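(* Let $\Bbbk$ be an algebraically closed field of characteristic $0$, let $n$ be an odd positive integer, let $G=\mathbb{Z}_n\times\mathbb{Z}_n$, and let $\triangleleft$ be an action of $C_2$ on $G$. (1) If $\triangleleft$ is such that $G_{0,-1}=0$, then $\mathrm{Ext}_{[\triangleleft]}(\Bbbk C_2,\Bbbk^G)$ has a unique Hopf algebra up to isomorphism, namely the group algebra $\Bbbk[G\rtimes C_2]$, where $G\rtimes C_2$ is the semidirect product with respect to $\triangleleft$. (2) If $\triangleleft$ is such that $G_{0,-1}\neq0$, then the isomorphism types of Hopf algebras in $\mathrm{Ext}_{[\triangleleft]}(\Bbbk C_2,\Bbbk^G)$ correspond bijectively to the subgroups of $\mathbb{Z}_{n(\triangleleft)}$. The trivial subgroup of $\mathbb{Z}_{n(\triangleleft)}$ corresponds to a unique trivial Hopf algebra, $\Bbbk[G\rtimes C_2]$.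
   Context: $C_2=\langle t\rangle$; an action is a right action by group automorphisms. Write $n=p_1^{e_1}\cdots p_m^{e_m}$ (prime decomposition) and let $G(i)\simeq\mathbb{Z}_{p_i^{e_i}}\oplus\mathbb{Z}_{p_i^{e_i}}$ be the $p_i$-primary component of $G$, which is invariant under $t$. Define $G_{0,-1}=\bigoplus\{G(i): t|_{G(i)}\neq\pm\mathrm{id}\}$ and $n(\triangleleft)=\prod\{p_i^{e_i}: t|_{G(i)}\neq\pm\mathrm{id}\}$. An extension of $\Bbbk C_2$ by $\Bbbk^G$ (functions on $G$) is a sequence of Hopf maps $\Bbbk^G\overset{\iota}{\rightarrowtail}H\overset{\pi}{\twoheadrightarrow}\Bbbk C_2$ with $\iota$ injective, $\pi$ surjective, $\iota(\Bbbk^G)$ normal in $H$ and $\ker\pi=\iota(\Bbbk^G)^+H$. Such $H$ is a crossed product of $\Bbbk C_2$ over $\Bbbk^G$, and the resulting action of $C_2$ on $\Bbbk^G$ has the form $(x.f)(a)=f(a\triangleleft x)$ for an action $\triangleleft$ of $C_2$ on $G$, called the action of the extension. $[\triangleleft]$ is the set of actions of $C_2$ on $G$ equivalent to $\triangleleft$ (conjugate under $\mathrm{Aut}(G)$), and $\mathrm{Ext}_{[\triangleleft]}(\Bbbk C_2,\Bbbk^G)$ is the set of equivalence classes of extensions whose action belongs to $[\triangleleft]$. Isomorphism is Hopf algebra isomorphism. A finite-dimensional Hopf algebra is trivial if it or its dual is a group algebra. *)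

(* Defs.v *)
From HB Require Import structures.
From mathcomp Require Import all_boot all_order all_algebra.
From mathcomp Require Import all_fingroup all_solvable.

Set Implicit Arguments.
Unset Strict Implicit.
Unset Printing Implicit Defensive.

Import GRing.Theory.
Local Open Scope ring_scope.

(* An element of the tensor product U (x) V is presented by a finite list of  *)
(* pure tensors, [:: (u1, v1); ...; (un, vn)] standing for the sum of the     *)
(* ui (x) vi. Two lists present the same element iff no bilinear map          *)
(* separates them (universal property of the tensor product); functions       *)
(* returning lists only matter up to this equality. Triple tensors are        *)
(* treated likewise, with trilinear maps.                                     *)
Section Tensor.
Variable k : fieldType.
Implicit Types U V W X : lmodType k.

Lemma linearZ_of U X (h : U -> X) : linear h -> forall a u, h (a *: u) = a *: h u.
Proof. exact: scalable_linear. Qed.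

Definition bilinear_map U V X (f : U -> V -> X) : Prop :=
  (forall v, linear (f ^~ v)) /\ (forall u, linear (f u)).

Definition trilinear_map U V W X (f : U -> V -> W -> X) : Prop :=
  [/\ forall v w, linear (fun u => f u v w),
      forall u w, linear (fun v => f u v w)
    & forall u v, linear (f u v)].

Definition tens_eq U V (s t : seq (U * V)) : Prop :=
  forall X (f : U -> V -> X), bilinear_map f ->
    \sum_(i <- s) f i.1 i.2 = \sum_(i <- t) f i.1 i.2.

Definition tens_eq3 U V W (s t : seq (U * V * W)) : Prop :=
  forall X (f : U -> V -> W -> X), trilinear_map f ->
    \sum_(i <- s) f i.1.1 i.1.2 i.2 = \sum_(i <- t) f i.1.1 i.1.2 i.2.

End Tensor.

(* comul x lists pure tensors whose sum is Delta(x) = x_(1) (x) x_(2).        *)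
HB.mixin Record Algebra_isHopf (k : fieldType) H of GRing.Algebra k H := {
  comul : H -> seq (H * H);
  counit : H -> k;
  antipode : H -> H;
  comul_linear : forall (a : k) (x y : H),
    tens_eq (comul (a *: x + y))
            ([seq (a *: u.1, u.2) | u <- comul x] ++ comul y);
  comulA : forall x : H,
    tens_eq3 [seq (v.1, v.2, u.2) | u <- comul x, v <- comul u.1]
             [seq (u.1, v.1, v.2) | u <- comul x, v <- comul u.2];
  counitl : forall x : H, \sum_(u <- comul x) counit u.1 *: u.2 = x;
  counitr : forall x : H, \sum_(u <- comul x) counit u.2 *: u.1 = x;
  comul1 : tens_eq (comul 1) [:: (1, 1)];
  comulM : forall x y : H,
    tens_eq (comul (x * y))
            [seq (u.1 * v.1, u.2 * v.2) | u <- comul x, v <- comul y];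
  counit_linear : scalar counit;
  counit1 : counit 1 = 1;
  counitM : {morph counit : x y / x * y};
  antipode_linear : linear antipode;
  antipodel : forall x : H,
    \sum_(u <- comul x) antipode u.1 * u.2 = (counit x)%:A;
  antipoder : forall x : H,
    \sum_(u <- comul x) u.1 * antipode u.2 = (counit x)%:A
}.

#[short(type="hopfAlgType")]
HB.structure Definition HopfAlgebra (k : fieldType) :=
  {H of Algebra_isHopf k H & GRing.Algebra k H}.

(* The group algebra k[F]: f stands for the sum of the f x * x.               *)
Definition group_alg (k : fieldType) (F : finGroupType) := {ffun F -> k}.

Section GroupAlgebra.
Variables (k : fieldType) (F : finGroupType).
Local Notation kF := (group_alg k F).
HB.instance Definition _ := GRing.Lmodule.copy kF {ffun F -> k^o}.
Implicit Types (f g : kF) (x y : F).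

Definition galg_of x : kF := [ffun y => (y == x)%:R].

Definition galg_mul f g : kF :=
  [ffun x => \sum_y f y * g (y^-1 * x)%g].

Lemma galg_expand f : f = \sum_x f x *: galg_of x.
Proof.
apply/ffunP=> y; rewrite sum_ffunE (bigD1 y) //= !ffunE eqxx.
rewrite big1 ?addr0 ?[_ *: _]mulr1 // => x /negPf nxy.
by rewrite !ffunE eq_sym nxy [_ *: _]mulr0.
Qed.

Fact galg_mulA : associative galg_mul.
Proof.
move=> f g h; apply/ffunP=> x; rewrite !ffunE.
under eq_bigr => y _ do rewrite ffunE mulr_sumr.
under [RHS]eq_bigr => y _ do rewrite ffunE mulr_suml.
rewrite [RHS]exchange_big /=; apply: eq_bigr => y _.
rewrite [RHS](reindex_inj (mulgI y)) /=; apply: eq_bigr => z _.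
by rewrite mulrA mulKg invMg mulgA.
Qed.

Fact galg_mul1 : left_id (galg_of 1%g) galg_mul.
Proof.
move=> f; apply/ffunP=> x; rewrite ffunE (bigD1 1%g) //= ffunE eqxx.
rewrite invg1 mul1g mul1r big1 ?addr0 // => y /negPf ny.
by rewrite ffunE ny mul0r.
Qed.

Fact galg_mulr1 : right_id (galg_of 1%g) galg_mul.
Proof.
move=> f; apply/ffunP=> x; rewrite ffunE (bigD1 x) //= ffunE mulVg eqxx.
rewrite mulr1 big1 ?addr0 // => y nyx.
by rewrite ffunE -eq_mulVg1 (negPf nyx) mulr0.
Qed.

Fact galg_mulDl : left_distributive galg_mul +%R.
Proof.
move=> f g h; apply/ffunP=> x; rewrite !ffunE -big_split.
by apply: eq_bigr => y _; rewrite ffunE mulrDl.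
Qed.

Fact galg_mulDr : right_distributive galg_mul +%R.
Proof.
move=> f g h; apply/ffunP=> x; rewrite !ffunE -big_split.
by apply: eq_bigr => y _; rewrite ffunE mulrDr.
Qed.

Fact galg_1neq0 : galg_of 1%g != 0.
Proof. by apply/eqP=> /ffunP/(_ 1%g)/eqP; rewrite !ffunE eqxx oner_eq0. Qed.

HB.instance Definition _ := GRing.Zmodule_isNzRing.Build kF
  galg_mulA galg_mul1 galg_mulr1 galg_mulDl galg_mulDr galg_1neq0.

Fact galg_scaleAl a f g : a *: (f * g) = (a *: f) * g.
Proof.
apply/ffunP=> x; rewrite !ffunE [_ *: _]mulr_sumr.
by apply: eq_bigr => y _; rewrite ffunE mulrA.
Qed.

HB.instance Definition _ := GRing.Lmodule_isLalgebra.Build k kF galg_scaleAl.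

Fact galg_scaleAr a f g : a *: (f * g) = f * (a *: g).
Proof.
apply/ffunP=> x; rewrite !ffunE [_ *: _]mulr_sumr.
by apply: eq_bigr => y _; rewrite ffunE mulrCA.
Qed.

HB.instance Definition _ := GRing.Lalgebra_isAlgebra.Build k kF galg_scaleAr.

Lemma galg_ofM x y : galg_of x * galg_of y = galg_of (x * y)%g.
Proof.
apply/ffunP=> z; rewrite !ffunE (bigD1 x) //= !ffunE eqxx mul1r.
rewrite big1 ?addr0 => [|u /negPf nux]; last by rewrite !ffunE nux mul0r.
by rewrite (can2_eq (mulKVg x) (mulKg x)).
Qed.

Lemma galg_mulE f g :
  f * g = \sum_x \sum_y (f x * g y) *: galg_of (x * y)%g.
Proof.
rewrite {1}[f]galg_expand mulr_suml; apply: eq_bigr => x _.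
rewrite {1}[g]galg_expand mulr_sumr; apply: eq_bigr => y _.
by rewrite -scalerAl -scalerAr scalerA galg_ofM.
Qed.

Definition galg_comul f : seq (kF * kF) :=
  [seq (f x *: galg_of x, galg_of x) | x <- enum F].

Definition galg_counit f : k := \sum_x f x.

Definition galg_antipode f : kF := [ffun x => f x^-1%g].

Lemma sum_galg_comul (X : nmodType) (h : kF -> kF -> X) f :
  \sum_(u <- galg_comul f) h u.1 u.2
    = \sum_x h (f x *: galg_of x) (galg_of x).
Proof. by rewrite big_map big_enum. Qed.

Lemma sum_galg_of (X : lmodType k) (h : F -> X) x :
  \sum_y galg_of x y *: h y = h x.
Proof.
rewrite (bigD1 x) //= ffunE eqxx scale1r big1 ?addr0 // => y /negPf ny.
by rewrite ffunE ny scale0r.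
Qed.

Lemma sum_galg_of_r (h : F -> k) x :
  \sum_y galg_of x y * h y = h x.
Proof. exact: (@sum_galg_of k^o). Qed.

Lemma sum_galg_bilin (X : lmodType k) (h : kF -> kF -> X) f :
  bilinear_map h ->
  \sum_(u <- galg_comul f) h u.1 u.2
    = \sum_x f x *: h (galg_of x) (galg_of x).
Proof.
move=> [hl _]; rewrite sum_galg_comul; apply: eq_bigr => x _.
exact: (linearZ_of (hl _)).
Qed.

Fact galg_comul_linear a f g :
  tens_eq (galg_comul (a *: f + g))
          ([seq (a *: u.1, u.2) | u <- galg_comul f] ++ galg_comul g).
Proof.
move=> X h hb; rewrite big_cat [in RHS]big_map /= !sum_galg_bilin //.
under [X in _ = X + _]eq_bigr => u _ do rewrite (linearZ_of (hb.1 _)).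
rewrite -scaler_sumr sum_galg_bilin // scaler_sumr -big_split.
by apply: eq_bigr => x _; rewrite !ffunE scalerDl scalerA.
Qed.

Fact galg_comulA f :
  tens_eq3 [seq (v.1, v.2, u.2) | u <- galg_comul f, v <- galg_comul u.1]
           [seq (u.1, v.1, v.2) | u <- galg_comul f, v <- galg_comul u.2].
Proof.
move=> X h [h1 h2 h3]; rewrite !big_allpairs_dep /=.
rewrite (sum_galg_comul (fun a b =>
  \sum_(v <- galg_comul a) h v.1 v.2 b)).
rewrite (sum_galg_comul (fun a b =>
  \sum_(v <- galg_comul b) h a v.1 v.2)).
apply: eq_bigr => x _.
rewrite (@sum_galg_bilin _ (fun a b => h a b (galg_of x))); last first.
  by split=> ?; [apply: h1 | apply: h2].
rewrite (@sum_galg_bilin _ (h (f x *: galg_of x))); last first.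
  by split=> ?; [apply: h2 | apply: h3].
rewrite sum_galg_of (linearZ_of (h1 _ _)).
under eq_bigr => y _ do rewrite ffunE -[_ *: _ in X in X *: _]/(_ * _) -scalerA.
by rewrite -scaler_sumr sum_galg_of.
Qed.

Lemma galg_counit_linear : scalar galg_counit.
Proof.
move=> a f g; rewrite /galg_counit mulr_sumr -big_split.
by apply: eq_bigr => x _; rewrite !ffunE.
Qed.

Lemma galg_counit_of x : galg_counit (galg_of x) = 1.
Proof.
rewrite /galg_counit (bigD1 x) //= ffunE eqxx big1 ?addr0 // => y /negPf ny.
by rewrite ffunE ny.
Qed.

Fact galg_counitl f : \sum_(u <- galg_comul f) galg_counit u.1 *: u.2 = f.
Proof.
rewrite (sum_galg_comul (fun a b => galg_counit a *: b)) [RHS]galg_expand.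
apply: eq_bigr => x _.
by rewrite (scalable_linear galg_counit_linear) galg_counit_of /= mulr1.
Qed.

Fact galg_counitr f : \sum_(u <- galg_comul f) galg_counit u.2 *: u.1 = f.
Proof.
rewrite (sum_galg_comul (fun a b => galg_counit b *: a)) [RHS]galg_expand.
by apply: eq_bigr => x _; rewrite galg_counit_of scale1r.
Qed.

Fact galg_comul1 : tens_eq (galg_comul 1) [:: (1, 1)].
Proof. by move=> X h hb; rewrite sum_galg_bilin // sum_galg_of big_seq1. Qed.

Lemma sum_galg_mul (X : lmodType k) (h : F -> X) f g :
  \sum_x (f * g) x *: h x = \sum_x \sum_y (f x * g y) *: h (x * y)%g.
Proof.
under eq_bigr => x _ do rewrite ffunE scaler_suml.
rewrite exchange_big; apply: eq_bigr => x _ /=.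
by rewrite (reindex_inj (mulgI x)); apply: eq_bigr => y _; rewrite mulKg.
Qed.

Fact galg_comulM f g :
  tens_eq (galg_comul (f * g))
    [seq (u.1 * v.1, u.2 * v.2) | u <- galg_comul f, v <- galg_comul g].
Proof.
move=> X h hb; rewrite sum_galg_bilin // sum_galg_mul big_allpairs_dep /=.
rewrite (sum_galg_comul (fun a b =>
  \sum_(v <- galg_comul g) h (a * v.1) (b * v.2))).
apply: eq_bigr => x _.
rewrite (sum_galg_comul (fun a b => h (f x *: galg_of x * a) (galg_of x * b))).
apply: eq_bigr => y _.
rewrite -scalerAl -scalerAr scalerA galg_ofM.
by rewrite (linearZ_of (hb.1 _)).
Qed.

Fact galg_counit1 : galg_counit 1 = 1.
Proof. exact: galg_counit_of. Qed.

Fact galg_counitM : {morph galg_counit : f g / f * g}.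
Proof.
move=> f g; rewrite /galg_counit mulr_suml.
have := @sum_galg_mul k^o (fun=> 1) f g; rewrite /GRing.scale /=.
under eq_bigr => x _ do rewrite mulr1.
move=> ->; apply: eq_bigr => x _; rewrite mulr_sumr.
by apply: eq_bigr => y _; rewrite mulr1.
Qed.

Fact galg_antipode_linear : linear galg_antipode.
Proof. by move=> a f g; apply/ffunP=> x; rewrite !ffunE. Qed.

Lemma galg_antipode_of x : galg_antipode (galg_of x) = galg_of x^-1%g.
Proof.
by apply/ffunP=> y; rewrite !ffunE (can2_eq (@invgK F) (@invgK F)).
Qed.

Fact galg_antipodel f :
  \sum_(u <- galg_comul f) galg_antipode u.1 * u.2 = (galg_counit f)%:A.
Proof.
rewrite (sum_galg_comul (fun a b => galg_antipode a * b)) scaler_suml.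
apply: eq_bigr => x _; rewrite (linearZ_of galg_antipode_linear).
by rewrite galg_antipode_of -scalerAl galg_ofM mulVg.
Qed.

Fact galg_antipoder f :
  \sum_(u <- galg_comul f) u.1 * galg_antipode u.2 = (galg_counit f)%:A.
Proof.
rewrite (sum_galg_comul (fun a b => a * galg_antipode b)) scaler_suml.
apply: eq_bigr => x _.
by rewrite galg_antipode_of -scalerAl galg_ofM mulgV.
Qed.

HB.instance Definition _ := Algebra_isHopf.Build k kF
  galg_comul_linear galg_comulA galg_counitl galg_counitr galg_comul1
  galg_comulM galg_counit_linear galg_counit1 galg_counitM
  galg_antipode_linear galg_antipodel galg_antipoder.

End GroupAlgebra.

(* The algebra k^G of functions on G, with Delta(f)(a, b) = f(ab), that is    *)
(* Delta(f) = sum_a e_a (x) f(a -), where e_a is the indicator of a.          *)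
Definition fun_alg (k : fieldType) (G : finGroupType) := {ffun G -> k}.

Section FunctionAlgebra.
Variables (k : fieldType) (G : finGroupType).
Local Notation kG := (fun_alg k G).
HB.instance Definition _ := GRing.Lmodule.copy kG {ffun G -> k^o}.
Implicit Types (f g : kG) (a b : G).

Definition falg_delta a : kG := [ffun b => (b == a)%:R].
Definition falg_one : kG := [ffun=> 1].
Definition falg_mul f g : kG := [ffun a => f a * g a].

Fact falg_mulA : associative falg_mul.
Proof. by move=> f g h; apply/ffunP=> a; rewrite !ffunE mulrA. Qed.
Fact falg_mul1 : left_id falg_one falg_mul.
Proof. by move=> f; apply/ffunP=> a; rewrite !ffunE mul1r. Qed.
Fact falg_mulr1 : right_id falg_one falg_mul.
Proof. by move=> f; apply/ffunP=> a; rewrite !ffunE mulr1. Qed.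
Fact falg_mulDl : left_distributive falg_mul +%R.
Proof. by move=> f g h; apply/ffunP=> a; rewrite !ffunE mulrDl. Qed.
Fact falg_mulDr : right_distributive falg_mul +%R.
Proof. by move=> f g h; apply/ffunP=> a; rewrite !ffunE mulrDr. Qed.
Fact falg_1neq0 : falg_one != 0.
Proof. by apply/eqP=> /ffunP/(_ 1%g)/eqP; rewrite !ffunE oner_eq0. Qed.

HB.instance Definition _ := GRing.Zmodule_isNzRing.Build kG
  falg_mulA falg_mul1 falg_mulr1 falg_mulDl falg_mulDr falg_1neq0.

Fact falg_scaleAl c f g : c *: (f * g) = (c *: f) * g.
Proof. by apply/ffunP=> a; rewrite !ffunE [LHS]mulrA. Qed.

HB.instance Definition _ := GRing.Lmodule_isLalgebra.Build k kG falg_scaleAl.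

Fact falg_scaleAr c f g : c *: (f * g) = f * (c *: g).
Proof. by apply/ffunP=> a; rewrite !ffunE [LHS]mulrCA. Qed.

HB.instance Definition _ := GRing.Lalgebra_isAlgebra.Build k kG falg_scaleAr.

Definition falg_shift a f : kG := [ffun b => f (a * b)%g].

Definition falg_comul f : seq (kG * kG) :=
  [seq (falg_delta a, falg_shift a f) | a <- enum G].

Definition falg_counit f : k := f 1%g.

Definition falg_antipode f : kG := [ffun a => f a^-1%g].

Lemma sum_falg_comul (X : nmodType) (h : kG -> kG -> X) f :
  \sum_(u <- falg_comul f) h u.1 u.2
    = \sum_a h (falg_delta a) (falg_shift a f).
Proof. by rewrite big_map big_enum. Qed.

Lemma falg_shift_linear a : linear (falg_shift a).
Proof. by move=> c f g; apply/ffunP=> b; rewrite !ffunE. Qed.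

Lemma falg_expand f : f = \sum_a f a *: falg_delta a.
Proof.
apply/ffunP=> b; rewrite sum_ffunE (bigD1 b) //= !ffunE eqxx.
rewrite big1 ?addr0 ?[_ *: _]mulr1 // => x /negPf nxy.
by rewrite !ffunE eq_sym nxy [_ *: _]mulr0.
Qed.

Fact falg_comul_linear c f g :
  tens_eq (falg_comul (c *: f + g))
          ([seq (c *: u.1, u.2) | u <- falg_comul f] ++ falg_comul g).
Proof.
move=> X h [hl hr]; rewrite big_cat [in RHS]big_map /=.
rewrite (sum_falg_comul (fun u v => h (c *: u) v)) !sum_falg_comul -big_split.
apply: eq_bigr => a _ /=.
by rewrite falg_shift_linear hr (linearZ_of (hl _)).
Qed.

Fact falg_comulA f :
  tens_eq3 [seq (v.1, v.2, u.2) | u <- falg_comul f, v <- falg_comul u.1]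
           [seq (u.1, v.1, v.2) | u <- falg_comul f, v <- falg_comul u.2].
Proof.
move=> X h [h1 h2 h3]; rewrite !big_allpairs_dep /=.
rewrite (sum_falg_comul (fun p q =>
  \sum_(v <- falg_comul p) h v.1 v.2 q)).
rewrite (sum_falg_comul (fun p q =>
  \sum_(v <- falg_comul q) h p v.1 v.2)).
under eq_bigr => a _ do rewrite (sum_falg_comul (fun u v => h u v _)).
under [RHS]eq_bigr => a _ do rewrite sum_falg_comul.
rewrite exchange_big; apply: eq_bigr => a _ /=.
rewrite (reindex_inj (mulgI a)); apply: eq_bigr => b _ /=; congr h.
  by apply/ffunP=> c; rewrite !ffunE (inj_eq (mulgI a)).
by apply/ffunP=> c; rewrite !ffunE mulgA.
Qed.

Fact falg_counitl f : \sum_(u <- falg_comul f) falg_counit u.1 *: u.2 = f.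
Proof.
rewrite (sum_falg_comul (fun p q => falg_counit p *: q)) (bigD1 1%g) //=.
rewrite big1 => [|a /negPf na]; last first.
  by rewrite /falg_counit ffunE eq_sym na scale0r.
rewrite /falg_counit ffunE eqxx scale1r addr0.
by apply/ffunP=> a; rewrite ffunE mul1g.
Qed.

Fact falg_counitr f : \sum_(u <- falg_comul f) falg_counit u.2 *: u.1 = f.
Proof.
rewrite (sum_falg_comul (fun p q => falg_counit q *: p)) [RHS]falg_expand.
by apply: eq_bigr => a _; rewrite /falg_counit ffunE mulg1.
Qed.

Fact falg_comul1 : tens_eq (falg_comul 1) [:: (1, 1)].
Proof.
move=> X h [hl hr]; rewrite big_seq1 sum_falg_comul /=.
have -> : \sum_a h (falg_delta a) (falg_shift a 1)
         = \sum_a h (falg_delta a) 1.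
  by apply: eq_bigr => a _; congr h; apply/ffunP=> b; rewrite !ffunE.
pose h1 := GRing.isLinear.Build _ _ _ _ (h^~ 1) (hl 1).
pose L : {linear kG -> X} := HB.pack (h^~ 1) h1.
rewrite -[LHS](raddf_sum L) /=; congr h.
rewrite [RHS]falg_expand; apply: eq_bigr => a _.
by rewrite ffunE scale1r.
Qed.

Lemma falg_deltaM a b :
  falg_delta a * falg_delta b = (a == b)%:R *: falg_delta a.
Proof.
apply/ffunP=> c; rewrite !ffunE [in RHS]/GRing.scale /=.
by case: (c =P a) => [->|_]; rewrite ?mul1r ?mulr1 ?mul0r ?mulr0.
Qed.

Fact falg_comulM f g :
  tens_eq (falg_comul (f * g))
    [seq (u.1 * v.1, u.2 * v.2) | u <- falg_comul f, v <- falg_comul g].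
Proof.
move=> X h [hl hr]; rewrite sum_falg_comul big_allpairs_dep /=.
rewrite (sum_falg_comul (fun p q =>
  \sum_(v <- falg_comul g) h (p * v.1) (q * v.2))).
apply: eq_bigr => a _.
rewrite (sum_falg_comul (fun u v => h (falg_delta a * u) (falg_shift a f * v))).
rewrite (bigD1 a) //= big1 => [|b]; last first.
  rewrite eq_sym => /negPf nab.
  by rewrite falg_deltaM nab (linearZ_of (hl _)) scale0r.
rewrite addr0 falg_deltaM eqxx scale1r; congr h.
by apply/ffunP=> b; rewrite !ffunE.
Qed.

Fact falg_counit_linear : scalar falg_counit.
Proof. by move=> c f g; rewrite /falg_counit !ffunE. Qed.

Fact falg_counit1 : falg_counit 1 = 1.
Proof. by rewrite /falg_counit ffunE. Qed.

Fact falg_counitM : {morph falg_counit : f g / f * g}.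
Proof. by move=> f g; rewrite /falg_counit ffunE. Qed.

Fact falg_antipode_linear : linear falg_antipode.
Proof. by move=> c f g; apply/ffunP=> a; rewrite !ffunE. Qed.

Fact falg_antipodel f :
  \sum_(u <- falg_comul f) falg_antipode u.1 * u.2 = (falg_counit f)%:A.
Proof.
rewrite (sum_falg_comul (fun p q => falg_antipode p * q)).
apply/ffunP=> b; rewrite sum_ffunE !ffunE [RHS]mulr1.
rewrite (bigD1 b^-1%g) //= big1 => [|a na]; last first.
  by rewrite !ffunE eq_sym (negPf na) mul0r.
by rewrite !ffunE eqxx mul1r addr0 mulVg.
Qed.

Fact falg_antipoder f :
  \sum_(u <- falg_comul f) u.1 * falg_antipode u.2 = (falg_counit f)%:A.
Proof.
rewrite (sum_falg_comul (fun p q => p * falg_antipode q)).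
apply/ffunP=> b; rewrite sum_ffunE !ffunE [RHS]mulr1.
rewrite (bigD1 b) //= big1 => [|a na].
  by rewrite !ffunE eqxx mul1r addr0 mulgV.
by rewrite !ffunE eq_sym (negPf na) mul0r.
Qed.

HB.instance Definition _ := Algebra_isHopf.Build k kG
  falg_comul_linear falg_comulA falg_counitl falg_counitr falg_comul1
  falg_comulM falg_counit_linear falg_counit1 falg_counitM
  falg_antipode_linear falg_antipodel falg_antipoder.

End FunctionAlgebra.

Section HopfMaps.
Variable k : fieldType.
Implicit Types A B H K : hopfAlgType k.

(* Bialgebra maps automatically commute with the antipodes.                   *)
Definition hopf_map H K (f : {lrmorphism H -> K}) : Prop :=
  (forall x, tens_eq (comul (f x)) [seq (f u.1, f u.2) | u <- comul x]) /\
  (forall x, counit (f x) = counit x).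

Definition hopf_iso H K : Prop :=
  exists2 f : {lrmorphism H -> K}, hopf_map f & bijective f.

(* K is the dual Hopf algebra of H: p identifies K with the space of linear   *)
(* forms on H, and the structure maps of K with the transposes of those of H. *)
Definition hopf_dual K H : Prop :=
  exists p : K -> {scalar H},
  [/\ (forall a x y h, p (a *: x + y) h = a * p x h + p y h),
      (forall f : {scalar H}, exists! x, p x =1 f),
      (forall x y h, p (x * y) h = \sum_(u <- comul h) p x u.1 * p y u.2) /\
        (forall h, p 1 h = counit h),
      (forall x h g, p x (h * g) = \sum_(u <- comul x) p u.1 h * p u.2 g) /\
        (forall x, p x 1 = counit x)
    & forall x h, p (antipode x) h = p x (antipode h)].

Definition is_group_algebra H : Prop :=
  exists F : finGroupType, hopf_iso H (group_alg k F).

Definition trivial_hopf H : Prop :=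
  is_group_algebra H \/
  exists2 K : hopfAlgType k, hopf_dual K H & is_group_algebra K.

(* The image of i is stable under the left and right adjoint actions.         *)
Definition normal_image A H (i : {lrmorphism A -> H}) : Prop :=
  forall h a,
    (exists b, \sum_(u <- comul h) u.1 * i a * antipode u.2 = i b) /\
    (exists b, \sum_(u <- comul h) antipode u.1 * i a * u.2 = i b).

Definition hopf_extension A H B
    (i : {lrmorphism A -> H}) (p : {lrmorphism H -> B}) : Prop :=
  [/\ hopf_map i /\ hopf_map p, injective i, (forall b, exists h, p h = b),
      normal_image i
    & forall h, p h = 0 <->
        exists s : seq (A * H), all (fun u => counit u.1 == 0) s /\
          h = \sum_(u <- s) i u.1 * u.2].

(* c : B -> H exhibits H as a crossed product of B over the image of A: it is *)
(* a map of right B-comodules with convolution inverse c'.                    *)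
Definition cleaving H B (p : {lrmorphism H -> B}) (c c' : {linear B -> H}) :
    Prop :=
  [/\ forall b, tens_eq [seq (u.1, p u.2) | u <- comul (c b)]
                        [seq (c u.1, u.2) | u <- comul b],
      forall b, \sum_(u <- comul b) c u.1 * c' u.2 = (counit b)%:A
    & forall b, \sum_(u <- comul b) c' u.1 * c u.2 = (counit b)%:A].

End HopfMaps.

Section GroupExtensions.
Variables (k : fieldType) (F G : finGroupType).
Implicit Type to : groupAction [set: F] [set: G].

(* c' x is the inverse of c x for x in F, so the crossed product action of x  *)
(* on k^G is conjugation by c x, required to be (x.f)(a) = f(to a x).         *)
Definition extension_action (H : hopfAlgType k)
    (i : {lrmorphism fun_alg k G -> H}) (p : {lrmorphism H -> group_alg k F})
    to : Prop :=
  exists c c' : {linear group_alg k F -> H},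
    cleaving p c c' /\
    forall (x : F) (f : fun_alg k G),
      c (galg_of k x) * i f * c' (galg_of k x) = i [ffun a => f (to a x)].

Definition equiv_action to to' : Prop :=
  exists2 s : {perm G}, s \in Aut [set: G] &
    forall a x, s (to a x) = to' (s a) x.

(* H is the middle term of an extension representing a class in Ext_[to].     *)
Definition in_Ext to (H : hopfAlgType k) : Prop :=
  exists (i : {lrmorphism fun_alg k G -> H})
         (p : {lrmorphism H -> group_alg k F})
         (to' : groupAction [set: F] [set: G]),
    [/\ hopf_extension i p, extension_action i p to' & equiv_action to to'].

End GroupExtensions.

(* The cyclic group Z_n for n > 0, with its additive group law; unlike 'Z_n,  *)
(* it is the trivial group when n = 1.                                        *)
Definition Zn (n : nat) : finGroupType := 'I_n.-1.+1.

Definition C2 : finGroupType := Zn 2.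
Definition t2 : C2 := inord 1.

Definition ZnZn (n : nat) : finGroupType := (Zn n * Zn n)%type.

Section ActionInvariants.
Variables (n : nat) (to : groupAction [set: C2] [set: ZnZn n]).

Definition primary_comp (p : nat) : {set ZnZn n} := [set a | p.-elt a]%g.

Definition acts_pm_id (p : nat) : bool :=
  [forall a in primary_comp p, to a t2 == a] ||
  [forall a in primary_comp p, to a t2 == a^-1%g].

Definition G0m1 : {set ZnZn n} :=
  (\prod_(p <- primes n | ~~ acts_pm_id p) primary_comp p)%g.

Definition n_of_action : nat :=
  (\prod_(p <- primes n | ~~ acts_pm_id p) p ^ logn p n)%N.

End ActionInvariants.

(* Main.v *)
(* Let t be the generator of C2. In an extension H of k C2 by k^G, comparing
   coproducts shows that k^G is exactly the subalgebra of left coinvariants, so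
   H = k^G + k^G T for an invertible T with Delta T = sum tau(a, b) e_a T (x) e_b T
   and T^2 in k^G. As G is abelian of odd order and k is algebraically closed,
   rescaling T makes T^2 = 1 and tau an alternating bicharacter beta with
   beta(ta, tb) beta(a, b) = 1; conversely every such beta defines an extension.
   A Hopf isomorphism between two of these preserves k^G, because the only Hopf
   map k^G -> k C2 is trivial (|G| is odd), so it is induced by an automorphism
   of G matching the bicharacters.

   Splitting G into the parts fixed and inverted by t, beta amounts to a pairing
   between them; only the primes with t <> id, -id on G(p) contribute, where both
   parts are cyclic of order p^e. With generators u and v, beta is determined by
   z = beta(u, v), an arbitrary n(t)-th root of unity, and the automorphisms of G
   commuting with t replace z by its powers prime to n(t). Hence the isomorphism
   type is the subgroup generated by z. For beta = 1, the algebra is the group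
   algebra of the semidirect product, by an invariant self-duality of G. *)

From HB Require Import structures.
Require Import Defs.
From mathcomp Require Import all_boot all_order all_algebra.
From mathcomp Require Import all_fingroup all_solvable.
From mathcomp Require Import cyclotomic separable ring.
From mathcomp Require classical_sets.

Set Implicit Arguments.
Unset Strict Implicit.
Unset Printing Implicit Defensive.

Import GRing.Theory.
Local Open Scope ring_scope.

(** * Functionals and Sweedler sums *)

(** The rescaling of T rests on the commutator pairing tau(a,b) / tau(b,a), a bicharacter whose
    square root is its power (|G|+1)/2. Dividing tau by this root leaves a symmetric cocycle, a
    coboundary because k is algebraically closed. After that T^2 is a character of G, and a power of
    it corrects T so that T^2 = 1. Two obstacles shape the proof. H is not assumed
    finite-dimensional and tensors are only seen through multilinear maps, so coproducts are
    compared by testing them on coordinate functionals; where no coordinates exist yet, in the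
    determination of the coinvariants, a functional from Zorn's lemma replaces them. Moreover the
    section of p is a right comodule map, whereas coinvariants are found on the left, so the
    agreement of the two gradings has to be proved. To separate isomorphism types it suffices that
    the values of one bicharacter occur among those of the other: the orders of the two roots of
    unity then divide each other. *)

Section Separation.
Variables (k : fieldType) (V : lmodType k).

(* The middle term of an extension is not known to be finite-dimensional, so
   functionals separating its elements have to come from Zorn's lemma. *)
Lemma exists_functional (v : V) : v != 0 ->
  exists2 psi : V -> k, scalar psi & psi v = 1.
Proof.
move=> v0.
pose P (W : V -> Prop) :=
  (forall a x y, W x -> W y -> W (a *: x + y)) /\ ~ W v.
have [F FP totF|W [[WD Wv] maxW]] := @classical_sets.Zorn_bigcup V P.
  split=> [a x y [X FX Xx] [Y FY Yy]|[X FX Xv]]; last by case: (FP _ FX) => _; apply.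
  have [XY|YX] := totF _ _ FX FY.
    by exists Y => //; apply: (FP _ FY).1 => //; apply: XY.
  by exists X => //; apply: (FP _ FX).1 => //; apply: YX.
(* The empty chain has empty union, so [P] has to admit the empty set and the maximal [W] is not
   known to contain 0. *)
pose W0 x := W x \/ x = 0.
have W0D a x y : W0 x -> W0 y -> W0 (a *: x + y).
  move=> [Wx|->] [Wy|->]; rewrite ?scaler0 ?add0r ?addr0; [|  |by left|by right].
    by left; apply: WD.
  have W00 : W 0 by rewrite -(addNr x) -scaleN1r; apply: WD.
  by left; rewrite -[_ *: x]addr0; apply: WD.
have W0v : ~ W0 v by case=> // v00; rewrite v00 eqxx in v0.
have decomp h : exists c, W0 (h - c *: v).
  case: (boolp.pselect (W0 h)) => [Wh|nWh].
    by exists 0; rewrite scale0r subr0.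
  (* The span of [W0] and [h]. If it contains [v], then [h] is a multiple of [v] modulo [W0]; if
     not, it contradicts the maximality of [W]. *)
  pose B x := exists c, W0 (x - c *: h).
  case: (boolp.pselect (B v)) => [[c Bc]|nBv].
    have c0 : c != 0.
      by apply/eqP=> c0; apply: W0v; move: Bc; rewrite c0 scale0r subr0.
    exists c^-1; have -> : h - c^-1 *: v = (- c^-1) *: (v - c *: h) + 0.
      by rewrite addr0 scalerBr !scaleNr opprK addrC scalerA mulVf // scale1r.
    by apply: W0D => //; right.
  case: (maxW B) => //; last first.
    split=> // a x y [c Bx] [d By]; exists (a * c + d).
    rewrite scalerDl -scalerA opprD addrACA -scalerBr; exact: W0D.
  split=> [x Wx|BW]; first by exists 0; left; rewrite scale0r subr0.
  by apply: nWh; left; apply: BW; exists 1; right; rewrite scale1r subrr.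
have [psi psiP] := boolp.choice decomp.
have uniq h c : W0 (h - c *: v) -> psi h = c.
  move=> Wc; apply/eqP; rewrite -subr_eq0; apply/negP=> nz; apply: W0v.
  have -> : v = (psi h - c)^-1 *: ((-1) *: (h - psi h *: v) + (h - c *: v)) + 0.
    rewrite addr0 scaleN1r opprB -addrA addKr -scalerBl scalerA.
    by rewrite mulVf ?scale1r //; apply/negP.
  by apply: (W0D); [exact: W0D | right].
exists psi; last by apply: uniq; rewrite scale1r subrr; right.
move=> a x y; apply: uniq.
rewrite scalerDl -scalerA opprD addrACA -scalerBr; exact: W0D.
Qed.

End Separation.

Lemma linear_sum_of (k : fieldType) (U X : lmodType k) (h : U -> X) :
  linear h -> forall I (r : seq I) (P : pred I) (E : I -> U),
  h (\sum_(i <- r | P i) E i) = \sum_(i <- r | P i) h (E i).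
Proof.
move=> hl I r P E; pose h1 := GRing.isLinear.Build _ _ _ _ h hl.
exact: (raddf_sum (HB.pack h h1 : {linear U -> X})).
Qed.

Section Sweedler.
Variables (k : fieldType) (H : hopfAlgType k).
Implicit Types X : lmodType k.

Lemma sweedlerP X (f : H -> H -> X) : bilinear_map f ->
  forall a x y, \sum_(u <- comul (a *: x + y)) f u.1 u.2 =
    a *: (\sum_(u <- comul x) f u.1 u.2) + \sum_(u <- comul y) f u.1 u.2.
Proof.
move=> fb a x y; rewrite (comul_linear a x y _ _ fb) big_cat big_map /=.
by rewrite scaler_sumr; congr (_ + _); apply: eq_bigr => u _; rewrite (linearZ_of (fb.1 _)).
Qed.

Lemma sweedlerZ X (f : H -> H -> X) : bilinear_map f -> forall a x,
  \sum_(u <- comul (a *: x)) f u.1 u.2 = a *: (\sum_(u <- comul x) f u.1 u.2).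
Proof.
move=> fb; pose S x := \sum_(u <- comul x) f u.1 u.2.
have Sl : linear S by move=> a x y; rewrite /S (sweedlerP fb).
exact: (linearZ_of Sl).
Qed.

Lemma sweedler_coassoc X (f : H -> H -> H -> X) x : trilinear_map f ->
  \sum_(u <- comul x) \sum_(v <- comul u.1) f v.1 v.2 u.2 =
  \sum_(u <- comul x) \sum_(v <- comul u.2) f u.1 v.1 v.2.
Proof.
by move=> ft; have := comulA x _ _ ft; rewrite !big_allpairs_dep.
Qed.

Lemma sweedler_mul X (f : H -> H -> X) x y : bilinear_map f ->
  \sum_(u <- comul (x * y)) f u.1 u.2 =
  \sum_(u <- comul x) \sum_(v <- comul y) f (u.1 * v.1) (u.2 * v.2).
Proof. by move=> fb; rewrite (comulM x y _ _ fb) big_allpairs_dep. Qed.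

Lemma sweedler1 X (f : H -> H -> X) : bilinear_map f ->
  \sum_(u <- comul (1 : H)) f u.1 u.2 = f 1 1.
Proof. by move=> fb; rewrite (comul1 _ _ fb) big_seq1. Qed.

End Sweedler.

(** * The Hopf algebra of a twist *)

(** A 1-cocycle of [F] with values in the alternating bicharacters of [G], as [tw_coc] and [tw_id]
    express. For [C2] the only cocycle condition left is that of x = y = [t2], so the datum is a
    single bicharacter. *)
Record twist (k : fieldType) (F G : finGroupType)
    (to : groupAction [set: F] [set: G]) := Twist {
  tw :> F -> G -> G -> k;
  twMl : forall x a b c, tw x (a * b)%g c = tw x a c * tw x b c;
  twMr : forall x a b c, tw x a (b * c)%g = tw x a b * tw x a c;
  tw_alt : forall x a, tw x a a = 1;
  tw_coc : forall x y a b, tw (x * y)%g a b = tw x a b * tw y (to a x) (to b x);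
  tw_id : forall a b, tw 1%g a b = 1
}.

(* f stands for the sum of the f (x, a) * e_a x, where e_a x * e_b y is
   e_a (x * y) if to a x = b and 0 otherwise, and Delta (e_a x) is the sum over
   b * c = a of D x b c * e_b x (x) e_c x. *)
Definition twalg (k : fieldType) (F G : finGroupType)
  (to : groupAction [set: F] [set: G]) of twist k to := {ffun F * G -> k}.

Section TwistedAlgebra.
Variables (k : fieldType) (F G : finGroupType).
Variables (to : groupAction [set: F] [set: G]) (D : twist k to).
Local Notation kT := (twalg D).
HB.instance Definition _ := GRing.Lmodule.copy kT {ffun F * G -> k^o}.
Implicit Types (f g h : kT) (x y z : F) (a b c : G).

Lemma gact_morph x : {morph to^~ x : a b / (a * b)%g}.
Proof. by move=> a b; apply: gactM; rewrite inE. Qed.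

Lemma gact_one x : to 1%g x = 1%g.
Proof. by apply: gact1; rewrite inE. Qed.

Lemma gact_inv x a : to a^-1%g x = (to a x)^-1%g.
Proof. by apply: gactV; rewrite inE. Qed.

Lemma gact_comp a x y : to a (x * y)%g = to (to a x) y.
Proof. by rewrite actMin ?inE. Qed.

Lemma gact_inj x : injective (to^~ x).
Proof. exact: act_inj. Qed.

Lemma tw_neq0 x a b : D x a b != 0.
Proof.
apply/eqP=> D0; have := tw_id D a b; rewrite -(mulgV x) tw_coc D0 mul0r.
by move/eqP; rewrite eq_sym oner_eq0.
Qed.

Lemma twg1 x a : D x a 1%g = 1.
Proof. by apply: (mulfI (tw_neq0 x a 1)); rewrite -twMr mulg1 mulr1. Qed.

Lemma tw1g x a : D x 1%g a = 1.
Proof. by apply: (mulfI (tw_neq0 x 1 a)); rewrite -twMl mulg1 mulr1. Qed.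

Lemma twgV x a : D x a a^-1%g = 1.
Proof. by rewrite -[LHS]mul1r -{1}(tw_alt D x a) -twMr mulgV twg1. Qed.

Definition twe x a : kT := [ffun p => (p == (x, a))%:R].

Definition tw_one : kT := [ffun p => (p.1 == 1%g)%:R].

Definition tw_mul f g : kT :=
  [ffun p => \sum_x f (x, p.2) * g (x^-1 * p.1, to p.2 x)%g].

Lemma twe_expand f : f = \sum_x \sum_a f (x, a) *: twe x a.
Proof.
rewrite pair_big; apply/ffunP=> p; rewrite sum_ffunE (bigD1 p) //= !ffunE.
rewrite -surjective_pairing eqxx big1 ?addr0 ?[_ *: _]mulr1 // => q /negPf nqp.
by rewrite !ffunE -surjective_pairing eq_sym nqp [_ *: _]mulr0.
Qed.

Fact tw_mulA : associative tw_mul.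
Proof.
move=> f g h; apply/ffunP=> -[z a]; rewrite !ffunE /=.
under eq_bigr => x _ do rewrite ffunE mulr_sumr.
under [RHS]eq_bigr => x _ do rewrite ffunE mulr_suml.
rewrite [RHS]exchange_big /=; apply: eq_bigr => x _.
rewrite [RHS](reindex_inj (mulgI x)) /=; apply: eq_bigr => y _.
by rewrite mulrA mulKg invMg mulgA gact_comp.
Qed.

Fact tw_mul1 : left_id tw_one tw_mul.
Proof.
move=> f; apply/ffunP=> -[x a]; rewrite ffunE (bigD1 1%g) //= ffunE eqxx.
rewrite invg1 mul1g act1 mul1r big1 ?addr0 // => y /negPf ny.
by rewrite ffunE ny mul0r.
Qed.

Fact tw_mulr1 : right_id tw_one tw_mul.
Proof.
move=> f; apply/ffunP=> -[x a]; rewrite ffunE (bigD1 x) //= ffunE /= mulVg eqxx.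
rewrite mulr1 big1 ?addr0 // => y nyx.
by rewrite ffunE /= -eq_mulVg1 (negPf nyx) mulr0.
Qed.

Fact tw_mulDl : left_distributive tw_mul +%R.
Proof.
move=> f g h; apply/ffunP=> p; rewrite !ffunE -big_split.
by apply: eq_bigr => x _; rewrite ffunE mulrDl.
Qed.

Fact tw_mulDr : right_distributive tw_mul +%R.
Proof.
move=> f g h; apply/ffunP=> p; rewrite !ffunE -big_split.
by apply: eq_bigr => x _; rewrite ffunE mulrDr.
Qed.

Fact tw_1neq0 : tw_one != 0.
Proof. by apply/eqP=> /ffunP/(_ (1%g, 1%g))/eqP; rewrite !ffunE eqxx oner_eq0. Qed.

HB.instance Definition _ := GRing.Zmodule_isNzRing.Build kT
  tw_mulA tw_mul1 tw_mulr1 tw_mulDl tw_mulDr tw_1neq0.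

Fact tw_scaleAl (s : k) f g : s *: (f * g) = (s *: f) * g.
Proof.
apply/ffunP=> p; rewrite !ffunE [_ *: _]mulr_sumr.
by apply: eq_bigr => x _; rewrite ffunE mulrA.
Qed.

HB.instance Definition _ := GRing.Lmodule_isLalgebra.Build k kT tw_scaleAl.

Fact tw_scaleAr (s : k) f g : s *: (f * g) = f * (s *: g).
Proof.
apply/ffunP=> p; rewrite !ffunE [_ *: _]mulr_sumr.
by apply: eq_bigr => x _; rewrite ffunE mulrCA.
Qed.

HB.instance Definition _ := GRing.Lalgebra_isAlgebra.Build k kT tw_scaleAr.

Lemma tweM x a y b :
  twe x a * twe y b = if to a x == b then twe (x * y)%g a else 0.
Proof.
apply/ffunP=> -[z c]; rewrite ffunE (bigD1 x) //= big1 ?addr0 => [|x' /negPf nx].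
  rewrite !ffunE !xpair_eqE eqxx /= -(inj_eq (mulgI x)) mulKVg.
  case: (c =P a) => [->|/eqP/negPf nca]; last first.
    by rewrite mul0r; case: ifP => _; rewrite !ffunE // xpair_eqE nca andbF.
  by rewrite mul1r; case: ifP => _; rewrite ?andbF // ffunE // xpair_eqE eqxx.
by rewrite !ffunE xpair_eqE nx mul0r.
Qed.

Lemma tw1E : 1 = \sum_a twe 1 a :> kT.
Proof.
apply/ffunP=> -[x a]; rewrite sum_ffunE (bigD1 a) //= big1 => [|b /negPf nb].
  by rewrite !ffunE /= xpair_eqE eqxx andbT addr0.
by rewrite ffunE xpair_eqE (eq_sym a) nb andbF.
Qed.

Definition tw_comul f : seq (kT * kT) :=
  [seq ((f (q.1, q.2.1 * q.2.2)%g * D q.1 q.2.1 q.2.2) *: twe q.1 q.2.1,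
        twe q.1 q.2.2) | q : F * (G * G)].

Definition tw_counit f : k := \sum_x f (x, 1%g).

(** It sends a basis vector over [x] to one over [x^-1] without a scalar, because the coefficient
    [D x b b^-1] that arises is 1 by [twgV]. *)
Definition tw_antipode f : kT :=
  [ffun p => f (p.1^-1, (to p.2 p.1)^-1)%g].

Lemma sum_tw_comul (X : nmodType) (h : kT -> kT -> X) f :
  \sum_(u <- tw_comul f) h u.1 u.2
    = \sum_x \sum_b \sum_c h ((f (x, b * c)%g * D x b c) *: twe x b) (twe x c).
Proof.
rewrite big_map big_enum /= -(pair_bigA _ (fun x q =>
  h ((f (x, q.1 * q.2)%g * D x q.1 q.2) *: twe x q.1) (twe x q.2))).
apply: eq_bigr => x _; symmetry; exact: pair_bigA.
Qed.

Lemma sum_tw_bilin (X : lmodType k) (h : kT -> kT -> X) f :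
  bilinear_map h ->
  \sum_(u <- tw_comul f) h u.1 u.2
    = \sum_x \sum_b \sum_c
        (f (x, b * c)%g * D x b c) *: h (twe x b) (twe x c).
Proof.
move=> [hl _]; rewrite sum_tw_comul; apply: eq_bigr => x _.
apply: eq_bigr => b _; apply: eq_bigr => c _; exact: (linearZ_of (hl _)).
Qed.

Fact tw_comul_linear (s : k) f g :
  tens_eq (tw_comul (s *: f + g))
          ([seq (s *: u.1, u.2) | u <- tw_comul f] ++ tw_comul g).
Proof.
move=> X h hb; rewrite big_cat [in RHS]big_map /= !sum_tw_bilin //.
under [X in _ = X + _]eq_bigr => u _ do rewrite (linearZ_of (hb.1 _)).
rewrite -scaler_sumr sum_tw_bilin // scaler_sumr -big_split.
apply: eq_bigr => x _; rewrite scaler_sumr -big_split; apply: eq_bigr => b _.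
rewrite scaler_sumr -big_split; apply: eq_bigr => c _.
by rewrite !ffunE mulrDl scalerDl /= scalerA mulrA.
Qed.

Lemma sum_tw_bilin_e (X : lmodType k) (h : kT -> kT -> X) x a :
  bilinear_map h ->
  \sum_(u <- tw_comul (twe x a)) h u.1 u.2
    = \sum_b D x b (b^-1 * a)%g *: h (twe x b) (twe x (b^-1 * a)%g).
Proof.
move=> hb; rewrite sum_tw_bilin // (bigD1 x) //= [X in _ + X]big1 ?addr0 => [|y ny].
  apply: eq_bigr => b _; rewrite (bigD1 (b^-1 * a)%g) //= big1 ?addr0 => [|c nc].
    by rewrite ffunE mulKVg eqxx mul1r.
  rewrite ffunE xpair_eqE eqxx /= -{1}(mulKVg b a) (inj_eq (mulgI b)) (negPf nc).
  by rewrite mul0r scale0r.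
apply: big1 => b _; apply: big1 => c _.
by rewrite ffunE xpair_eqE (negPf ny) mul0r scale0r.
Qed.

(** The coefficients D(bc,d) D(b,c) and D(b,cd) D(c,d) of the two sides are both D(b,c) D(b,d)
    D(c,d). *)
Fact tw_comulA f :
  tens_eq3 [seq (v.1, v.2, u.2) | u <- tw_comul f, v <- tw_comul u.1]
           [seq (u.1, v.1, v.2) | u <- tw_comul f, v <- tw_comul u.2].
Proof.
move=> X h [h1 h2 h3]; rewrite !big_allpairs_dep /=.
rewrite (sum_tw_comul (fun p q => \sum_(v <- tw_comul p) h v.1 v.2 q)).
rewrite (sum_tw_comul (fun p q => \sum_(v <- tw_comul q) h p v.1 v.2)).
apply: eq_bigr => x _.
have hb1 q : bilinear_map (fun p p' => h p p' q).
  by split=> ?; [apply: h1 | apply: h2].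
have hb2 p : bilinear_map (h p) by split=> ?; [apply: h2 | apply: h3].
transitivity (\sum_b \sum_c \sum_d
   (f (x, b * c * d)%g * (D x (b * c)%g d * D x b c)) *:
    h (twe x b) (twe x c) (twe x d)); last first.
  apply: eq_bigr => b _.
  have R (c : G) : \sum_(v <- tw_comul (twe x c))
       h ((f (x, (b * c)%g) * D x b c) *: twe x b) v.1 v.2 =
     \sum_c' (f (x, (b * c)%g) * (D x b c * D x c' (c'^-1 * c)%g)) *:
       h (twe x b) (twe x c') (twe x (c'^-1 * c)%g).
    rewrite sum_tw_bilin_e //; apply: eq_bigr => c' _.
    by rewrite (linearZ_of (h1 _ _)) scalerA mulrC mulrA.
  under [RHS]eq_bigr => c _ do rewrite R.
  rewrite [RHS]exchange_big /=; under [RHS]eq_bigr => c' _ do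
    rewrite (reindex_inj (mulgI c')) /=.
  apply: eq_bigr => c _; apply: eq_bigr => d _.
  by rewrite !mulKg mulgA !twMr !twMl; congr (_ * _ *: _); rewrite mulrC mulrA.
have L (b d : G) : \sum_(v <- tw_comul ((f (x, (b * d)%g) * D x b d) *: twe x b))
       h v.1 v.2 (twe x d) =
     \sum_b' (f (x, (b * d)%g) * (D x b d * D x b' (b'^-1 * b)%g)) *:
       h (twe x b') (twe x (b'^-1 * b)%g) (twe x d).
  rewrite -[_ *: twe x b]addr0.
  have -> : \sum_(v <- tw_comul ((f (x, (b * d)%g) * D x b d) *: twe x b + 0)) h v.1 v.2 (twe x d)
    = (f (x, (b * d)%g) * D x b d) *: \sum_(v <- tw_comul (twe x b)) h v.1 v.2 (twe x d).
    rewrite (@tw_comul_linear _ _ _ X _ (hb1 _)) big_cat big_map /= scaler_sumr.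
    rewrite [X in _ + X](@sum_tw_bilin X (fun p p' => h p p' (twe x d)) 0) //.
    rewrite [X in _ + X]big1 ?addr0 => [|y _]; last first.
      by apply: big1 => ? _; apply: big1 => ? _; rewrite ffunE mul0r scale0r.
    by apply: eq_bigr => u _; rewrite (linearZ_of (h1 _ _)).
  rewrite (@sum_tw_bilin_e X (fun p p' => h p p' (twe x d))) // scaler_sumr.
  by apply: eq_bigr => b' _; rewrite scalerA mulrA.
under eq_bigr => b _ do under eq_bigr => d _ do rewrite L.
under eq_bigr => b _ do rewrite exchange_big /=.
rewrite exchange_big /=; apply: eq_bigr => b _.
rewrite (reindex_inj (mulgI b)) /=; apply: eq_bigr => c _.
by apply: eq_bigr => d _; rewrite mulKg.
Qed.

Lemma tw_counit_linear : scalar tw_counit.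
Proof.
move=> s g h; rewrite /tw_counit mulr_sumr -big_split.
by apply: eq_bigr => x _; rewrite !ffunE.
Qed.

Lemma tw_counit_e x a : tw_counit (twe x a) = (a == 1%g)%:R.
Proof.
rewrite /tw_counit (bigD1 x) //= ffunE xpair_eqE eqxx /= big1 ?addr0 1?eq_sym //.
by move=> y /negPf ny; rewrite ffunE xpair_eqE ny.
Qed.

Fact tw_counitl f : \sum_(u <- tw_comul f) tw_counit u.1 *: u.2 = f.
Proof.
rewrite (sum_tw_comul (fun p q => tw_counit p *: q)) [RHS]twe_expand.
apply: eq_bigr => x _; rewrite (bigD1 1%g) //= [X in _ + X]big1 ?addr0.
  apply: eq_bigr => c _; rewrite (scalable_linear tw_counit_linear) tw_counit_e.
  by rewrite eqxx /= mulr1 mul1g tw1g mulr1.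
move=> b /negPf nb; apply: big1 => c _.
by rewrite (scalable_linear tw_counit_linear) tw_counit_e nb /= mulr0 scale0r.
Qed.

Fact tw_counitr f : \sum_(u <- tw_comul f) tw_counit u.2 *: u.1 = f.
Proof.
rewrite (sum_tw_comul (fun p q => tw_counit q *: p)) [RHS]twe_expand.
apply: eq_bigr => x _; apply: eq_bigr => b _.
rewrite (bigD1 1%g) //= [X in _ + X]big1 ?addr0 => [|c /negPf nc].
  by rewrite tw_counit_e eqxx scale1r mulg1 twg1 mulr1.
by rewrite tw_counit_e nc scale0r.
Qed.

Fact tw_comul1 : tens_eq (tw_comul 1) [:: (1, 1)].
Proof.
move=> X h hb; rewrite sum_tw_bilin // big_seq1 /= (bigD1 1%g) //=.
rewrite [X in _ + X]big1 ?addr0 => [|x /negPf nx]; last first.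
  by apply: big1 => b _; apply: big1 => c _; rewrite ffunE nx mul0r scale0r.
rewrite tw1E (linear_sum_of (hb.1 _)); apply: eq_bigr => b _.
rewrite -tw1E {2}tw1E (linear_sum_of (hb.2 _)); apply: eq_bigr => c _.
by rewrite ffunE eqxx tw_id mulr1 scale1r.
Qed.

Lemma sum_tw_mul (X : lmodType k) (h : F -> G -> X) f g :
  \sum_x \sum_a (f * g) (x, a) *: h x a =
  \sum_x \sum_y \sum_a (f (x, a) * g (y, to a x)) *: h (x * y)%g a.
Proof.
under eq_bigr => x _ do under eq_bigr => a _ do rewrite ffunE scaler_suml.
under eq_bigr => x _ do rewrite exchange_big /=.
rewrite exchange_big; apply: eq_bigr => x _ /=.
rewrite (reindex_inj (mulgI x)); apply: eq_bigr => y _ /=.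
by apply: eq_bigr => a _; rewrite mulKg.
Qed.

(** In a product [twe x b * twe y b'] only b' = [to b x] survives, so the coefficients multiply to
    [D x b c * D y (to b x) (to c x)], which is the left side by [tw_coc]. *)
Fact tw_comulM f g :
  tens_eq (tw_comul (f * g))
    [seq (u.1 * v.1, u.2 * v.2) | u <- tw_comul f, v <- tw_comul g].
Proof.
move=> X h hb; rewrite sum_tw_bilin // big_allpairs_dep /=.
rewrite (sum_tw_comul (fun p q =>
  \sum_(v <- tw_comul g) h (p * v.1) (q * v.2))).
transitivity (\sum_x \sum_a (f * g) (x, a) *:
   \sum_b D x b (b^-1 * a)%g *: h (twe x b) (twe x (b^-1 * a)%g)).
  apply: eq_bigr => x _.
  under [RHS]eq_bigr => a _ do rewrite scaler_sumr.
  rewrite [RHS]exchange_big; apply: eq_bigr => b _ /=.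
  rewrite [RHS](reindex_inj (mulgI b)); apply: eq_bigr => c _ /=.
  by rewrite mulKg scalerA.
rewrite (sum_tw_mul (fun x a =>
   \sum_b D x b (b^-1 * a)%g *: h (twe x b) (twe x (b^-1 * a)%g))).
apply: eq_bigr => x _.
transitivity (\sum_b \sum_c \sum_y
  (f (x, (b * c)%g) * g (y, to (b * c)%g x) * D (x * y)%g b c) *:
   h (twe (x * y)%g b) (twe (x * y)%g c)).
  rewrite [RHS]exchange_big /= exchange_big /=.
  under [LHS]eq_bigr => a _ do under eq_bigr => y _ do rewrite scaler_sumr.
  under [LHS]eq_bigr => a _ do rewrite exchange_big /=.
  rewrite exchange_big /=; rewrite [RHS]exchange_big /=.
  apply: eq_bigr => b _; rewrite (reindex_inj (mulgI b)) /=.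
  apply: eq_bigr => c _; apply: eq_bigr => y _.
  by rewrite mulKg scalerA.
apply: eq_bigr => b _; apply: eq_bigr => c _.
rewrite (sum_tw_comul (fun p q =>
   h ((f (x, (b * c)%g) * D x b c) *: twe x b * p) (twe x c * q))).
apply: eq_bigr => y _.
rewrite (bigD1 (to b x)) //= [X in _ + X]big1 ?addr0 => [|b' nb]; last first.
  apply: big1 => c' _; rewrite -scalerAl -scalerAr [twe x b * _]tweM (eq_sym (to b x)) (negPf nb).
  by rewrite !scaler0 -(scale0r 0) (linearZ_of (hb.1 _)) scale0r.
rewrite (bigD1 (to c x)) //= [X in _ + X]big1 ?addr0 => [|c' nc]; last first.
  rewrite [X in h _ X]tweM (eq_sym (to c x)) (negPf nc) -(scale0r 0).
  by rewrite (linearZ_of (hb.2 _)) scale0r.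
rewrite -scalerAl -scalerAr scalerA !tweM !eqxx (linearZ_of (hb.1 _)).
by rewrite gact_morph tw_coc; congr (_ *: _); rewrite -!mulrA; congr (_ * _); rewrite mulrCA.
Qed.

Fact tw_counit1 : tw_counit 1 = 1.
Proof.
rewrite /tw_counit (bigD1 1%g) //= ffunE eqxx big1 ?addr0 // => x /negPf nx.
by rewrite ffunE nx.
Qed.

Fact tw_counitM : {morph tw_counit : f g / f * g}.
Proof.
move=> f g; rewrite /tw_counit mulr_suml.
under eq_bigr => x _ do rewrite ffunE.
rewrite exchange_big; apply: eq_bigr => x _ /=; rewrite mulr_sumr.
rewrite (reindex_inj (mulgI x)); apply: eq_bigr => y _ /=.
by rewrite mulKg gact_one.
Qed.

Fact tw_antipode_linear : linear tw_antipode.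
Proof. by move=> a f g; apply/ffunP=> x; rewrite !ffunE. Qed.

Lemma tw_antipode_e x a : tw_antipode (twe x a) = twe x^-1%g (to a^-1%g x).
Proof.
apply/ffunP=> -[y b]; rewrite !ffunE !xpair_eqE /= (can2_eq (@invgK F) (@invgK F)).
case: eqP => //= ->.
by rewrite -(inj_eq (@invg_inj G)) invgK -(inj_eq (@gact_inj x)) (actKV to x).
Qed.

Fact tw_antipodel f :
  \sum_(u <- tw_comul f) tw_antipode u.1 * u.2 = (tw_counit f)%:A.
Proof.
rewrite (sum_tw_comul (fun p q => tw_antipode p * q)) scaler_suml.
apply: eq_bigr => x _; rewrite tw1E scaler_sumr.
rewrite [RHS](reindex_inj (inj_comp (@gact_inj x) (@invg_inj G))).
apply: eq_bigr => b _; rewrite (bigD1 b^-1%g) //= [X in _ + X]big1 => [|c nc].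
  rewrite addr0 mulgV twgV mulr1 (linearZ_of tw_antipode_linear).
  by rewrite tw_antipode_e -scalerAl tweM actK eqxx mulVg.
rewrite (linearZ_of tw_antipode_linear) tw_antipode_e -scalerAl tweM actK.
by rewrite eq_sym (negPf nc) scaler0.
Qed.

Fact tw_antipoder f :
  \sum_(u <- tw_comul f) u.1 * tw_antipode u.2 = (tw_counit f)%:A.
Proof.
rewrite (sum_tw_comul (fun p q => p * tw_antipode q)) scaler_suml.
apply: eq_bigr => x _; rewrite tw1E scaler_sumr.
apply: eq_bigr => b _; rewrite (bigD1 b^-1%g) //= [X in _ + X]big1 => [|c nc].
  by rewrite addr0 mulgV twgV mulr1 tw_antipode_e -scalerAl tweM invgK eqxx mulgV.
rewrite tw_antipode_e -scalerAl tweM (inj_eq (@gact_inj x)).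
by rewrite -(inj_eq (@invg_inj G)) invgK eq_sym (negPf nc) scaler0.
Qed.

HB.instance Definition _ := Algebra_isHopf.Build k kT
  tw_comul_linear tw_comulA tw_counitl tw_counitr tw_comul1
  tw_comulM tw_counit_linear tw_counit1 tw_counitM
  tw_antipode_linear tw_antipodel tw_antipoder.

End TwistedAlgebra.

(** * The twisted algebra as an extension *)

Section TwistedExtension.
Variables (k : fieldType) (F G : finGroupType).
Variables (to : groupAction [set: F] [set: G]) (D : twist k to).
Local Notation kT := (twalg D).
Local Notation kF := (group_alg k F).
Local Notation kG := (fun_alg k G).
Implicit Types (x y z : F) (a b c : G).

Definition tw_inj (f : kG) : kT := [ffun p => if p.1 == 1%g then f p.2 else 0].
Definition tw_proj (h : kT) : kF := [ffun x => h (x, 1%g)].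
Definition tw_sec (g : kF) : kT := [ffun p => g p.1].

Fact tw_inj_linear : linear tw_inj.
Proof.
move=> s f g; apply/ffunP=> p; rewrite !ffunE; case: ifP => _; rewrite ?ffunE //.
by rewrite [_ *: _]mulr0 addr0.
Qed.
HB.instance Definition _ := GRing.isLinear.Build _ _ _ _ tw_inj tw_inj_linear.

Lemma tw_inj_mull f (h : kT) y a : (tw_inj f * h) (y, a) = f a * h (y, a).
Proof.
rewrite ffunE (bigD1 1%g) //= big1 ?addr0 => [|x /negPf nx].
  by rewrite ffunE eqxx invg1 mul1g act1.
by rewrite ffunE /= nx mul0r.
Qed.

Lemma tw_inj_mulr f (h : kT) y a : (h * tw_inj f) (y, a) = h (y, a) * f (to a y).
Proof.
rewrite ffunE (bigD1 y) //= big1 ?addr0 => [|x nx].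
  by rewrite ffunE /= mulVg eqxx.
by rewrite ffunE /= -eq_mulVg1 (negPf nx) mulr0.
Qed.

Fact tw_inj_monoid : monoid_morphism tw_inj.
Proof.
split=> [|f g]; apply/ffunP=> -[x a]; rewrite ?tw_inj_mull !ffunE //=.
  by case: ifP; rewrite ?ffunE.
by case: ifP => _; rewrite ?ffunE // mulr0.
Qed.
HB.instance Definition _ := GRing.isMonoidMorphism.Build _ _ tw_inj tw_inj_monoid.

Fact tw_proj_linear : linear tw_proj.
Proof. by move=> s f g; apply/ffunP=> p; rewrite !ffunE. Qed.
HB.instance Definition _ := GRing.isLinear.Build _ _ _ _ tw_proj tw_proj_linear.

Fact tw_proj_monoid : monoid_morphism tw_proj.
Proof.
split=> [|f g]; apply/ffunP=> x; rewrite !ffunE //=.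
by apply: eq_bigr => y _; rewrite !ffunE gact_one.
Qed.
HB.instance Definition _ := GRing.isMonoidMorphism.Build _ _ tw_proj tw_proj_monoid.

Fact tw_sec_linear : linear tw_sec.
Proof. by move=> s f g; apply/ffunP=> p; rewrite !ffunE. Qed.
HB.instance Definition _ := GRing.isLinear.Build _ _ _ _ tw_sec tw_sec_linear.

Fact tw_sec_monoid : monoid_morphism tw_sec.
Proof.
split=> [|f g]; apply/ffunP=> x; rewrite !ffunE //=.
by apply: eq_bigr => y _; rewrite !ffunE.
Qed.
HB.instance Definition _ := GRing.isMonoidMorphism.Build _ _ tw_sec tw_sec_monoid.

Lemma tw_inj_delta a : tw_inj (falg_delta k a) = twe D 1%g a.
Proof.
by apply/ffunP=> -[x b]; rewrite !ffunE /= xpair_eqE; case: eqP.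
Qed.

Lemma tw_proj_e x a : tw_proj (twe D x a) = (a == 1%g)%:R *: galg_of k x.
Proof.
apply/ffunP=> y; rewrite !ffunE xpair_eqE andbC (eq_sym a).
by rewrite -mulnb natrM.
Qed.

Lemma tw_sec_of x : tw_sec (galg_of k x) = \sum_a twe D x a.
Proof.
apply/ffunP=> -[y b]; rewrite sum_ffunE (bigD1 b) //= big1 => [|a /negPf na].
  by rewrite !ffunE xpair_eqE eqxx andbT addr0.
by rewrite ffunE xpair_eqE (eq_sym b) na andbF.
Qed.

Lemma tw_proj_inj f : tw_proj (tw_inj f) = (counit f)%:A.
Proof.
apply/ffunP=> x; rewrite !ffunE.
by case: eqP => _; rewrite ?[_ *: _]mulr1 ?[_ *: _]mulr0.
Qed.

Lemma tw_inj_hopf : hopf_map tw_inj.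
Proof.
split=> f; last first.
  rewrite /counit /= /tw_counit (bigD1 1%g) //= big1 => [|x /negPf nx].
    by rewrite ffunE eqxx addr0.
  by rewrite ffunE /= nx.
move=> X h hb; rewrite [RHS]big_map /= [RHS](sum_falg_comul (fun u v => h (tw_inj u) (tw_inj v))).
rewrite [LHS](sum_tw_bilin _ hb) (bigD1 1%g) //= [X in _ + X]big1 ?addr0; last first.
  move=> x /negPf nx; apply: big1 => b _; apply: big1 => c _.
  by rewrite ffunE /= nx mul0r scale0r.
apply: eq_bigr => a _; rewrite tw_inj_delta (falg_expand (falg_shift a f)).
rewrite (linear_sum_of tw_inj_linear) (linear_sum_of (hb.2 _)).
apply: eq_bigr => c _; rewrite linearZ (linearZ_of (hb.2 _)) /= tw_inj_delta.
by rewrite !ffunE eqxx tw_id mulr1.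
Qed.

Lemma tw_proj_hopf : hopf_map tw_proj.
Proof.
split=> f; last by apply: eq_bigr => x _; rewrite ffunE.
move=> X h hb; rewrite [RHS]big_map /= [LHS](sum_galg_bilin _ hb).
have hb2 : bilinear_map (fun u v => h (tw_proj u) (tw_proj v)).
  by split=> u s v w; rewrite linearP; [apply: hb.1 | apply: hb.2].
rewrite [RHS](sum_tw_bilin _ hb2); apply: eq_bigr => x _.
rewrite (bigD1 1%g) //= [X in _ = _ + X]big1 ?addr0; last first.
  move=> b /negPf nb; apply: big1 => c _.
  by rewrite tw_proj_e nb (linearZ_of (hb.1 _)) scale0r scaler0.
rewrite (bigD1 1%g) //= [X in _ = _ + X]big1 ?addr0; last first.
  move=> c /negPf nc.
  by rewrite [X in h _ X]tw_proj_e nc (linearZ_of (hb.2 _)) scale0r scaler0.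
by rewrite !tw_proj_e eqxx !scale1r ffunE mulg1 twg1 mulr1.
Qed.

Lemma tw_inj_injective : injective tw_inj.
Proof.
by move=> f g /ffunP E; apply/ffunP=> a; have := E (1%g, a); rewrite !ffunE eqxx.
Qed.

(** Right multiplication by [tw_inj f] only rescales [twe x b], and the antipode contributes a basis
    vector over [x^-1], so the product lies over 1. *)
Lemma tw_inj_e_mul x b c f :
  exists g, twe D x b * tw_inj f * antipode (twe D x c) = tw_inj g.
Proof.
have -> : twe D x b * tw_inj f = f (to b x) *: twe D x b.
  apply/ffunP=> -[y a]; rewrite tw_inj_mulr !ffunE xpair_eqE.
  case: eqP => [->|_]; last by rewrite mul0r [RHS]mulr0.
  by case: eqP => [->|_]; rewrite ?mul1r ?[RHS]mulr1 // mul0r [RHS]mulr0.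
rewrite /antipode /= tw_antipode_e -scalerAl tweM mulgV; case: ifP => _.
  by exists (f (to b x) *: falg_delta k b); rewrite linearZ /= tw_inj_delta.
by exists 0; rewrite scaler0 linear0.
Qed.

(** Each [twe x c] is the antipode of a basis vector over [x^-1], which turns this case into the
    previous one. *)
Lemma tw_inj_e_mul' x b c f :
  exists g, antipode (twe D x b) * tw_inj f * twe D x c = tw_inj g.
Proof.
have [g E] := tw_inj_e_mul x^-1%g (to b^-1%g x) (to c^-1%g x) f.
exists g; rewrite -E /antipode /= !tw_antipode_e; congr (_ * _).
by rewrite invgK -gact_inv invgK actK.
Qed.

Lemma tw_normal : normal_image tw_inj.
Proof.
have sum_im I (r : seq I) (E : I -> kT) :
    (forall i, exists f : kG, E i = tw_inj f) ->
    exists f : kG, \sum_(i <- r) E i = tw_inj f.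
  move=> EP; elim: r => [|i r [f Ef]]; first by exists 0; rewrite big_nil linear0.
  by have [g Eg] := EP i; exists (g + f); rewrite big_cons Eg Ef linearD.
move=> h f; split.
  have -> := sum_tw_comul (fun p q => p * tw_inj f * antipode q) h.
  apply: (sum_im) => x; apply: (sum_im) => b; apply: (sum_im) => c.
  have [g Eg] := tw_inj_e_mul x b c f.
  by eexists; rewrite -!scalerAl Eg -linearZ.
have -> := sum_tw_comul (fun p q => antipode p * tw_inj f * q) h.
apply: (sum_im) => x; apply: (sum_im) => b; apply: (sum_im) => c.
have [g Eg] := tw_inj_e_mul' x b c f.
by eexists; rewrite (linearZ_of antipode_linear) -!scalerAl Eg -linearZ.
Qed.

Lemma tw_extension : hopf_extension tw_inj tw_proj.
Proof.
split; [by split; [apply: tw_inj_hopf | apply: tw_proj_hopf] | exact: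
  tw_inj_injective | | exact: tw_normal | ].
  move=> g; exists (tw_sec g); apply/ffunP=> x; by rewrite !ffunE.
move=> h; split=> [ph0|[s [/allP s0 ->]]].
  (* A vector killed by [tw_proj] has no coordinates at the unit of [G], so it equals (1 - e_1) h,
     where 1 - e_1 has counit 0. *)
  exists [:: (1 - falg_delta k 1%g, h)]; split.
    by rewrite /= andbT /counit /= /falg_counit !ffunE eqxx subrr.
  rewrite big_seq1 /=; apply/ffunP=> -[x a]; rewrite tw_inj_mull !ffunE.
  case: eqP => [->|_]; last by rewrite subr0 mul1r.
  by move/ffunP/(_ x): ph0; rewrite !ffunE => ->; rewrite mulr0.
rewrite raddf_sum big_seq big1 // => u /s0/eqP u0.
by rewrite [LHS](rmorphM tw_proj) /= tw_proj_inj u0 scale0r mul0r.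
Qed.

(** [tw_sec] is an algebra map, so composing it with the antipode gives its convolution inverse. *)
Definition tw_sec_inv (g : kF) : kT := tw_sec (galg_antipode g).

Fact tw_sec_inv_linear : linear tw_sec_inv.
Proof. by move=> s f g; rewrite /tw_sec_inv galg_antipode_linear linearP. Qed.
HB.instance Definition _ := GRing.isLinear.Build _ _ _ _
  tw_sec_inv tw_sec_inv_linear.

Lemma tw_extension_action : extension_action tw_inj tw_proj to.
Proof.
exists tw_sec, tw_sec_inv; split; last first.
  move=> x f; rewrite /= /tw_sec_inv galg_antipode_of.
  have -> : tw_sec (galg_of k x) * tw_inj f =
      tw_inj [ffun a => f (to a x)] * tw_sec (galg_of k x).
    apply/ffunP=> -[y a]; rewrite tw_inj_mulr tw_inj_mull !ffunE /=.
    by case: eqP => [->|_]; rewrite ?mul1r ?mulr1 // mul0r mulr0.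
  rewrite -mulrA -(rmorphM tw_sec) /= galg_ofM mulgV.
  by rewrite (rmorph1 tw_sec) mulr1.
split=> g.
- move=> X h hb; rewrite [LHS]big_map [RHS]big_map /= [RHS](sum_galg_comul (fun u v
  => h (tw_sec u) v)).
  have hb2 : bilinear_map (fun u v => h u (tw_proj v)).
    by split=> u s v w; rewrite ?linearP; [apply: hb.1 | apply: hb.2].
  rewrite [LHS](sum_tw_bilin _ hb2); apply: eq_bigr => x _.
  rewrite /= (linearZ_of tw_sec_linear) tw_sec_of (linearZ_of (hb.1 _)) (linear_sum_of (hb.1 _)).
  rewrite scaler_sumr; apply: eq_bigr => b _.
  rewrite (bigD1 1%g) //= [X in _ + X]big1 ?addr0; last first.
    move=> c /negPf nc.
    by rewrite [X in h _ X]tw_proj_e nc (linearZ_of (hb.2 _)) scale0r scaler0.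
  by rewrite tw_proj_e eqxx scale1r ffunE twg1 mulr1.
- have := antipoder g => /(congr1 tw_sec); rewrite linearZ rmorph1 => <-.
  by rewrite raddf_sum; apply: eq_bigr => u _; rewrite [RHS](rmorphM tw_sec).
- have := antipodel g => /(congr1 tw_sec); rewrite linearZ rmorph1 => <-.
  by rewrite raddf_sum; apply: eq_bigr => u _; rewrite [RHS](rmorphM tw_sec).
Qed.

Lemma tw_in_Ext : in_Ext to kT.
Proof.
exists tw_inj, tw_proj, to; split; [exact: tw_extension | exact: tw_extension_action | ].
exists 1%g => [|a x]; by rewrite ?group1 // !perm1.
Qed.

End TwistedExtension.

(** * Hopf isomorphisms *)

Section HopfIsomorphisms.
Variable k : fieldType.
Implicit Types H K L : hopfAlgType k.

(* An injective map compatible with the comultiplications is compatible with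
   the counits, since those are determined by the comultiplications. *)
Lemma hopf_isoP H K (f : H -> K) : linear f -> monoid_morphism f ->
    (forall x, tens_eq (comul (f x)) [seq (f u.1, f u.2) | u <- comul x]) ->
    bijective f ->
  hopf_iso H K.
Proof.
move=> fl fm fD fb.
have fe x : counit (f x) = counit x.
  have eb : bilinear_map (fun a b : K => counit a *: b).
    by split=> u c v w; rewrite ?counit_linear ?(scalerDl, scalerDr) ?scalerA // mulrC -scalerA.
  have E : \sum_(u <- comul x) counit (f u.1) *: u.2 = x.
    apply: (bij_inj fb); rewrite (linear_sum_of fl) -[RHS]counitl (fD x _ _ eb).
    by rewrite [RHS]big_map; apply: eq_bigr => u _; rewrite (linearZ_of fl).
  have el (L : hopfAlgType k) := @linear_sum_of k L k^o counit (@counit_linear k L).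
  have eZ (L : hopfAlgType k) c (y : L) : counit (c *: y) = c * counit y.
    exact: (scalable_linear (@counit_linear k L)).
  rewrite -[in RHS]E -{1}(counitr x) (linear_sum_of fl) !el.
  by apply: eq_bigr => u _; rewrite (linearZ_of fl) !eZ mulrC.
pose hl := GRing.isLinear.Build _ _ _ _ f fl.
pose hm := GRing.isMonoidMorphism.Build _ _ f fm.
by exists (HB.pack f hl hm : {lrmorphism H -> K}).
Qed.

Lemma hopf_map_comp H K L (f : {lrmorphism H -> K}) (g : {lrmorphism K -> L}) :
  hopf_map f -> hopf_map g -> hopf_map (g \o f).
Proof.
move=> [fD fe] [gD ge]; split=> x /=; last by rewrite ge fe.
move=> X h hb; rewrite (gD (f x) X h hb) !big_map /=.
have hb2 : bilinear_map (fun u v => h (g u) (g v)).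
  by split=> u s v w; rewrite linearP; [apply: hb.1 | apply: hb.2].
by rewrite (fD x X _ hb2) big_map.
Qed.

Lemma hopf_iso_trans H K L : hopf_iso H K -> hopf_iso K L -> hopf_iso H L.
Proof.
move=> [f fh fb] [g gh gb].
by exists (g \o f); [exact: hopf_map_comp | exact: bij_comp].
Qed.

Lemma hopf_iso_inv H K (f : {lrmorphism H -> K}) : hopf_map f -> bijective f ->
  exists g : {lrmorphism K -> H}, [/\ hopf_map g, cancel f g & cancel g f].
Proof.
move=> [fD fe] [g fK gK].
have gl : linear g.
  by move=> s x y; apply: (can_inj fK); rewrite linearP /= !gK.
have gm : monoid_morphism g.
  by split=> [|x y]; apply: (can_inj fK); rewrite ?rmorph1 ?rmorphM /= !gK ?rmorph1.
pose hl := GRing.isLinear.Build _ _ _ _ g gl.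
pose hm := GRing.isMonoidMorphism.Build _ _ g gm.
exists (HB.pack g hl hm : {lrmorphism K -> H}); split=> //.
split=> y /=; last by rewrite -{2}(gK y) fe.
move=> X h hb; rewrite big_map /= -{2}(gK y).
have hb2 : bilinear_map (fun u v => h (g u) (g v)).
  by split=> u s v w; rewrite gl; [apply: hb.1 | apply: hb.2].
rewrite (fD (g y) X _ hb2) big_map /=.
by apply: eq_bigr => u _; rewrite !fK.
Qed.

Lemma hopf_iso_sym H K : hopf_iso H K -> hopf_iso K H.
Proof.
move=> [f fh fb]; have [g [gh fK gK]] := hopf_iso_inv fh fb.
by exists g => //; exists f.
Qed.

(** Both sides are convolution inverses of [f], hence equal; [t] encodes the triple convolution
    product that is evaluated with either bracketing. *)
Lemma hopf_map_antipode H K (f : {lrmorphism H -> K}) : hopf_map f ->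
  forall x, f (antipode x) = antipode (f x).
Proof.
move=> [fD fe] x.
have Sl := @antipode_linear k.
pose t (a b c : H) := antipode (f a) * (f b * f (antipode c)).
have tt : trilinear_map t.
  by split=> a b s u v; rewrite /t ?Sl ?linearP ?Sl !(mulrDl, mulrDr) -?scalerAr
    -?scalerAl -?scalerAr.
transitivity (\sum_(u <- comul x) \sum_(v <- comul u.1) t v.1 v.2 u.2).
  transitivity (\sum_(u <- comul x) counit u.1 *: f (antipode u.2)).
    rewrite -{1}(counitl x) (linear_sum_of (Sl H)) linear_sum.
    by apply: eq_bigr => u _; rewrite (linearZ_of (Sl H)) linearZ.
  apply: eq_bigr => u _; rewrite /t.
  under eq_bigr => v _ do rewrite mulrA.
  rewrite -mulr_suml.
  have hb : bilinear_map (fun a b : K => antipode a * b).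
    by split=> a s b c; rewrite ?Sl ?mulrDl ?mulrDr -?scalerAl -?scalerAr.
  have := antipodel (f u.1); rewrite (fD u.1 K _ hb) big_map /= => ->.
  by rewrite fe -scalerAl mul1r.
rewrite (sweedler_coassoc _ tt) -{2}(counitr x) linear_sum (linear_sum_of (Sl K)).
apply: eq_bigr => u _; rewrite /t -mulr_sumr.
under eq_bigr => v _ do rewrite -rmorphM.
rewrite -linear_sum antipoder linearZ /= rmorph1 -scalerAr mulr1.
by rewrite linearZ (linearZ_of (Sl K)).
Qed.

(** Transport of structure. It makes a group algebra the middle term of an extension once it is
    known to be isomorphic to a twisted algebra. *)
Lemma hopf_iso_Ext (F G : finGroupType) (to : groupAction [set: F] [set: G]) H K :
  hopf_iso H K -> in_Ext to H -> in_Ext to K.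
Proof.
move=> [f fh fb] [i [p [to' [[[ih ph] inj_i surj_p nrm_i ker_p] act_ip eqto]]]].
have [g [gh fK gK]] := hopf_iso_inv fh fb.
have sumf (X : lmodType k) (h : K -> K -> X) y : bilinear_map h ->
  \sum_(u <- comul y) h u.1 u.2 = \sum_(u <- comul (g y)) h (f u.1) (f u.2).
  by move=> hb; rewrite -{1}(gK y) (fh.1 _ X h hb) big_map.
have Sl := @antipode_linear k.
exists (f \o i), (p \o g), to'; split=> //; first split.
- by split; apply: hopf_map_comp.
- exact: inj_comp (can_inj fK) inj_i.
- by move=> b; have [h <-] := surj_p b; exists (f h); rewrite /= fK.
- move=> h a; have [[b Eb] [b' Eb']] := nrm_i (g h) a; split.
    exists b; rewrite /= -Eb.
    rewrite (sumf K (fun u v => u * f (i a) * antipode v)); last first.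
      by split=> u s v w; rewrite ?Sl !(mulrDl, mulrDr) -?scalerAr -?scalerAl -?scalerAr.
    rewrite linear_sum; apply: eq_bigr => u _.
    by rewrite -(hopf_map_antipode fh) !rmorphM.
  exists b'; rewrite /= -Eb'.
  rewrite (sumf K (fun u v => antipode u * f (i a) * v)); last first.
    by split=> u s v w; rewrite ?Sl !(mulrDl, mulrDr) -?scalerAr -?scalerAl -?scalerAr.
  rewrite linear_sum; apply: eq_bigr => u _.
  by rewrite -(hopf_map_antipode fh) !rmorphM.
- move=> h; split=> [/= /ker_p [s [s0 Es]]|[s [s0 ->]]].
    exists [seq (u.1, f u.2) | u <- s]; split; first by rewrite all_map.
    rewrite big_map -[LHS]gK Es linear_sum; apply: eq_bigr => u _.
    exact: rmorphM.
  apply/ker_p; exists [seq (u.1, g u.2) | u <- s]; split; first by rewrite all_map.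
  rewrite big_map linear_sum; apply: eq_bigr => u _ /=.
  by rewrite rmorphM /= fK.
case: act_ip => c [c' [[c1 c2 c3] cE]].
exists (f \o c), (f \o c'); split; last first.
  by move=> x h; rewrite /= -cE !rmorphM.
split=> b /=.
- move=> X h hb; rewrite !big_map /=.
  have hb1 : bilinear_map (fun u v => h u (p (g v))).
    by split=> u s v w; rewrite ?linearP; [apply: hb.1 | apply: hb.2].
  have hb2 : bilinear_map (fun u v => h (f u) v).
    by split=> u s v w; rewrite ?linearP; [apply: hb.1 | apply: hb.2].
  rewrite (sumf X (fun u v => h u (p (g v)))) // fK.
  have := c1 b X _ hb2; rewrite !big_map /= => <-.
  by apply: eq_bigr => u _; rewrite fK.
- rewrite -[RHS](rmorph_alg f) -c2 linear_sum; apply: eq_bigr => u _.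
  by rewrite rmorphM.
- rewrite -[RHS](rmorph_alg f) -c3 linear_sum; apply: eq_bigr => u _.
  by rewrite rmorphM.
Qed.

End HopfIsomorphisms.

Lemma C2P (x : C2) : x = 1%g \/ x = t2.
Proof.
case: x => -[|[|//]] lt_x; [left | right]; apply: val_inj => //=.
by rewrite /t2 inordK.
Qed.

Lemma t2_neq1 : t2 != 1%g.
Proof. by rewrite -val_eqE /= inordK. Qed.

Lemma t2_mul : (t2 * t2 = 1)%g.
Proof. by apply: val_inj; rewrite /= inordK. Qed.

Lemma t2V : (t2^-1 = t2)%g.
Proof. by apply: (mulgI t2); rewrite mulgV t2_mul. Qed.

Lemma sum_C2 (V : nmodType) (E : C2 -> V) : \sum_x E x = E 1%g + E t2.
Proof.
rewrite (bigD1 1%g) //= (bigD1 t2) ?t2_neq1 //= big1 ?addr0 // => x /andP[x1 xt].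
by case: (C2P x) x1 xt => ->; rewrite eqxx.
Qed.

(** Oddness of the group order mostly enters here: values of bicharacters are roots of unity of odd
    order, and symmetry against antisymmetry makes their squares 1. *)
Lemma odd_order_root1 (k : fieldType) (N : nat) (z : k) :
  odd N -> z ^+ N = 1 -> z ^+ 2 = 1 -> z = 1.
Proof.
move=> oN zN z2; rewrite -{}zN -[in RHS](odd_double_half N) oN add1n exprS.
by rewrite -mul2n exprM z2 expr1n mulr1.
Qed.

Section TwistedIsomorphism.
Variables (k : fieldType) (F G G' : finGroupType).
Variables (to : groupAction [set: F] [set: G]) (D : twist k to).
Variables (to' : groupAction [set: F] [set: G']) (D' : twist k to').

Lemma twalg_iso (s : G' -> G) :
    {morph s : a b / (a * b)%g} -> bijective s ->
    (forall a x, s (to' a x) = to (s a) x) ->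
    (forall x a b, D' x a b = D x (s a) (s b)) ->
  hopf_iso (twalg D) (twalg D').
Proof.
move=> sM [s' sK s'K] s_to s_D.
pose phi (f : twalg D) : twalg D' := [ffun p => f (p.1, s p.2)].
have phi_lin : linear phi by move=> c f g; apply/ffunP=> p; rewrite !ffunE.
apply: (@hopf_isoP _ _ _ phi) => //.
- split=> [|f g]; apply/ffunP=> -[x a]; rewrite !ffunE //=.
  by apply: eq_bigr => y _; rewrite !ffunE /= s_to.
- move=> f X h hb; rewrite [RHS]big_map /= [LHS](sum_tw_bilin _ hb).
  have hb2 : bilinear_map (fun u v => h (phi u) (phi v)).
    by split=> u c v w; rewrite phi_lin; [apply: hb.1 | apply: hb.2].
  have phi_e x a : phi (twe D x (s a)) = twe D' x a.
    by apply/ffunP=> -[y b]; rewrite !ffunE /= !xpair_eqE (can_eq sK).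
  rewrite [RHS](sum_tw_bilin _ hb2); apply: eq_bigr => x _.
  have sbij : bijective s by exists s'.
  rewrite [RHS](reindex s) /=; last exact: onW_bij.
  apply: eq_bigr => b _; rewrite [RHS](reindex s) /=; last exact: onW_bij.
  by apply: eq_bigr => c _; rewrite !phi_e ffunE sM s_D.
exists (fun f : twalg D' => [ffun p => f (p.1, s' p.2)] : twalg D) => f; apply/ffunP=> -[x a].
  by rewrite !ffunE /= s'K.
by rewrite !ffunE /= sK.
Qed.

End TwistedIsomorphism.

Section TwistRoots.
Variables (k : fieldType) (F G : finGroupType).
Variables (to : groupAction [set: F] [set: G]) (D : twist k to).

Lemma twX x a b m : D x (a ^+ m)%g b = D x a b ^+ m.
Proof.
elim: m => [|m IHm]; first by rewrite expg0 tw1g expr0.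
by rewrite expgS twMl IHm exprS.
Qed.

Lemma tw_order x a b : D x a b ^+ #|G| = 1.
Proof. by rewrite -twX -cardsT expg_cardG ?inE // tw1g. Qed.

Lemma twC x a b : D x a b * D x b a = 1.
Proof.
by have := tw_alt D x (a * b)%g; rewrite twMl !twMr !tw_alt mul1r mulr1.
Qed.

Lemma tw_symm_trivial x a b : odd #|G| -> D x a b = D x b a -> D x a b = 1.
Proof.
by move=> oG sym; apply: (odd_order_root1 oG (tw_order x a b)); rewrite expr2 {2}sym twC.
Qed.

End TwistRoots.

(** * Obstructions to being a group algebra or the dual of one *)

Section TrivialTwisted.
Variables (k : fieldType) (F G : finGroupType).
Variables (to : groupAction [set: F] [set: G]) (D : twist k to).
Local Notation kT := (twalg D).

Lemma group_algebra_cocomm (H : hopfAlgType k) : is_group_algebra H ->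
  forall (X : lmodType k) (h : H -> H -> X), bilinear_map h ->
  forall x, \sum_(u <- comul x) h u.1 u.2 = \sum_(u <- comul x) h u.2 u.1.
Proof.
move=> [E /hopf_iso_sym[f [fD _] [g gK fK]]] X h hb x.
have hb1 : bilinear_map (fun u v => h v u).
  by split=> u; [apply: hb.2 | apply: hb.1].
have hb2 : bilinear_map (fun u v => h (f u) (f v)).
  by split=> u c v w; rewrite linearP; [apply: hb.1 | apply: hb.2].
have hb3 : bilinear_map (fun u v => h (f v) (f u)).
  by split=> u; [apply: hb2.2 | apply: hb2.1].
rewrite -(fK x) (fD (g x) X h hb) (fD (g x) X _ hb1) [LHS]big_map [RHS]big_map /=.
rewrite [LHS](sum_galg_bilin _ hb2) [RHS](sum_galg_bilin _ hb3).
exact: eq_bigr.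
Qed.

Lemma twe_eval x a y b : twe D x a (y, b) = ((y == x) && (b == a))%:R.
Proof. by rewrite ffunE xpair_eqE. Qed.

Lemma tw_eval_linear (p : F * G) : scalar (fun h : kT => h p).
Proof. by move=> c f g; rewrite !ffunE. Qed.

Lemma tw_eval_bilinear (p q : F * G) :
  @bilinear_map k kT kT k^o (fun u v => u p * v q).
Proof.
by split=> u c v w; rewrite !ffunE ?mulrDl ?mulrDr -?mulrA // mulrCA.
Qed.

Lemma tw_comul_eval (f : kT) x y a b :
  \sum_(u <- comul f) u.1 (x, a) * u.2 (y, b) =
  if x == y then f (x, a * b)%g * D x a b else 0.
Proof.
rewrite [LHS](sum_tw_bilin f (tw_eval_bilinear (x, a) (y, b))) (bigD1 x) //=.
rewrite [X in _ + X]big1 ?addr0 => [|z nz]; last first.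
  apply: big1 => c _; apply: big1 => d _.
  by rewrite twe_eval eq_sym (negPf nz) mul0r scaler0.
rewrite (bigD1 a) //= [X in _ + X]big1 ?addr0 => [|c nc]; last first.
  by apply: big1 => d _; rewrite twe_eval (eq_sym a) (negPf nc) andbF mul0r scaler0.
rewrite (bigD1 b) //= [X in _ + X]big1 ?addr0 => [|d nd]; last first.
  by rewrite [twe D x d _]twe_eval (eq_sym b) (negPf nd) andbF mulr0 scaler0.
rewrite !twe_eval !eqxx (eq_sym y) andbT mul1r.
by case: eqP => _; rewrite [_ *: _]mulrC ?mul1r ?mul0r.
Qed.

(** Cocommutativity, applied to the sum of the [twe x c] over all [c], makes [D x] symmetric; an
    alternating symmetric bicharacter is trivial in odd order. *)
Lemma group_algebra_twist : odd #|G| -> is_group_algebra kT ->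
  forall x a b, D x a b = 1.
Proof.
move=> oG gT x a b; apply: tw_symm_trivial => //.
have := group_algebra_cocomm gT (tw_eval_bilinear (x, a) (x, b)) (tw_sec D (galg_of k x)).
rewrite tw_comul_eval eqxx; under eq_bigr => u _ do rewrite mulrC.
by rewrite tw_comul_eval eqxx !ffunE !eqxx !mul1r.
Qed.

(** A cocommutative dual makes the algebra commutative. Then [twe x a * twe 1 (to a x)], which is
    [twe x a], equals the product in the other order, which vanishes unless [to a x] is [a]. *)
Lemma dual_group_algebra_action (K : hopfAlgType k) :
  hopf_dual K kT -> is_group_algebra K -> forall x a, to a x = a.
Proof.
move=> [p [pl p_surj [pM p1] [pD pe] _]] gK x a.
(* Each coordinate functional is represented in the dual, whose cocommutativity exchanges the two
   factors. *)
have comm (f g : kT) : f * g = g * f.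
  apply/ffunP=> q; pose hl := GRing.isLinear.Build _ _ _ _ _ (@tw_eval_linear q).
  have [y [yE _]] := p_surj (HB.pack (fun h : kT => h q) hl : {scalar kT}).
  rewrite -[LHS]yE -[RHS]yE !pD.
  have hb : @bilinear_map k K K k^o (fun u v => p u f * p v g).
    by split=> u c v w; rewrite pl ?mulrDl ?mulrDr -?mulrA // mulrCA.
  rewrite [LHS](group_algebra_cocomm gK hb).
  by apply: eq_bigr => u _; rewrite mulrC.
have /ffunP/(_ (x, a)) := comm (twe D x a) (twe D 1%g (to a x)).
rewrite !tweM eqxx act1 mulg1 mul1g twe_eval !eqxx.
case: eqP => // _ /eqP; by rewrite ffunE oner_eq0.
Qed.

End TrivialTwisted.

(** * Hopf isomorphisms between twisted algebras in odd order *)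

Section OddIsomorphism.
Variables (k : fieldType) (char_k : [pchar k] =i pred0) (G : finGroupType).
Hypotheses (oG : odd #|G|) (abG : forall a b : G, commute a b).
Variables (to to' : groupAction [set: C2] [set: G]).
Variables (D : twist k to) (D' : twist k to').

(** Some indicator has nonzero image, because the indicators sum to 1, and multiplying by that
    idempotent evaluates at its point. *)
Lemma fun_alg_character (chi : fun_alg k G -> k) : scalar chi ->
  monoid_morphism chi -> exists a, forall f, chi f = f a.
Proof.
move=> chil [chi1 chiM].
have [/existsP[a nz]|] := boolP [exists a, chi (falg_delta k a) != 0].
  exists a => f; apply: (mulIf nz); rewrite -chiM.
  have -> : f * falg_delta k a = f a *: falg_delta k a.
    apply/ffunP=> b; rewrite !ffunE.
    by case: eqP => [->|_]; rewrite ?mulr1 ?[RHS]mulr1 // mulr0 [RHS]mulr0.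
  exact: scalable_linear chil _ _.
rewrite negb_exists => /forallP nz; have := oner_neq0 k; rewrite -chi1.
rewrite (falg_expand 1) (@linear_sum_of _ _ k^o _ chil) big1 ?eqxx // => a _.
rewrite (scalable_linear chil) /=; apply/eqP.
by rewrite mulf_eq0 -(negbK (chi _ == 0)) nz orbT.
Qed.

Lemma two_neq0 : (2%:R : k) != 0.
Proof.
by apply/negP=> /eqP/eqP two0; have := char_k 2; rewrite !inE two0.
Qed.

Local Notation kT := (twalg D).
Local Notation kT' := (twalg D').
Local Notation kG := (fun_alg k G).

Lemma tw_mulE (f g : kT') p :
  (f * g) p = \sum_x f (x, p.2) * g (x^-1 * p.1, to' p.2 x)%g.
Proof. by rewrite ffunE. Qed.

Lemma tw_addE (f g : kT) p : (f + g) p = f p + g p.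
Proof. by rewrite ffunE. Qed.

(** Reduces the vanishing of coordinates at [(x, a)] to that at [(x, 1)], where the counit and the
    sign character give information. *)
Lemma tw_coaction (y : kT') x a :
  y (x, a) = \sum_(u <- comul y) u.1 (x, 1%g) * u.2 (x, a).
Proof. by rewrite tw_comul_eval eqxx mul1g tw1g mulr1. Qed.

(** Here [s a] is the point of [G] by which the coordinate at [(1, a)] evaluates the image of k^G.
    The image of the generator over [t2] is supported over [t2], and its coproduct shows that the
    two bicharacters differ by a symmetric factor, which is trivial in odd order. *)
Lemma twalg_iso_twist : hopf_iso kT kT' ->
  exists s : G -> G, forall a b, D' t2 a b = D t2 (s a) (s b).
Proof.
move=> [phi [phiD phie] [psi phiK psiK]].
have unit2 := two_neq0.
(* The projection to the group algebra of [C2] followed by its sign character; [sgD] says that it is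
   its own convolution inverse. *)
pose sg (y : kT') := y (1%g, 1%g) - y (t2, 1%g).
have sg_lin : scalar sg.
  by move=> c f g; rewrite /sg !ffunE opprD addrACA -mulrBr.
have sgM : monoid_morphism sg.
  split=> [|f g]; rewrite /sg.
    by rewrite !ffunE eqxx (negPf t2_neq1) subr0.
  rewrite !tw_mulE /=.
  by rewrite !sum_C2 !gact_one invg1 !mul1g mulg1 t2V t2_mul; ring.
have sgD (y : kT') : \sum_(u <- comul y) sg u.1 * sg u.2 = counit y.
  rewrite /sg; under eq_bigr => u _ do rewrite !mulrBr !mulrBl.
  rewrite !sumrB !tw_comul_eval !eqxx (negPf t2_neq1) eq_sym (negPf t2_neq1).
  by rewrite subr0 sub0r opprK /counit /= /tw_counit sum_C2 mulg1 !tw1g !mulr1.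
have sgE y : sg y = y (1%g, 1%g) - y (t2, 1%g) by [].
clearbody sg.
pose th (f : kG) : kT' := phi (tw_inj D f).
have th_lin : linear th by move=> c f g; rewrite /th linearP linearP.
have thM : monoid_morphism th.
  by split=> [|f g]; rewrite /th ?(rmorph1 (tw_inj D)) ?(rmorphM (tw_inj D)) ?rmorph1 ?rmorphM.
have thD (X : lmodType k) (h : kT' -> kT' -> X) (f : kG) : bilinear_map h ->
    \sum_(u <- comul (th f)) h u.1 u.2 = \sum_(a : G) h (th (falg_delta k a)) (th (falg_shift a f)).
  move=> hb; rewrite (phiD _ X h hb) big_map /=.
  have hb2 : bilinear_map (fun u v => h (phi u) (phi v)).
    by split=> u c v w; rewrite linearP; [apply: hb.1 | apply: hb.2].
  rewrite ((tw_inj_hopf D).1 f X _ hb2) [LHS]big_map /=.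
  exact: (sum_falg_comul (fun u v => h (th u) (th v))).
have the f : counit (th f) = f 1%g by rewrite /th phie (tw_inj_hopf D).2.
have chi_sg : exists a, forall f, sg (th f) = f a.
  apply: fun_alg_character; first by move=> c f g; rewrite th_lin sg_lin.
  by split=> [|f g]; rewrite ?thM.1 ?thM.2 ?sgM.1 ?sgM.2.
have th_t1 f : th f (t2, 1%g) = 0.
  have [g gE] := chi_sg.
  have sgb : @bilinear_map k kT' kT' k^o (fun u v => sg u * sg v).
    by split=> u c v w; rewrite sg_lin ?mulrDl ?mulrDr -?mulrA // mulrCA.
  (* Convolution of characters of k^G is multiplication of points, so [sgD] gives g^2 = 1, and odd
     order gives g = 1. *)
  have g1 : g = 1%g.
    have gg : (g * g = 1)%g.
      have := sgD (th (falg_delta k 1%g)).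
      rewrite (thD k^o _ _ sgb) the (bigD1 g) //= big1 => [|a na]; last first.
        by rewrite !gE ffunE eq_sym (negPf na) mul0r.
      rewrite !gE !ffunE !eqxx mul1r addr0.
      by case: eqP => // _ /eqP; rewrite eq_sym oner_eq0.
    have := expg_cardG (in_setT g); rewrite cardsT -(odd_double_half #|G|) oG.
    by rewrite expgD expg1 -mul2n expgM expgS expg1 gg expg1n mulg1.
  (* With g = 1 the sign character agrees with the counit at [th f], and the two differ by twice the
     coordinate at [(t2, 1)]. *)
  have := gE f; rewrite sgE g1 -(the f) /counit /= /tw_counit sum_C2.
  move/(congr1 (fun z => z - th f (1%g, 1%g) + th f (t2, 1%g))).
  rewrite [LHS]addrAC subrK subrr [X in _ = X + _]addrC addKr => /esym/eqP.
  by rewrite -mulr2n -mulr_natl mulf_eq0 (negPf unit2) => /eqP.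
have th_t f a : th f (t2, a) = 0.
  rewrite tw_coaction (thD k^o _ _ (tw_eval_bilinear D' _ _)) big1 // => b _.
  by rewrite th_t1 mul0r.
have th1M f y a : (th f * y : kT') (1%g, a) = th f (1%g, a) * y (1%g, a).
  by rewrite ffunE sum_C2 /= th_t mul0r addr0 invg1 mul1g act1.
have [s sE] : exists s : G -> G, forall a, forall f, th f (1%g, a) = f (s a).
  apply: (@fin_all_exists _ _ (fun a b => forall f, th f (1%g, a) = f b)) => a.
  apply: fun_alg_character; first by move=> c f g; rewrite th_lin !ffunE.
  by split=> [|f g]; rewrite ?thM.1 ?thM.2 ?th1M // ffunE.
have s1 : s 1%g = 1%g.
  have := the (falg_delta k 1%g); rewrite /counit /= /tw_counit sum_C2 th_t1 addr0.
  by rewrite sE !ffunE eqxx; case: eqP => // _ /esym/eqP; rewrite oner_eq0.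
pose T := tw_sec D (galg_of k t2); pose y := phi T.
have TE : T = \sum_a twe D t2 a by rewrite /T tw_sec_of.
have TT : T * T = 1.
  by rewrite /T -(rmorphM (tw_sec D)) /= galg_ofM t2_mul (rmorph1 (tw_sec D)).
have teE a : twe D t2 a = tw_inj D (falg_delta k a) * T.
  apply/ffunP=> -[x b]; rewrite tw_inj_mull !ffunE xpair_eqE /=.
  by do 2?case: eqP => _; rewrite ?mul1r ?mul0r ?mulr0.
have the_mul a x b : phi (twe D t2 a) (x, b) = (s b == a)%:R * y (x, b).
  rewrite teE rmorphM -/(th _) -/y; case: (C2P x) => ->.
    by rewrite th1M sE ffunE.
  rewrite ffunE sum_C2 /= th_t mul0r addr0 invg1 mul1g act1.
  by rewrite sE ffunE.
have yD (X : lmodType k) (h : kT' -> kT' -> X) : bilinear_map h ->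
    \sum_(u <- comul y) h u.1 u.2 =
    \sum_b \sum_c D t2 b c *: h (phi (twe D t2 b)) (phi (twe D t2 c)).
  move=> hb; rewrite (phiD _ X h hb) big_map /=.
  have hb2 : bilinear_map (fun u v => h (phi u) (phi v)).
    by split=> u c v w; rewrite linearP; [apply: hb.1 | apply: hb.2].
  rewrite [LHS](sum_tw_bilin _ hb2) sum_C2 big1 ?add0r => [|b _]; last first.
    by apply: big1 => c _; rewrite !ffunE eq_sym (negPf t2_neq1) mul0r scale0r.
  apply: eq_bigr => b _; apply: eq_bigr => c _.
  by rewrite !ffunE eqxx mul1r.
have yDe x x' a b : \sum_(u <- comul y) u.1 (x, a) * u.2 (x', b) =
    D t2 (s a) (s b) * (y (x, a) * y (x', b)).
  rewrite (yD k^o _ (tw_eval_bilinear D' _ _)).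
  rewrite (bigD1 (s a)) //= [X in _ + X]big1 ?addr0 => [|c nc]; last first.
    by apply: big1 => d _; rewrite the_mul eq_sym (negPf nc) !mul0r scaler0.
  rewrite (bigD1 (s b)) //= [X in _ + X]big1 ?addr0 => [|d nd]; last first.
    by rewrite [phi (twe D t2 d) _]the_mul eq_sym (negPf nd) mul0r mulr0 scaler0.
  by rewrite !the_mul !eqxx !mul1r.
(* No term of a coproduct mixes the components over 1 and over [t2]. *)
have qq : y (1%g, 1%g) * y (t2, 1%g) = 0.
  have := tw_comul_eval y 1%g t2 1%g 1%g.
  by rewrite yDe s1 tw1g mul1r eq_sym (negPf t2_neq1).
have qsum : y (1%g, 1%g) + y (t2, 1%g) = 1.
  have := phie T; rewrite -/y /counit /= /tw_counit !sum_C2 => ->.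
  by rewrite /T !ffunE /= eqxx eq_sym (negPf t2_neq1) add0r.
(* Otherwise [sg] composed with [phi] is the counit, although [phi] is onto and [sg] takes the value
   -1 at the generator over [t2]. *)
have q0 : y (1%g, 1%g) = 0.
  apply/eqP/negPn/negP => nz.
  move/eqP: qq; rewrite mulf_eq0 (negPf nz) => /eqP q0.
  have sgy : sg y = 1 by rewrite sgE q0 subr0 -qsum q0 addr0.
  have sg_counit h : sg (phi h) = counit h.
    have hE : h = tw_inj D [ffun a => h (1%g, a)] + tw_inj D [ffun a => h (t2, a)] * T.
      apply/ffunP=> -[x a]; rewrite [RHS]tw_addE tw_inj_mull /T !ffunE /=.
      case: (C2P x) => ->; rewrite ?eqxx ?(negPf t2_neq1).
        by rewrite eq_sym (negPf t2_neq1) mulr0 addr0.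
      by rewrite add0r mulr1.
    rewrite [in LHS]hE linearD rmorphM -/y -!/(th _) -[_ + _]scale1r.
    rewrite (scalable_linear sg_lin) /= mul1r.
    rewrite -[X in sg (X + _)]scale1r sg_lin mul1r sgM.2 sgy mulr1 !sgE !th_t1 !subr0.
    by rewrite !sE s1 !ffunE /counit /= /tw_counit sum_C2.
  have := sg_counit (psi (tw_sec D' (galg_of k t2))).
  rewrite -phie psiK sgE /counit /= /tw_counit sum_C2 !ffunE /= eqxx.
  rewrite eq_sym (negPf t2_neq1) sub0r add0r => /eqP.
  by rewrite eq_sym -addr_eq0 -mulr2n (negPf unit2).
have y1 a : y (1%g, a) = 0.
  by rewrite tw_coaction yDe s1 tw1g mul1r q0 mul0r.
have yinv a : y (t2, a) * y (t2, to' a t2) = 1.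
  have : (y * y : kT') (1%g, a) = 1 by rewrite /y -rmorphM TT rmorph1 ffunE eqxx.
  by rewrite ffunE sum_C2 /= y1 mul0r add0r t2V mulg1.
have ynz a : y (t2, a) != 0.
  by apply/eqP=> ya0; have := yinv a; rewrite ya0 mul0r => /esym/eqP; rewrite oner_eq0.
exists s => a b.
have main c d : y (t2, (c * d)%g) * D' t2 c d = D t2 (s c) (s d) * (y (t2, c) * y (t2, d)).
  by rewrite -yDe tw_comul_eval eqxx.
(* As [a] and [b] commute, the left sides of [main] at (a, b) and at (b, a) share the coordinate of
   [y], so the ratio of the two bicharacters is symmetric. *)
have mainC : D' t2 a b * D t2 (s b) (s a) = D' t2 b a * D t2 (s a) (s b).
  apply: (mulfI (ynz (a * b)%g)); rewrite !mulrA main [in RHS](abG a b) main.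
  by rewrite mulrAC twC mul1r mulrAC [in RHS](mulrC (D t2 _ _)) twC mul1r mulrC.
have z2 : (D' t2 a b * D t2 (s b) (s a)) ^+ 2 = 1.
  rewrite expr2 {2}mainC mulrACA twC mul1r mulrC; exact: twC.
have zN : (D' t2 a b * D t2 (s b) (s a)) ^+ #|G| = 1.
  by rewrite exprMn !tw_order mulr1.
have := odd_order_root1 oG zN z2; move/(congr1 (fun z => z * D t2 (s a) (s b))).
by rewrite -mulrA twC mulr1 mul1r.
Qed.

End OddIsomorphism.

(** * The structure of an extension *)

Section Multilinear.
Variable k : fieldType.
Implicit Types U V W X : lmodType k.

Lemma linear_sum_fun U X I (r : seq I) (E : I -> U -> X) :
  (forall i, linear (E i)) -> linear (fun u => \sum_(i <- r) E i u).
Proof.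
move=> El c u v; rewrite scaler_sumr -big_split.
by apply: eq_bigr => i _; rewrite El.
Qed.

Lemma bilinear_comp U V U' V' X (f : U -> V -> X) (g : U' -> U) (h : V' -> V) :
  bilinear_map f -> linear g -> linear h -> bilinear_map (fun u v => f (g u) (h v)).
Proof. by move=> fb gl hl; split=> u c v w; rewrite ?gl ?hl; [apply: fb.1 | apply: fb.2]. Qed.

Lemma linear_comp U V X (f : V -> X) (g : U -> V) :
  linear f -> linear g -> linear (fun u => f (g u)).
Proof. by move=> fl gl c u v; rewrite gl fl. Qed.

Lemma bilinear_scale U V (f : U -> k) : scalar f ->
  bilinear_map (fun (u : U) (v : V) => f u *: v).
Proof.
move=> fl; split=> u c v w; first by rewrite fl scalerDl scalerA.
by rewrite scalerDr scalerA mulrC -scalerA.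
Qed.

Lemma bilinear_scale_r U V (f : V -> k) : scalar f ->
  bilinear_map (fun (u : U) (v : V) => f v *: u).
Proof. by move=> fl; have fb := bilinear_scale U fl; split=> u; [apply: fb.2 | apply: fb.1]. Qed.

End Multilinear.

Section Multiplication.
Variables (k : fieldType) (A : algType k).
Lemma mull_linear (a : A) : linear (fun x => a * x).
Proof. by move=> c x y; rewrite mulrDr scalerAr. Qed.
Lemma mulr_linear (a : A) : linear (fun x => x * a).
Proof. by move=> c x y; rewrite mulrDl scalerAl. Qed.
Lemma bilinear_mul : bilinear_map (fun x y : A => x * y).
Proof. by split=> a; [apply: mulr_linear | apply: mull_linear]. Qed.
End Multiplication.

(** * Gradings by the quotient and the left coinvariants *)

Section Gradings.
Variables (k : fieldType) (F G : finGroupType) (H : hopfAlgType k).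
Variables (i : {lrmorphism fun_alg k G -> H}) (p : {lrmorphism H -> group_alg k F}).
Hypotheses (ih : hopf_map i) (ph : hopf_map p).
Hypothesis ker_p : forall h, p h = 0 <->
  exists s : seq (fun_alg k G * H), all (fun u => counit u.1 == 0) s /\
          h = \sum_(u <- s) i u.1 * u.2.
Implicit Types (x y : F) (f : fun_alg k G) (h : H).

(* Comodule structures over a group algebra are gradings: lgr x and rgr x are
   the projections onto the x-components for the left and right coactions. *)
Definition lgr x h : H := \sum_(u <- comul h) p u.1 x *: u.2.
Definition rgr x h : H := \sum_(u <- comul h) p u.2 x *: u.1.

Lemma p_eval_linear x : scalar (fun h => p h x).
Proof. by move=> c g h; rewrite linearP !ffunE. Qed.

Lemma lgr_bilin x : bilinear_map (fun a b : H => p a x *: b).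
Proof. exact: bilinear_scale (p_eval_linear x). Qed.

Lemma rgr_bilin x : bilinear_map (fun a b : H => p b x *: a).
Proof. exact: bilinear_scale_r (p_eval_linear x). Qed.

Lemma lgr_linear x : linear (lgr x).
Proof. by move=> c g h; rewrite /lgr (sweedlerP (lgr_bilin x)). Qed.

Lemma rgr_linear x : linear (rgr x).
Proof. by move=> c g h; rewrite /rgr (sweedlerP (rgr_bilin x)). Qed.

Lemma lgr_sum h : \sum_x lgr x h = h.
Proof.
rewrite exchange_big /= -[RHS]counitl; apply: eq_bigr => u _.
by rewrite -scaler_suml -(ph.2 u.1).
Qed.

Lemma p_lgr x h : p (lgr x h) = p h x *: galg_of k x.
Proof.
have hb : bilinear_map (fun a b : group_alg k F => a x *: b).
  by apply: bilinear_scale => c a b; rewrite !ffunE.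
have hb2 : bilinear_map (fun a b : H => p a x *: p b).
  by apply: (bilinear_comp hb) => c a b; rewrite linearP.
rewrite /lgr linear_sum /=; under eq_bigr => u _ do rewrite linearZ /=.
have := ph.1 h _ _ hb; rewrite [in RHS]big_map /= => <-.
rewrite [LHS](sum_galg_bilin _ hb) (bigD1 x) //= big1 ?addr0 => [|y nyx].
  by rewrite ffunE eqxx scale1r.
by rewrite ffunE eq_sym (negPf nyx) scale0r scaler0.
Qed.

Lemma p_lgr_eval x y h : p (lgr x h) y = if x == y then p h x else 0.
Proof.
rewrite p_lgr !ffunE eq_sym.
by case: eqP => _; [rewrite [LHS]mulr1 | rewrite [LHS]mulr0].
Qed.

(** Coassociativity: the coproduct is a map of left comodules, so the projection can be moved to its
    first factor. *)
Lemma sum_comul_lgr (X : lmodType k) (f : H -> H -> X) x h : bilinear_map f ->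
  \sum_(u <- comul (lgr x h)) f u.1 u.2 = \sum_(u <- comul h) f (lgr x u.1) u.2.
Proof.
move=> fb.
transitivity (\sum_(u <- comul h) \sum_(v <- comul u.2) p u.1 x *: f v.1 v.2).
  pose S g := \sum_(u <- comul g) f u.1 u.2.
  have Sl : linear S by move=> c g g'; rewrite /S (sweedlerP fb).
  rewrite -/(S _) /lgr (linear_sum_of Sl); apply: eq_bigr => u _.
  by rewrite (linearZ_of Sl) /S scaler_sumr.
have ft : trilinear_map (fun a b c => p a x *: f b c).
  split=> [b c|a c|a b].
  - exact: (linear_comp ((bilinear_scale X (p_eval_linear x)).1 (f b c)) (fun _ _ _ => erefl)).
  - by move=> s u v; rewrite fb.1 scalerDr scalerA mulrC -scalerA.
  - by move=> s u v; rewrite fb.2 scalerDr scalerA mulrC -scalerA.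
rewrite -(sweedler_coassoc _ ft); apply: eq_bigr => u _.
rewrite /lgr (linear_sum_of (fb.1 _)); apply: eq_bigr => v _.
by rewrite (linearZ_of (fb.1 _)).
Qed.

Lemma sum_comul_rgr (X : lmodType k) (f : H -> H -> X) x h : bilinear_map f ->
  \sum_(u <- comul (rgr x h)) f u.1 u.2 = \sum_(u <- comul h) f u.1 (rgr x u.2).
Proof.
move=> fb.
transitivity (\sum_(u <- comul h) \sum_(v <- comul u.1) p u.2 x *: f v.1 v.2).
  pose S g := \sum_(u <- comul g) f u.1 u.2.
  have Sl : linear S by move=> c g g'; rewrite /S (sweedlerP fb).
  rewrite -/(S _) /rgr (linear_sum_of Sl); apply: eq_bigr => u _.
  by rewrite (linearZ_of Sl) /S scaler_sumr.
have ft : trilinear_map (fun a b c => p c x *: f a b).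
  split=> [b c|a c|a b].
  - by move=> s u v; rewrite fb.1 scalerDr scalerA mulrC -scalerA.
  - by move=> s u v; rewrite fb.2 scalerDr scalerA mulrC -scalerA.
  - exact: (linear_comp ((bilinear_scale X (p_eval_linear x)).1 (f a b)) (fun _ _ _ => erefl)).
rewrite (sweedler_coassoc _ ft); apply: eq_bigr => u _.
rewrite /rgr (linear_sum_of (fb.2 _)); apply: eq_bigr => v _.
by rewrite (linearZ_of (fb.2 _)).
Qed.

Lemma lgr_lgr x y h : lgr y (lgr x h) = if x == y then lgr x h else 0.
Proof.
rewrite {1}/lgr (sum_comul_lgr _ _ (lgr_bilin y)).
under eq_bigr => u _ do rewrite p_lgr_eval.
by case: eqP => [->|_] //; rewrite big1 // => u _; rewrite scale0r.
Qed.

Lemma lgr_rgr x y h : lgr x (rgr y h) = rgr y (lgr x h).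
Proof.
rewrite {1}/lgr (sum_comul_rgr _ _ (lgr_bilin x)) (linear_sum_of (rgr_linear y)).
by apply: eq_bigr => u _; rewrite (linearZ_of (rgr_linear y)).
Qed.

Lemma lgrM x g h : lgr x (g * h) = \sum_y lgr y g * lgr (y^-1 * x)%g h.
Proof.
rewrite /lgr (sweedler_mul _ _ (lgr_bilin x)).
under [RHS]eq_bigr => y _ do rewrite mulr_suml.
rewrite [RHS]exchange_big; apply: eq_bigr => u _ /=.
under [RHS]eq_bigr => y _ do rewrite mulr_sumr.
rewrite [RHS]exchange_big; apply: eq_bigr => v _ /=.
rewrite rmorphM ffunE scaler_suml; apply: eq_bigr => y _.
by rewrite -scalerAl -scalerAr scalerA.
Qed.

Lemma rgrM x g h : rgr x (g * h) = \sum_y rgr y g * rgr (y^-1 * x)%g h.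
Proof.
rewrite /rgr (sweedler_mul _ _ (rgr_bilin x)).
under [RHS]eq_bigr => y _ do rewrite mulr_suml.
rewrite [RHS]exchange_big; apply: eq_bigr => u _ /=.
under [RHS]eq_bigr => y _ do rewrite mulr_sumr.
rewrite [RHS]exchange_big; apply: eq_bigr => v _ /=.
rewrite rmorphM ffunE scaler_suml; apply: eq_bigr => y _.
by rewrite -scalerAl -scalerAr scalerA.
Qed.

Lemma p_inj f : p (i f) = (f 1%g)%:A.
Proof.
suff : p (i (f - (f 1%g)%:A)) = 0.
  rewrite !linearB /= !linearZ /= !rmorph1 scalerN; exact: subr0_eq.
apply: (proj2 (ker_p _)); exists [:: (f - (f 1%g)%:A, 1)]; rewrite big_seq1 /= mulr1; split=> //.
by rewrite andbT /counit /= /falg_counit !ffunE [_ *: _]mulr1 subrr.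
Qed.

Lemma sum_comul_inj (X : lmodType k) (g : H -> H -> X) f : bilinear_map g ->
  \sum_(u <- comul (i f)) g u.1 u.2 =
  \sum_a g (i (falg_delta k a)) (i (falg_shift a f)).
Proof.
move=> gb; rewrite (ih.1 f X _ gb) [LHS]big_map /=.
exact: (sum_falg_comul (fun u v => g (i u) (i v))).
Qed.

Lemma p_inj_eval f x : p (i f) x = if x == 1%g then f 1%g else 0.
Proof.
rewrite p_inj !ffunE.
by case: eqP => _; [rewrite [LHS]mulr1 | rewrite [LHS]mulr0].
Qed.

Lemma lgr_inj x f : lgr x (i f) = if x == 1%g then i f else 0.
Proof.
rewrite /lgr (sum_comul_inj _ (lgr_bilin x)); case: (x =P 1%g) => [->|/eqP nx].
  rewrite (bigD1 1%g) //= big1 ?addr0 => [|a na].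
    rewrite p_inj_eval eqxx ffunE eqxx scale1r; congr (i _).
    by apply/ffunP=> b; rewrite ffunE mul1g.
  by rewrite p_inj_eval eqxx ffunE eq_sym (negPf na) scale0r.
by apply: big1 => a _; rewrite p_inj_eval (negPf nx) scale0r.
Qed.

Lemma rgr_inj x f : rgr x (i f) = if x == 1%g then i f else 0.
Proof.
rewrite /rgr (sum_comul_inj _ (rgr_bilin x)); case: (x =P 1%g) => [->|/eqP nx].
  rewrite [in RHS](falg_expand f) linear_sum; apply: eq_bigr => a _.
  by rewrite p_inj_eval eqxx ffunE mulg1 linearZ.
by apply: big1 => a _; rewrite p_inj_eval (negPf nx) scale0r.
Qed.

Local Notation E := (i (falg_delta k 1%g)).

(** The kernel is generated by the augmentation ideal of k^G, which the indicator of 1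
    annihilates. *)
Lemma inj1_ker h : p h = 0 -> E * h = 0.
Proof.
case/ker_p=> s [/allP s0 ->]; rewrite mulr_sumr big_seq big1 // => u /s0 /eqP u0.
rewrite mulrA -rmorphM; have -> : falg_delta k 1%g * u.1 = 0.
  apply/ffunP=> a; rewrite !ffunE; case: eqP => [->|_]; last by rewrite mul0r.
  by rewrite -[u.1 1%g]/(counit u.1) u0 mulr0.
by rewrite rmorph0 mul0r.
Qed.

Lemma inj1_lgr h : E * lgr 1%g h = counit (lgr 1%g h) *: E.
Proof.
have pl : p (lgr 1%g h - (counit (lgr 1%g h))%:A) = 0.
  rewrite linearB linearZ /= rmorph1 -(ph.2 (lgr _ _)) p_lgr.
  rewrite {1}/counit /= (scalable_linear (@galg_counit_linear k F)).
  by rewrite galg_counit_of /= mulr1 subrr.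
have := inj1_ker pl; rewrite mulrBr -scalerAr mulr1; exact: subr0_eq.
Qed.

(* Expand Delta (E h_1) (1 (x) S h_2) in two ways, where E is the image of the
   indicator of 1, using that E g = eps g E for every left coinvariant g. *)
Lemma lgr1_swap (X : lmodType k) (f : H -> H -> X) h : bilinear_map f ->
  \sum_a f (i (falg_delta k a) * lgr 1%g h) (i (falg_delta k a^-1%g)) =
  \sum_a f (i (falg_delta k a)) (i (falg_delta k a^-1%g) * antipode (lgr 1%g h)).
Proof.
move=> fb; set g := lgr 1%g h.
have shift1 a : falg_shift a (falg_delta k 1%g) = falg_delta k a^-1%g.
  by apply/ffunP=> b; rewrite !ffunE -[in RHS](inj_eq (mulgI a)) mulgV.
have sumE (f' : H -> H -> X) : bilinear_map f' -> \sum_(w <- comul E) f' w.1 w.2 =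
    \sum_a f' (i (falg_delta k a)) (i (falg_delta k a^-1%g)).
  by move=> fb'; rewrite sum_comul_inj //; apply: eq_bigr => a _; rewrite shift1.
pose L b := \sum_(w <- comul E) f w.1 (w.2 * antipode b).
have Sl := @antipode_linear k H.
have mS b : linear (fun z : H => z * antipode b) by exact: mulr_linear.
have Ll : linear L.
  apply: linear_sum_fun => w; apply: linear_comp (fb.2 _) _.
  exact: linear_comp (mull_linear _) Sl.
have fS b : bilinear_map (fun w z => f w (z * antipode b)).
  exact: (bilinear_comp fb).
pose f1 a b := \sum_(w <- comul (E * a)) f w.1 (w.2 * antipode b).
have f1b : bilinear_map f1.
  split=> [b c u v|a].
    by rewrite /f1 mulrDr -scalerAr (sweedlerP (fS b)).
  apply: linear_sum_fun => w; apply: linear_comp (fb.2 _) _.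
  exact: linear_comp (mull_linear _) Sl.
rewrite -(sumE (fun a b => f (a * g) b)); last first.
  by apply: (bilinear_comp fb) => //; apply: mulr_linear.
rewrite -(sumE _ (fS g)) -/(L g).
transitivity (\sum_(u <- comul g) f1 u.1 u.2).
  symmetry; under eq_bigr => u _ do rewrite /f1 (sweedler_mul _ _ (fS u.2)).
  rewrite exchange_big /=; apply: eq_bigr => w _.
  rewrite (sweedler_coassoc (f := fun a b c => f (w.1 * a) (w.2 * b * antipode c))); last first.
    split=> [b c|a c|a b].
    - exact: linear_comp (fb.1 _) (mull_linear _).
    - apply: linear_comp (fb.2 _) _; apply: linear_comp (mS c) (mull_linear _).
    - apply: linear_comp (fb.2 _) _; apply: linear_comp (mull_linear _) Sl.
  transitivity (\sum_(u <- comul g) f (w.1 * (counit u.2 *: u.1)) w.2).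
    apply: eq_bigr => u _.
    under eq_bigr => v _ do rewrite -mulrA.
    rewrite -(linear_sum_of (fb.2 _)) -mulr_sumr antipoder -!scalerAr mulr1.
    by rewrite (linearZ_of (fb.1 _)) (linearZ_of (fb.2 _)).
  by rewrite -(linear_sum_of (fb.1 _)) -mulr_sumr counitr.
rewrite /g (sum_comul_lgr _ _ f1b).
transitivity (\sum_(u <- comul h) counit (lgr 1%g u.1) *: L u.2).
  by apply: eq_bigr => u _; rewrite /f1 inj1_lgr (sweedlerZ (fS _)).
have cL : bilinear_map (fun a b : H => counit a *: L b).
  exact: (bilinear_comp (g := id) (bilinear_scale X (@counit_linear k H))).
rewrite -(sum_comul_lgr _ _ cL) -[in RHS](counitl (lgr 1%g h)) (linear_sum_of Ll).
by apply: eq_bigr => u _; rewrite (linearZ_of Ll).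
Qed.

Hypothesis i_inj : injective i.

(** In [lgr1_swap], multiplying the first factor by the indicator of [a] and applying to the second
    a functional [psi] that is 1 on the indicator of [a^-1] isolates one term: each indicator times
    a coinvariant is a multiple of that indicator. *)
Lemma lgr1_image h : exists f, lgr 1%g h = i f.
Proof.
have E1 : 1 = \sum_a i (falg_delta k a).
  rewrite -(rmorph1 i) [X in i X = _]falg_expand linear_sum; apply: eq_bigr => a _.
  by rewrite ffunE scale1r.
suff row a : exists c : k, i (falg_delta k a) * lgr 1%g h = c *: i (falg_delta k a).
  have [c cE] := fin_all_exists row.
  exists (\sum_a c a *: falg_delta k a).
  rewrite -[LHS]mul1r E1 mulr_suml linear_sum; apply: eq_bigr => a _.
  by rewrite cE linearZ.
have nz : i (falg_delta k a^-1%g) != 0.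
  rewrite -(rmorph0 i) (inj_eq i_inj); apply/eqP=> /ffunP/(_ a^-1%g)/eqP.
  by rewrite !ffunE eqxx oner_eq0.
have [psi psil psi1] := exists_functional nz.
have iM b : i (falg_delta k a) * i (falg_delta k b) = (a == b)%:R *: i (falg_delta k a).
  by rewrite -rmorphM falg_deltaM [LHS]linearZ.
exists (psi (i (falg_delta k a^-1%g) * antipode (lgr 1%g h))).
have fb : bilinear_map (fun g z : H => psi z *: (i (falg_delta k a) * g)).
  exact: (bilinear_comp (bilinear_scale_r H psil) (mull_linear _) (h := id)).
have := lgr1_swap h fb.
rewrite (bigD1 a) //= big1 ?addr0 => [|b nb]; last first.
  by rewrite mulrA iM eq_sym (negPf nb) scale0r mul0r scaler0.
rewrite mulrA iM eqxx scale1r psi1 scale1r => ->.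
rewrite (bigD1 a) //= big1 ?addr0 => [|b nb]; last first.
  by rewrite iM eq_sym (negPf nb) scale0r scaler0.
by rewrite iM eqxx scale1r.
Qed.

End Gradings.

(** * The generator over [t2], its cocycle and its square *)

Section CleftStructure.
Variables (k : fieldType) (G : finGroupType) (H : hopfAlgType k).
Variables (i : {lrmorphism fun_alg k G -> H}) (p : {lrmorphism H -> group_alg k C2}).
Variable to : groupAction [set: C2] [set: G].
Hypotheses (ext : hopf_extension i p) (act : extension_action i p to).
Implicit Types (f : fun_alg k G) (h : H) (a b c : G).
Local Notation t a := (to a t2).
Local Notation lgr := (lgr p).
Local Notation rgr := (rgr p).

Let ih : hopf_map i. Proof. by case: ext => [[]]. Qed.
Let ph : hopf_map p. Proof. by case: ext => [[]]. Qed.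
Let i_inj : injective i. Proof. by case: ext. Qed.
Let ker_p h : p h = 0 <->
  exists s : seq (fun_alg k G * H), all (fun u => counit u.1 == 0) s /\
          h = \sum_(u <- s) i u.1 * u.2.
Proof. by case: ext. Qed.

(** [T] and [T'] are the values at [t2] of the section and of its convolution inverse. The section
    is a right comodule map, which gives only the right degree of [T]; the left degrees have to be
    deduced. *)
Lemma cleft_generator : exists T T' : H,
  [/\ T * T' = 1, T' * T = 1,
      forall f, T * i f = i [ffun a => f (t a)] * T,
      lgr 1%g T = 0 /\ lgr 1%g T' = 0 & rgr t2 T = T].
Proof.
case: act => c [c' [[c1 c2 c3] cE]].
pose T := c (galg_of k t2); pose T' := c' (galg_of k t2).
have sum_of (X : lmodType k) (g : group_alg k C2 -> group_alg k C2 -> X) x :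
    bilinear_map g -> \sum_(u <- comul (galg_of k x)) g u.1 u.2 = g (galg_of k x) (galg_of k x).
  by move=> gb; rewrite [LHS](sum_galg_bilin _ gb) sum_galg_of.
have cl : linear c by move=> s u v; rewrite linearP.
have cl' : linear c' by move=> s u v; rewrite linearP.
have TT' : T * T' = 1.
  have := c2 (galg_of k t2).
  rewrite (sum_of H (fun u v => c u * c' v)); last exact: bilinear_comp (bilinear_mul H) cl cl'.
  by rewrite /counit /= galg_counit_of scale1r.
have T'T : T' * T = 1.
  have := c3 (galg_of k t2).
  rewrite (sum_of H (fun u v => c' u * c v)); last exact: bilinear_comp (bilinear_mul H) cl' cl.
  by rewrite /counit /= galg_counit_of scale1r.
have rT x : rgr x T = galg_of k t2 x *: T.
  have gb : bilinear_map (fun (u : H) (v : group_alg k C2) => v x *: u).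
    by apply: bilinear_scale_r => s u v; rewrite !ffunE.
  have := c1 (galg_of k t2) _ _ gb; rewrite [LHS]big_map [RHS]big_map /= => E.
  rewrite /rgr [LHS]E (sum_of H (fun u v => v x *: c u)) //.
  exact: (bilinear_comp (h := id) gb cl).
have rTt : rgr t2 T = T by rewrite rT ffunE eqxx scale1r.
(* This component lies in k^G, of right degree 1, but inherits the right degree [t2] of [T]. *)
have lT1 : lgr 1%g T = 0.
  have [f fE] := lgr1_image ih ph ker_p i_inj T.
  by rewrite -{1}rTt lgr_rgr // fE rgr_inj // (negPf t2_neq1).
exists T, T'; split=> //.
  by move=> f; rewrite -cE -!/T -/T' -!mulrA T'T mulr1.
split=> //.
(* Once [lgr 1 T] is 0, the component of T T' = 1 in degree [t2] is [T * lgr 1 T'], and 1 has no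
   such component. *)
have := lgrM p t2 T T'.
rewrite TT' sum_C2 lT1 mul0r add0r mulVg => E.
have lt1 : lgr t2 1 = 0 by rewrite -(rmorph1 i) lgr_inj // (negPf t2_neq1).
have lTt : lgr t2 T = T by rewrite -[RHS](lgr_sum ph) sum_C2 lT1 add0r.
by move: E; rewrite lt1 lTt => /(congr1 (fun z => T' * z)); rewrite mulr0 mulrA T'T mul1r.
Qed.

Variables T T' : H.
Hypotheses (TT' : T * T' = 1) (T'T : T' * T = 1).
Hypothesis T_act : forall f, T * i f = i [ffun a => f (t a)] * T.
Hypotheses (lT1 : lgr 1%g T = 0) (lT'1 : lgr 1%g T' = 0) (rTt : rgr t2 T = T).

Lemma lgr_gen : lgr t2 T = T.
Proof. by rewrite -[RHS](lgr_sum ph) sum_C2 lT1 add0r. Qed.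

Lemma lgr_gen_inv : lgr t2 T' = T'.
Proof. by rewrite -[RHS](lgr_sum ph) sum_C2 lT'1 add0r. Qed.

(** Right multiplication by [T'] moves degree [t2] to degree 1, where [lgr1_image] applies. *)
Lemma lgrt_image h : exists f, lgr t2 h = i f * T.
Proof.
have [f fE] := lgr1_image ih ph ker_p i_inj (lgr t2 h * T').
exists f; rewrite -fE lgrM sum_C2 invg1 mul1g lT'1 mulr0 add0r t2V mulg1.
by rewrite lgr_lgr // eqxx lgr_gen_inv -mulrA T'T mulr1.
Qed.

(** Checked on the two pieces [i f] and [i g * T] of [h]. It lets both factors of the coproduct of
    [T] be expressed through the same coordinate [be]. *)
Lemma rgr_lgr h : rgr t2 h = lgr t2 h.
Proof.
rewrite -{1}(lgr_sum ph h) sum_C2.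
have [f ->] := lgr1_image ih ph ker_p i_inj h; have [g ->] := lgrt_image h.
rewrite -[i f]scale1r rgr_linear scale1r rgr_inj // (negPf t2_neq1) add0r.
by rewrite rgrM sum_C2 !rgr_inj // eqxx (negPf t2_neq1) mul0r addr0 invg1 mul1g rTt.
Qed.

Lemma gen_inj : injective (fun f => i f * T).
Proof.
by move=> f g /(congr1 (fun z => z * T')); rewrite -!mulrA TT' !mulr1; apply: i_inj.
Qed.

Lemma gen_sq : exists s, T * T = i s.
Proof.
have [s sE] := lgr1_image ih ph ker_p i_inj (T * T).
by exists s; rewrite -sE lgrM sum_C2 lT1 mul0r add0r mulg1 t2V lgr_gen.
Qed.

Lemma gen_coord : exists be : H -> fun_alg k G,
  [/\ linear be, forall h, lgr t2 h = i (be h) * T,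
      forall f h, be (i f * h) = f * be h & be T = 1].
Proof.
have [be beE] := boolp.choice lgrt_image.
exists be; split=> //.
- move=> c g h; apply: gen_inj; rewrite -beE lgr_linear !beE.
  by rewrite linearP mulrDl -scalerAl.
- move=> f h; apply: gen_inj; rewrite -beE lgrM sum_C2 !lgr_inj // eqxx.
  by rewrite (negPf t2_neq1) mul0r addr0 invg1 mul1g beE rmorphM mulrA.
by apply: gen_inj; rewrite -beE lgr_gen rmorph1 mul1r.
Qed.

Variable be : H -> fun_alg k G.
Hypotheses (be_lin : linear be) (beE : forall h, lgr t2 h = i (be h) * T).
Hypotheses (beM : forall f h, be (i f * h) = f * be h) (beT : be T = 1).

Definition gen_cocycle a b : k := \sum_(u <- comul T) be u.1 a * be u.2 b.
Local Notation tau := gen_cocycle.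
Local Notation eT a := (i (falg_delta k a) * T).

Lemma gen_expand f : i f * T = \sum_a f a *: eT a.
Proof.
rewrite {1}(falg_expand f) linear_sum mulr_suml.
by apply: eq_bigr => a _; rewrite linearZ -scalerAl.
Qed.

(** [T] has degree [t2] on both sides, so each factor of its coproduct may be replaced by its
    component of that degree, which is a function times [T]. *)
Lemma sum_comul_gen (X : lmodType k) (g : H -> H -> X) : bilinear_map g ->
  \sum_(u <- comul T) g u.1 u.2 = \sum_a \sum_b tau a b *: g (eT a) (eT b).
Proof.
move=> gb; rewrite -{1}lgr_gen (sum_comul_lgr _ _ _ gb).
have gb1 : bilinear_map (fun u v => g (lgr t2 u) v).
  exact: (bilinear_comp (h := id) gb (lgr_linear p t2)).
rewrite -{1}rTt (sum_comul_rgr _ _ _ gb1).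
under [RHS]eq_bigr => a _ do under eq_bigr => b _ do rewrite scaler_suml.
under [RHS]eq_bigr => a _ do rewrite exchange_big /=.
rewrite [RHS]exchange_big /=; apply: eq_bigr => u _.
rewrite rgr_lgr !beE gen_expand (linear_sum_of (gb.1 _)); apply: eq_bigr => a _.
rewrite (linearZ_of (gb.1 _)) (gen_expand (be u.2)) (linear_sum_of (gb.2 _)) scaler_sumr.
by apply: eq_bigr => b _; rewrite (linearZ_of (gb.2 _)) scalerA.
Qed.

Lemma inj_eT f a : i f * eT a = f a *: eT a.
Proof.
rewrite mulrA -rmorphM; have -> : f * falg_delta k a = f a *: falg_delta k a.
  apply/ffunP=> b; rewrite !ffunE.
  by case: eqP => [->|_]; rewrite ?mulr1 ?[RHS]mulr1 // mulr0 [RHS]mulr0.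
by rewrite scalerAl; congr (_ * T); exact: linearZ.
Qed.

Lemma sum_comul_inj_gen (X : lmodType k) (g : H -> H -> X) f : bilinear_map g ->
  \sum_(u <- comul (i f * T)) g u.1 u.2 =
  \sum_a \sum_b (f (a * b)%g * tau a b) *: g (eT a) (eT b).
Proof.
move=> gb; rewrite (sweedler_mul _ _ gb).
pose g1 u v := \sum_(w <- comul T) g (u * w.1) (v * w.2).
have g1b : bilinear_map g1.
  split=> u; apply: linear_sum_fun => w.
    exact: linear_comp (gb.1 _) (mulr_linear _).
  exact: linear_comp (gb.2 _) (mulr_linear _).
rewrite (sum_comul_inj ih _ g1b); apply: eq_bigr => a _.
have gb2 : bilinear_map (fun u v => g (i (falg_delta k a) * u) (i (falg_shift a f) * v)).
  exact: bilinear_comp gb (mull_linear _) (mull_linear _).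
rewrite /g1 (sum_comul_gen gb2) (bigD1 a) //= [X in _ + X]big1 ?addr0 => [|c nc].
  apply: eq_bigr => b _; rewrite !inj_eT !ffunE eqxx scale1r.
  by rewrite (linearZ_of (gb.2 _)) scalerA mulrC.
apply: big1 => b _; rewrite inj_eT ffunE (negPf nc).
by rewrite (linearZ_of (gb.1 _)) scale0r scaler0.
Qed.

Lemma be_eval_linear a : scalar (fun h => be h a).
Proof. by move=> c g h; rewrite be_lin !ffunE. Qed.

Lemma be_eT a b : be (eT a) b = (b == a)%:R.
Proof. by rewrite beM beT mulr1 ffunE. Qed.

Lemma mul_eval_bilinear (A : lmodType k) (phi psi : A -> k) :
  scalar phi -> scalar psi ->
  @bilinear_map k A A k^o (fun u v => phi u * psi v).
Proof.
move=> fl gl; split=> u c v w; rewrite ?fl ?gl ?mulrDl ?mulrDr -?mulrA //.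
by rewrite mulrCA.
Qed.

Lemma be_inj f : be (i f) = 0.
Proof.
rewrite -[i f]mulr1 beM; suff -> : be 1 = 0 by rewrite mulr0.
apply: gen_inj; rewrite -beE -{1}(rmorph1 i) lgr_inj // (negPf t2_neq1).
by rewrite rmorph0 mul0r.
Qed.

Lemma comul_be h a b :
  \sum_(u <- comul h) be u.1 a * be u.2 b = be h (a * b)%g * tau a b.
Proof.
have gb := mul_eval_bilinear (be_eval_linear a) (be_eval_linear b).
have [f fE] := lgr1_image ih ph ker_p i_inj h; have [g gE] := lgrt_image h.
rewrite -(lgr_sum ph h) sum_C2 fE gE -[i f]scale1r (sweedlerP gb) be_lin.
rewrite (sum_comul_inj ih _ gb) big1 ?scaler0 ?add0r => [|c _]; last first.
  by rewrite be_inj ffunE mul0r.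
rewrite be_inj scaler0 add0r beM beT mulr1 (sum_comul_inj_gen _ gb).
rewrite (bigD1 a) //= [X in _ + X]big1 ?addr0 => [|c nc]; last first.
  by apply: big1 => d _; rewrite be_eT eq_sym (negPf nc) mul0r scaler0.
rewrite (bigD1 b) //= [X in _ + X]big1 ?addr0 => [|d nd]; last first.
  by rewrite (be_eT d) (eq_sym b) (negPf nd) mulr0 scaler0.
by rewrite !be_eT !eqxx mulr1 [LHS]mulr1.
Qed.

(** Coassociativity at [T], tested on the coordinates at [a], [b] and [c]. *)
Lemma gen_cocycleP a b c : tau a b * tau (a * b)%g c = tau b c * tau a (b * c)%g.
Proof.
have gt : @trilinear_map k H H H k^o (fun u v w => be u a * be v b * be w c).
  split=> [v w|u w|u v] s x y; rewrite be_eval_linear.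
  - by rewrite !mulrDl -!mulrA.
  - by rewrite mulrDr mulrDl mulrCA -!mulrA.
  - by rewrite mulrDr mulrCA.
have := sweedler_coassoc T gt.
under eq_bigr => u _ do rewrite -mulr_suml comul_be mulrAC mulrC.
rewrite -mulr_sumr => ->.
under eq_bigr => u _ do under eq_bigr => v _ do rewrite -mulrA.
under eq_bigr => u _ do rewrite -mulr_sumr comul_be mulrA mulrC.
by rewrite -mulr_sumr.
Qed.

Lemma be_gen_linear a : scalar (fun h => be (h * T) a).
Proof. by move=> c g h; rewrite mulrDl -scalerAl be_eval_linear. Qed.

(** In the coproduct of T T' = 1 every term contributing at (a, b) contains [tau a b]. The
    functional [be (h * T)] reads the component of [h] in k^G. *)
Lemma gen_cocycle_neq0 a b : tau a b != 0.
Proof.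
apply/eqP=> tau0.
have gb := mul_eval_bilinear (be_gen_linear a) (be_gen_linear b).
have := sweedler1 (H := H) gb; rewrite !mul1r beT !ffunE mulr1 -{1}TT'.
rewrite (sweedler_mul _ _ gb).
have g1b : @bilinear_map k H H k^o (fun u w =>
    \sum_(v <- comul T') be (u * v.1 * T) a * be (w * v.2 * T) b).
  split=> u; apply: linear_sum_fun => w.
    exact: (linear_comp (gb.1 _) (mulr_linear _)).
  exact: (linear_comp (gb.2 _) (mulr_linear _)).
rewrite (sum_comul_gen g1b) big1 => [/eqP|c _]; first by rewrite eq_sym oner_eq0.
apply: big1 => d _.
have beTv e h e' : be (eT e * h * T) e' = (e' == e)%:R * be (T * h * T) e'.
  by rewrite -!mulrA beM !ffunE.
case: (c =P a) => [->|/eqP nc]; last first.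
  by rewrite big1 ?scaler0 // => v _; rewrite beTv eq_sym (negPf nc) !mul0r.
case: (d =P b) => [->|/eqP nd]; first by rewrite tau0 scale0r.
rewrite big1 ?scaler0 // => v _.
by rewrite (beTv d) (eq_sym b) (negPf nd) mul0r mulr0.
Qed.

Variable s : fun_alg k G.
Hypothesis sE : T * T = i s.

Lemma gen_sq_neq0 a : s a != 0.
Proof.
have : be (T * T * T') a = 1 by rewrite -mulrA TT' mulr1 beT ffunE.
rewrite sE beM ffunE => E; apply/eqP=> s0.
by move/eqP: E; rewrite s0 mul0r eq_sym oner_eq0.
Qed.

(** [T] commutes with its own square. *)
Lemma gen_sq_act a : s (t a) = s a.
Proof.
have /gen_inj : i [ffun a => s (t a)] * T = i s * T by rewrite -T_act -sE mulrA.
by move=> /ffunP/(_ a); rewrite ffunE.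
Qed.

(** The coproduct of T^2 against the square of the coproduct of [T], at (a, b); moving [T] past the
    indicators of the second copy produces [t a] and [t b]. *)
Lemma gen_sq_cocycle a b : s (a * b)%g = tau a b * tau (t a) (t b) * s a * s b.
Proof.
have gb := mul_eval_bilinear (be_gen_linear a) (be_gen_linear b).
have beTT c d e : be (eT c * eT d * T) e = (e == c)%:R * (t e == d)%:R * s e.
  rewrite -!mulrA beM !ffunE; congr (_ * _).
  rewrite (mulrA T) T_act -!mulrA beM !ffunE sE T_act beM beT mulr1 ffunE.
  by rewrite gen_sq_act.
have : \sum_(u <- comul (i s)) be (u.1 * T) a * be (u.2 * T) b = s (a * b)%g.
  rewrite (sum_comul_inj ih _ gb) (bigD1 a) //= [X in _ + X]big1 ?addr0 => [|c nc].
    by rewrite !beM beT !mulr1 !ffunE eqxx mul1r.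
  by rewrite beM beT mulr1 ffunE eq_sym (negPf nc) mul0r.
move=> <-; rewrite -sE (sweedler_mul _ _ gb).
have g1b : @bilinear_map k H H k^o (fun u w =>
    \sum_(v <- comul T) be (u * v.1 * T) a * be (w * v.2 * T) b).
  split=> u; apply: linear_sum_fun => w.
    exact: (linear_comp (gb.1 _) (mulr_linear _)).
  exact: (linear_comp (gb.2 _) (mulr_linear _)).
have gvb u w : @bilinear_map k H H k^o (fun v v' =>
    be (u * v * T) a * be (w * v' * T) b).
  exact: (bilinear_comp gb (mull_linear _) (mull_linear _)).
rewrite (sum_comul_gen g1b) (bigD1 a) //= [X in _ + X]big1 ?addr0 => [|c nc]; last first.
  apply: big1 => d _; rewrite (sum_comul_gen (gvb _ _)) big1 ?scaler0 // => c' _.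
  by apply: big1 => d' _; rewrite beTT eq_sym (negPf nc) !mul0r scaler0.
rewrite (bigD1 b) //= [X in _ + X]big1 ?addr0 => [|d nd]; last first.
  rewrite (sum_comul_gen (gvb _ _)) big1 ?scaler0 // => c' _.
  by apply: big1 => d' _; rewrite (beTT d) (eq_sym b) (negPf nd) !mul0r mulr0 scaler0.
rewrite (sum_comul_gen (gvb _ _)).
rewrite (bigD1 (t a)) //= [X in _ *: (_ + X)]big1 ?addr0 => [|c nc]; last first.
  by apply: big1 => d _; rewrite beTT (eq_sym _ c) (negPf nc) mulr0 !mul0r scaler0.
rewrite (bigD1 (t b)) //= [X in _ *: (_ + X)]big1 ?addr0 => [|d nd]; last first.
  by rewrite (beTT b) (eq_sym _ d) (negPf nd) mulr0 !mul0r mulr0 scaler0.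
by rewrite !beTT !eqxx !mul1r -!mulrA.
Qed.

End CleftStructure.

(** * Normal form of the cocycles *)

Section CommonEigenvector.
Variable k : closedFieldType.

(** [B] is the matrix of [A] restricted to the row space of [V], and its characteristic polynomial
    has a root. *)
Lemma stable_eigenspace n (V A : 'M[k]_n) : V != 0 -> stablemx V A ->
  exists a, (V :&: eigenspace A a)%MS != 0.
Proof.
move=> V0 VA; pose W := row_base V; pose B := W *m A *m pinvmx W.
have BW : B *m W = W *m A.
  by rewrite mulmxKpV // eq_row_base (eqmxMr A (eq_row_base V)).
have /closed_rootP[a] : size (char_poly B) != 1.
  by rewrite size_char_poly eqSS mxrank_eq0.
rewrite -eigenvalue_root_char => /eigenvalueP[v vB v0].
exists a; apply/rowV0Pn; exists (v *m W); last first.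
  by rewrite mulmx_free_eq0 ?row_base_free.
rewrite sub_capmx -{1}(eq_row_base V) submxMl; apply/eigenspaceP.
by rewrite -mulmxA -BW mulmxA vB -scalemxAl.
Qed.

(** Cut [V] down to an eigenspace of the first matrix, which the others preserve because they
    commute with it. *)
Lemma commuting_eigenvector n (As : seq 'M[k]_n) (V : 'M[k]_n) : V != 0 ->
    {in As, forall A, stablemx V A} ->
    {in As &, forall A B, A *m B = B *m A} ->
  exists v : 'rV_n, [/\ v != 0, (v <= V)%MS
    & {in As, forall A, exists a, v *m A = a *: v}].
Proof.
elim: As V => [|A As IHs] V V0 VAs comm.
  by have /rowV0Pn[v vV v0] := V0; exists v.
have [a W0] := stable_eigenspace V0 (VAs A (mem_head _ _)).
pose W := (V :&: eigenspace A a)%MS.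
have sub_W m (v : 'M_(m, n)) : (v <= W)%MS = (v <= V)%MS && (v *m A == a *: v).
  by rewrite sub_capmx; congr (_ && _); apply/eigenspaceP/eqP.
have WAs : {in A :: As, forall B, stablemx W B}.
  move=> B BAs; have := submx_refl W; rewrite sub_W => /andP[WV /eqP WA].
  rewrite sub_W (submx_trans (submxMr B WV) (VAs B BAs)) /=.
  by rewrite -mulmxA -(comm _ _ (mem_head _ _) BAs) mulmxA WA -scalemxAl.
have sAs : {subset As <= A :: As} by move=> B BAs; rewrite inE BAs orbT.
have [||v [v0 vW vAs]] := IHs W W0.
- by move=> B /sAs; apply: WAs.
- by move=> B C /sAs BAs /sAs CAs; apply: comm.
move: vW; rewrite sub_W => /andP[vV /eqP vA].
by exists v; split=> // B; rewrite inE => /predU1P[->|/vAs//]; exists a.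
Qed.

Variable G : finGroupType.
Hypothesis abG : forall a b : G, commute a b.

(* The operators of the twisted regular representation commute, and the
   eigenvalues of a common eigenvector trivialise the cocycle. *)
Lemma symmetric_cocycle_coboundary (ka : G -> G -> k) :
    (forall a b, ka a b != 0) -> (forall a b, ka a b = ka b a) ->
    (forall a b c, ka a b * ka (a * b)%g c = ka b c * ka a (b * c)%g) ->
  exists2 nu : G -> k, (forall a, nu a != 0) &
    forall a b, nu a * nu b = ka a b * nu (a * b)%g.
Proof.
move=> ka0 kaC kaP.
pose R a : 'M[k]_#|G| :=
  \matrix_(i, j) if enum_val i == (enum_val j * a)%g then ka (enum_val j) a else 0.
pose ev (v : 'rV[k]_#|G|) x := v 0 (enum_rank x).
have evR v a x : ev (v *m R a) x = ka x a * ev v (x * a)%g.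
  rewrite /ev mxE (bigD1 (enum_rank (x * a)%g)) //= mxE !enum_rankK eqxx.
  rewrite big1 ?addr0 => [|i ni]; first by rewrite mulrC.
  rewrite mxE enum_rankK; case: eqP => [ix|_]; last by rewrite mulr0.
  by rewrite -ix enum_valK eqxx in ni.
have evP u v : (forall x, ev u x = ev v x) -> u = v.
  by move=> uv; apply/rowP=> i; rewrite -(enum_valK i); apply: uv.
have RM a b : R a *m R b = ka a b *: R (a * b)%g.
  apply/row_matrixP => i; apply: evP => x.
  rewrite !rowE mulmxA !evR -scalemxAr [RHS]mxE -/(ev _ x) evR (abG a b) mulgA.
  by rewrite !mulrA kaP (kaC b a).
have [v v0 vR] : exists2 v : 'rV_#|G|, v != 0 & forall a, exists c, v *m R a = c *: v.
  have I0 : (1%:M : 'M[k]_#|G|) != 0.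
    by rewrite -mxrank_eq0 mxrank1 -lt0n; apply/card_gt0P; exists 1%g.
  have [||v [v0 _ vR]] := commuting_eigenvector (As := [seq R a | a : G]) I0.
  - by move=> A _; apply: submx_full; rewrite -sub1mx.
  - move=> _ _ /mapP[a _ ->] /mapP[b _ ->].
    by rewrite !RM kaC (abG a).
  by exists v => // a; apply: vR; apply: map_f; rewrite mem_enum.
have [nu nuE] := fin_all_exists vR.
have inj c d : c *: v = d *: v -> c = d.
  by move/eqP; rewrite -subr_eq0 -scalerBl scaler_eq0 (negPf v0) orbF subr_eq0 => /eqP.
exists nu => [a|a b].
  apply/eqP=> nu0; move/negP: v0; apply; apply/eqP/evP => x.
  have := congr1 (fun u => ev u (x * a^-1)%g) (nuE a).
  rewrite nu0 scale0r evR mulgKV [in RHS]/ev mxE => /eqP.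
  by rewrite mulf_eq0 (negPf (ka0 _ _)) /= => /eqP ->; rewrite /ev mxE.
apply: inj; rewrite -[LHS]scalerA -[RHS]scalerA -!nuE scalemxAl -nuE.
by rewrite -mulmxA RM -scalemxAr.
Qed.

Hypothesis oG : odd #|G|.

Lemma bimult_root (ga : G -> G -> k) : (forall a b, ga a b != 0) ->
  (forall a b c, ga (a * b)%g c = ga a c * ga b c) ->
  forall a b, ga a b ^+ #|G| = 1.
Proof.
move=> ga0 gaM a b.
have ga1 : ga 1%g b = 1 by apply: (mulfI (ga0 1%g b)); rewrite -gaM mulg1 mulr1.
have gaX m : ga (a ^+ m)%g b = ga a b ^+ m.
  by elim: m => [|m IHm]; rewrite ?expr0 // expgS gaM IHm exprS.
by rewrite -gaX -cardsT expg_cardG ?inE.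
Qed.

(* The square root of the commutator pairing of [ta] is again bimultiplicative
   because [#|G|] is odd, and dividing [ta] by it leaves a symmetric cocycle. *)
Lemma cocycle_normal_form (ta : G -> G -> k) : (forall a b, ta a b != 0) ->
    (forall a b c, ta a b * ta (a * b)%g c = ta b c * ta a (b * c)%g) ->
  exists (be : G -> G -> k) (nu : G -> k),
  [/\ forall a b c, be (a * b)%g c = be a c * be b c,
      forall a b c, be a (b * c)%g = be a b * be a c,
      forall a, be a a = 1, forall a, nu a != 0
    & forall a b, nu (a * b)%g * ta a b = be a b * (nu a * nu b)].
Proof.
(* The commutator pairing; its multiplicativity combines the cocycle identity at three orderings of
   the arguments. *)
move=> ta0 taP; pose al a b := ta a b / ta b a.
have al0 a b : al a b != 0 by rewrite mulf_neq0 ?invr_eq0.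
have alM a b c : al (a * b)%g c = al a c * al b c.
  have E1 := taP a b c; have E2 := taP c a b; have E3 := taP a c b.
  rewrite -(abG a c) in E2; rewrite -(abG b c) in E3.
  rewrite /al mulf_div; apply/eqP; rewrite eqr_div ?mulf_neq0 //; apply/eqP.
  apply: (mulfI (ta0 a b)); apply: (mulfI (ta0 (a * c)%g b)).
  transitivity (ta b c * (ta c b * ta a (b * c)%g) * (ta c a * ta (a * c)%g b)).
    transitivity (ta a b * ta (a * b)%g c * (ta (a * c)%g b * (ta c a * ta c b))).
      by ring.
    by rewrite E1; ring.
  by rewrite -E3 E2; ring.
have alC a b : al a b * al b a = 1 by rewrite /al mulrA divfK // divff.
have alMr a b c : al a (b * c)%g = al a b * al a c.
  apply: (mulIf (al0 (b * c)%g a)); rewrite alC alM mulrACA.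
  by rewrite !alC mulr1.
have alN := bimult_root al0 alM.
(* The exponent is (|G|+1)/2, so the square is [al] to the power |G|+1, that is [al]. *)
pose be a b := al a b ^+ (#|G|./2).+1.
have be0 a b : be a b != 0 by rewrite expf_neq0.
have beM a b c : be (a * b)%g c = be a c * be b c by rewrite /be alM exprMn.
have beMr a b c : be a (b * c)%g = be a b * be a c by rewrite /be alMr exprMn.
have be2 a b : be a b ^+ 2 = al a b.
  have N2 : (#|G|./2.*2).+1 = #|G| by rewrite -[RHS]odd_double_half oG.
  by rewrite -exprM muln2 doubleS exprS N2 alN mulr1.
have beC a b : be a b * be b a = 1 by rewrite -exprMn alC expr1n.
pose ka a b := ta a b / be a b.
have [|a b|a b c|nu nu0 nuM] := @symmetric_cocycle_coboundary ka.
- by move=> a b; rewrite mulf_neq0 ?invr_eq0.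
- apply/eqP; rewrite eqr_div //; apply/eqP.
  apply: (mulIf (be0 a b)); rewrite -mulrA (mulrC (be b a)) beC mulr1.
  by rewrite -mulrA -expr2 be2 /al mulrC divfK.
- rewrite /ka !mulf_div beM beMr taP; congr (_ / _); ring.
exists be, nu; split=> // [a|a b]; first by rewrite /be /al divff ?expr1n.
by rewrite nuM /ka mulrA (mulrC (be a b)) divfK // mulrC.
Qed.

End CommonEigenvector.

Section C2Twist.
Variables (k : fieldType) (G : finGroupType) (to : groupAction [set: C2] [set: G]).
Variable be : G -> G -> k.
Hypotheses (beM : forall a b c, be (a * b)%g c = be a c * be b c)
  (beMr : forall a b c, be a (b * c)%g = be a b * be a c)
  (be1 : forall a, be a a = 1)
  (be_act : forall a b, be a b * be (to a t2) (to b t2) = 1).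

Definition c2_twist_fun (x : C2) a b : k := if x == t2 then be a b else 1.

Fact c2_twistMl x a b c : c2_twist_fun x (a * b)%g c = c2_twist_fun x a c * c2_twist_fun x b c.
Proof. by rewrite /c2_twist_fun; case: ifP; rewrite ?mul1r. Qed.
Fact c2_twistMr x a b c : c2_twist_fun x a (b * c)%g = c2_twist_fun x a b * c2_twist_fun x a c.
Proof. by rewrite /c2_twist_fun; case: ifP; rewrite ?mul1r. Qed.
Fact c2_twist_alt x a : c2_twist_fun x a a = 1.
Proof. by rewrite /c2_twist_fun; case: ifP. Qed.
Fact c2_twist_coc x y a b : c2_twist_fun (x * y)%g a b =
  c2_twist_fun x a b * c2_twist_fun y (to a x) (to b x).
Proof.
rewrite /c2_twist_fun; case: (C2P x) => ->; case: (C2P y) => ->.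
all: rewrite ?mulg1 ?mul1g ?t2_mul ?eqxx ?(eq_sym 1%g) ?(negPf t2_neq1) ?mul1r ?mulr1 //.
by rewrite !act1.
Qed.
Fact c2_twist_id a b : c2_twist_fun 1%g a b = 1.
Proof. by rewrite /c2_twist_fun eq_sym (negPf t2_neq1). Qed.

Definition c2_twist : twist k to :=
  Twist c2_twistMl c2_twistMr c2_twist_alt c2_twist_coc c2_twist_id.

Lemma c2_twistE a b : c2_twist t2 a b = be a b.
Proof. by rewrite /= /c2_twist_fun eqxx. Qed.

End C2Twist.

Section NormalForm.
Variables (k : closedFieldType) (G : finGroupType).
Hypotheses (abG : forall a b : G, commute a b) (oG : odd #|G|).

(** After the rescaling of [cocycle_normal_form], the square [s1] is multiplicative up to [ga]. This
    [ga] is symmetric because [G] is abelian and antisymmetric as a product of alternating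
    bicharacters, hence 1, so [s1] is a character fixed by [t]. *)
Lemma twisted_cocycle_normal_form (t : G -> G) (ta : G -> G -> k) (s : G -> k) :
    {morph t : a b / (a * b)%g} -> involutive t ->
    (forall a b, ta a b != 0) ->
    (forall a b c, ta a b * ta (a * b)%g c = ta b c * ta a (b * c)%g) ->
    (forall a, s a != 0) -> (forall a, s (t a) = s a) ->
    (forall a b, s (a * b)%g = ta a b * ta (t a) (t b) * s a * s b) ->
  exists (be : G -> G -> k) (nu : G -> k),
  [/\ [/\ forall a b c, be (a * b)%g c = be a c * be b c,
          forall a b c, be a (b * c)%g = be a b * be a c & forall a, be a a = 1],
      forall a b, be a b * be (t a) (t b) = 1, forall a, nu a != 0,
      forall a b, nu (a * b)%g * ta a b = be a b * (nu a * nu b)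
    & forall a, nu a * nu (t a) * s a = 1].
Proof.
move=> tM tK ta0 taP s0 st sM.
have [be [nu [beM beMr be1 nu0 nuM]]] := cocycle_normal_form abG oG ta0 taP.
pose s1 a := nu a * nu (t a) * s a.
have s10 a : s1 a != 0 by rewrite !mulf_neq0.
pose ga a b := be a b * be (t a) (t b).
have s1M a b : s1 (a * b)%g = ga a b * (s1 a * s1 b).
  transitivity (nu (a * b)%g * ta a b * (nu (t a * t b)%g * ta (t a) (t b)) * (s a * s b)).
    by rewrite /s1 tM sM; ring.
  by rewrite !nuM /ga /s1; ring.
have gaC a b : ga a b = ga b a.
  apply: (mulIf (mulf_neq0 (s10 a) (s10 b))).
  by rewrite -s1M mulrC [RHS]mulrC (mulrC (s1 a)) mulrC [RHS]mulrC -s1M (abG a).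
have beC a b : be a b * be b a = 1.
  by have := be1 (a * b)%g; rewrite beM !beMr !be1 mul1r mulr1.
have be0 a b : be a b != 0.
  by apply/eqP=> b0; have /eqP := beC a b; rewrite b0 mul0r eq_sym oner_eq0.
have ga0 a b : ga a b != 0 by rewrite mulf_neq0.
have ga1 a b : ga a b = 1.
  apply: (odd_order_root1 oG).
    apply: bimult_root ga0 _ a b => a b c.
    by rewrite /ga tM !beM; ring.
  rewrite expr2 {2}gaC /ga mulrACA [X in _ * X]beC mulr1; exact: beC.
have {}s1M a b : s1 (a * b)%g = s1 a * s1 b by rewrite s1M ga1 mul1r.
have s1N a : s1 a ^+ #|G| = 1.
  have s11 : s1 1%g = 1 by apply: (mulfI (s10 1%g)); rewrite -s1M mulg1 mulr1.
  have s1X m : s1 (a ^+ m)%g = s1 a ^+ m.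
    by elim: m => [|m IHm]; rewrite ?expr0 // expgS s1M IHm exprS.
  by rewrite -s1X -cardsT expg_cardG ?inE.
(* The new factor s1^((|G|-1)/2) is a character, so it leaves [be] unchanged; it enters the square
   twice and turns [s1] into s1^|G| = 1. *)
exists be, (fun a => nu a * s1 a ^+ #|G|./2); split=> //.
- by move=> a; rewrite mulf_neq0 ?expf_neq0.
- by move=> a b; rewrite s1M exprMn mulrAC nuM; ring.
move=> a; have st1 : s1 (t a) = s1 a by rewrite /s1 tK st (mulrC (nu (t a))).
rewrite st1; transitivity (s1 a * (s1 a ^+ #|G|./2 * s1 a ^+ #|G|./2)).
  by rewrite /s1; ring.
have N2 : (#|G|./2.*2).+1 = #|G| by rewrite -[RHS]odd_double_half oG.
by rewrite -exprD addnn -exprS N2 s1N.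
Qed.

End NormalForm.

(** * Every extension is a twisted algebra *)

Section Classification.
Variables (k : closedFieldType) (G : finGroupType) (H : hopfAlgType k).
Hypotheses (abG : forall a b : G, commute a b) (oG : odd #|G|).
Variables (i : {lrmorphism fun_alg k G -> H}) (p : {lrmorphism H -> group_alg k C2}).
Variable to : groupAction [set: C2] [set: G].
Hypotheses (ext : hopf_extension i p) (act : extension_action i p to).

Lemma extension_twalg : exists D : twist k to, hopf_iso (twalg D) H.
Proof.
have [[ih ph] i_inj _ _ ker_p] := ext.
have [T [T' [TT' T'T T_act [lT1 lT'1] rTt]]] := cleft_generator ext act.
have [be0 [be_lin beE beM beT]] := gen_coord ext TT' T'T lT1 lT'1.
have [s sE] := gen_sq ext lT1.
pose ta := gen_cocycle T be0.
have tK : involutive (fun a => to a t2) by move=> a; rewrite -gact_comp t2_mul act1.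
have := twisted_cocycle_normal_form abG oG (gact_morph to t2) tK
  (gen_cocycle_neq0 ext TT' T'T lT1 lT'1 rTt be_lin beE beM beT)
  (gen_cocycleP ext TT' T'T lT1 lT'1 rTt be_lin beE beM beT)
  (gen_sq_neq0 TT' beM beT sE)
  (gen_sq_act ext TT' T_act sE)
  (gen_sq_cocycle ext TT' T'T T_act lT1 lT'1 rTt be_lin beE beM beT sE).
move=> [be [nu [[beMl beMr be1] be_act nu0 nuM nuS]]].
pose D := c2_twist beMl beMr be1 be_act.
pose t a := to a t2.
have kGC (f g : fun_alg k G) : f * g = g * f.
  by apply/ffunP=> a; rewrite !ffunE mulrC.
(* Rescaling by [nu] gives a generator of square 1 whose coproduct has the coefficients [be]. *)
pose n : fun_alg k G := [ffun a => nu a]; pose Tn := i n * T.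
have Tn_act f : Tn * i f = i [ffun a => f (t a)] * Tn.
  by rewrite /Tn -mulrA T_act !mulrA -!rmorphM kGC.
have TnTn : Tn * Tn = 1.
  have -> : Tn * Tn = i n * (T * i n) * T by rewrite /Tn !mulrA.
  rewrite T_act mulrA -mulrA sE -!rmorphM -(rmorph1 i); congr (i _).
  by apply/ffunP=> a; rewrite !ffunE nuS.
exists D.
pose f1 (f : twalg D) : fun_alg k G := [ffun a => f (1%g, a)].
pose f2 (f : twalg D) : fun_alg k G := [ffun a => f (t2, a)].
pose phi f : H := i (f1 f) + i (f2 f) * Tn.
have f1l : linear f1 by move=> c f g; apply/ffunP=> a; rewrite !ffunE.
have f2l : linear f2 by move=> c f g; apply/ffunP=> a; rewrite !ffunE.
have phil : linear phi.
  by move=> c f g; rewrite /phi f1l f2l !linearP mulrDl -scalerAl scalerDr addrACA.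
have phi1 b : phi (twe D 1%g b) = i (falg_delta k b).
  have -> : phi (twe D 1%g b) = i (falg_delta k b) + i 0 * Tn.
    congr (i _ + i _ * _); apply/ffunP=> a; rewrite !ffunE xpair_eqE ?eqxx //.
    by rewrite (negPf t2_neq1).
  by rewrite rmorph0 mul0r addr0.
have phi2 b : phi (twe D t2 b) = nu b *: (i (falg_delta k b) * T).
  have -> : phi (twe D t2 b) = i 0 + i (falg_delta k b) * Tn.
    congr (i _ + i _ * _); apply/ffunP=> a; rewrite !ffunE xpair_eqE ?eqxx //.
    by rewrite eq_sym (negPf t2_neq1).
  rewrite rmorph0 add0r /Tn mulrA -rmorphM kGC rmorphM -mulrA.
  by rewrite (inj_eT _) ffunE.
apply: (@hopf_isoP _ _ _ phi) => //.
- split=> [|f g].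
    have -> : phi 1 = i 1 + i 0 * Tn.
      congr (i _ + i _ * _); apply/ffunP=> a; rewrite !ffunE ?eqxx //=.
      by rewrite (negPf t2_neq1).
    by rewrite rmorph0 mul0r addr0 rmorph1.
  have fg1 : f1 (f * g) = f1 f * f1 g + f2 f * [ffun a => f2 g (t a)].
    apply/ffunP=> a; rewrite !ffunE sum_C2 /= invg1 mulg1 t2V act1 mulg1.
    by [].
  have fg2 : f2 (f * g) = f1 f * f2 g + f2 f * [ffun a => f1 g (t a)].
    apply/ffunP=> a; rewrite !ffunE sum_C2 /= invg1 mul1g t2V t2_mul act1.
    by [].
  rewrite /phi fg1 fg2 !rmorphD !rmorphM mulrDl mulrDr !mulrDl.
  rewrite -(mulrA (i (f2 f)) Tn (i (f1 g))) Tn_act.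
  rewrite -(mulrA (i (f2 f)) Tn (i (f2 g) * Tn)) (mulrA Tn) Tn_act -(mulrA _ Tn) TnTn mulr1.
  rewrite !mulrA -!addrA; congr (_ + _).
  by rewrite addrCA [RHS]addrC -addrA.
- move=> f X g gb.
  have gb2 : bilinear_map (fun u v => g (phi u) (phi v)) by apply: bilinear_comp.
  rewrite [RHS]big_map /= [RHS](sum_tw_bilin _ gb2) sum_C2.
  rewrite -[phi f]/(i (f1 f) + i (f2 f) * Tn) -[i (f1 f)]scale1r (sweedlerP gb)
    scale1r; congr (_ + _).
    rewrite (sum_comul_inj ih _ gb); apply: eq_bigr => a _.
    rewrite (falg_expand (falg_shift a (f1 f))) linear_sum (linear_sum_of (gb.2 _)).
    apply: eq_bigr => c _; rewrite linearZ (linearZ_of (gb.2 _)) !phi1.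
    by rewrite tw_id mulr1 !ffunE.
  rewrite /Tn mulrA -rmorphM (sum_comul_inj_gen ext T'T lT1 lT'1 rTt beE) //.
  apply: eq_bigr => a _; apply: eq_bigr => b _.
  rewrite !phi2 (linearZ_of (gb.1 _)) (linearZ_of (gb.2 _)) !scalerA.
  by rewrite !ffunE c2_twistE -/(ta a b) -!mulrA nuM !mulrA.
(* The coordinate over 1 is read after multiplying by [T], which moves degree 1 to degree [t2]; the
   square of [T] then lies in k^G and is killed by [be0]. Dividing by [nu] undoes the rescaling. *)
pose psi h : twalg D :=
  [ffun q => if q.1 == t2 then be0 h q.2 / nu q.2 else be0 (h * T) q.2].
have be_inj' := be_inj ext TT' beE beM.
have psiE f g : psi (i f + i g * T) = [ffun q => if q.1 == t2 then g q.2 / nu q.2 else f q.2].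
  have -> : i f + i g * T = 1 *: i f + i g * T by rewrite scale1r.
  apply/ffunP=> q; rewrite !ffunE be_lin mulrDl -scalerAl -mulrA sE be_lin.
  rewrite !beM beT be_inj' !mulr1 !scaler0 ?scale1r !ffunE.
  rewrite (be_inj' s). by rewrite ffunE mulr0 addr0 add0r.
exists psi => [f|h].
  rewrite {1}/phi /Tn mulrA -rmorphM psiE; apply/ffunP=> -[x a]; rewrite !ffunE /=.
  case: (C2P x) => ->; rewrite ?eqxx ?(eq_sym 1%g) ?(negPf t2_neq1) // mulfK //.
have [f fE] : exists f, lgr p 1%g h = i f by exact: lgr1_image.
have [g gE] := lgrt_image ext T'T lT'1 h.
have hE : h = i f + i g * T by rewrite -fE -gE -(sum_C2 (fun x => lgr p x h)) lgr_sum.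
rewrite [in LHS]hE psiE /phi hE; congr (_ + _).
  congr (i _); apply/ffunP=> a; by rewrite !ffunE eq_sym (negPf t2_neq1).
rewrite /Tn mulrA -rmorphM; congr (i _ * _).
by apply/ffunP=> a; rewrite !ffunE eqxx divfK.
Qed.

End Classification.

(** * The trivial twist *)

Section GroupAlgebraLift.
Variables (k : fieldType) (F : finGroupType) (H : hopfAlgType k) (w : F -> H).
Hypotheses (w1 : w 1%g = 1) (wM : {morph w : u v / (u * v)%g >-> u * v}).
Hypothesis wD : forall u (X : lmodType k) (g : H -> H -> X), bilinear_map g ->
  \sum_(v <- comul (w u)) g v.1 v.2 = g (w u) (w u).

(** By the hypotheses, [w] is a homomorphism into the grouplike elements of [H]. *)
Definition galg_lift (f : group_alg k F) : H := \sum_u f u *: w u.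

Lemma galg_lift_linear : linear galg_lift.
Proof.
move=> c f g; rewrite /galg_lift scaler_sumr -big_split; apply: eq_bigr => u _.
by rewrite !ffunE scalerDl scalerA.
Qed.

Lemma galg_lift_monoid : monoid_morphism galg_lift.
Proof.
split=> [|f g]; first by rewrite /galg_lift [LHS]sum_galg_of w1.
rewrite /galg_lift sum_galg_mul mulr_suml; apply: eq_bigr => u _.
rewrite mulr_sumr; apply: eq_bigr => v _.
by rewrite wM -scalerAl -scalerAr scalerA.
Qed.

Lemma galg_lift_iso : bijective galg_lift -> hopf_iso H (group_alg k F).
Proof.
move=> wb; apply: hopf_iso_sym; apply: (hopf_isoP galg_lift_linear galg_lift_monoid) => // f X g gb.
have lb : bilinear_map (fun u v => g (galg_lift u) (galg_lift v)).
  by apply: bilinear_comp gb _ _; exact: galg_lift_linear.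
rewrite [RHS]big_map /= [RHS](sum_galg_bilin _ lb).
pose S h := \sum_(u <- comul h) g u.1 u.2.
have Sl : linear S by move=> c h h'; rewrite /S (sweedlerP gb).
rewrite -[LHS]/(S _) (linear_sum_of Sl); apply: eq_bigr => u _.
by rewrite (linearZ_of Sl) /S wD // /galg_lift !sum_galg_of.
Qed.

End GroupAlgebraLift.

(** * The untwisted algebra as the group algebra of a semidirect product *)

Section Semidirect.
Variables (k : fieldType) (char_k : [pchar k] =i pred0) (F G : finGroupType).
Variables (to : groupAction [set: F] [set: G]) (D : twist k to).
Hypothesis D1 : forall x a b, D x a b = 1.
Variable B : G -> G -> k.
Hypotheses (BM : forall a b c, B (a * b)%g c = B a c * B b c)
  (BC : forall a b, B a b = B b a) (B_act : forall x a b, B (to a x) (to b x) = B a b)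
  (B_neq0 : forall a b, B a b != 0)
  (B_nondeg : forall a, (forall b, B a b = 1) -> a = 1%g).
Local Notation S := (sdprod_by to).

Fact sd_pair_subproof (x : F) (a : G) : (x, a) \in setX [set: F] [set: G].
Proof. by rewrite !inE. Qed.
Definition sd_pair x a : S := SdPair to (sd_pair_subproof x a).

Lemma sum_sdprod (V : nmodType) (E : S -> V) :
  \sum_u E u = \sum_x \sum_a E (sd_pair x a).
Proof.
rewrite pair_big (reindex (fun q : F * G => sd_pair q.1 q.2)) //.
exists (fun u : S => val u) => [[x a] _ //|u _]; apply: val_inj => /=.
by case: (val u).
Qed.

Lemma card_neq0 : (#|G|%:R : k) != 0.
Proof. by move/pcharf0P: char_k => ->; rewrite -cardsT -lt0n cardG_gt0. Qed.

Lemma BMr a b c : B a (b * c)%g = B a b * B a c.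
Proof. by rewrite BC BM !(BC a). Qed.

Lemma B1 b : B 1%g b = 1.
Proof. by apply: (mulfI (B_neq0 1%g b)); rewrite -BM mulg1 mulr1. Qed.

(** Orthogonality of characters: with d = a b^-1 different from 1, nondegeneracy supplies [c] with
    [B d c] different from 1, and translating the sum by [c] multiplies it by [B d c]. *)
Lemma B_orthogonal a b : \sum_c B a c / B b c = if a == b then #|G|%:R else 0.
Proof.
case: eqP => [->|/eqP nab].
  by under eq_bigr => c _ do rewrite divff //; rewrite sumr_const.
pose d := (a * b^-1)%g.
have BV c e : B c^-1%g e = (B c e)^-1.
  apply: (mulfI (B_neq0 c e)); rewrite divff // -BM mulgV.
  by apply: (mulfI (B_neq0 1%g e)); rewrite -BM mulg1 mulr1.
have dE c : B a c / B b c = B d c by rewrite /d BM BV.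
under eq_bigr => c _ do rewrite dE.
have [c Bc] : exists c, B d c != 1.
  apply/existsP; rewrite -negb_forall; apply/negP => /forallP Bd.
  move/negP: nab; apply; rewrite (eq_mulgV1 a b) -/d; apply/eqP/B_nondeg => c.
  exact/eqP.
apply/eqP; rewrite -(mulIr_eq0 _ (mulIf (_ : B d c - 1 != 0))) ?subr_eq0 //.
rewrite mulrBr mulr1 subr_eq0 mulr_suml; apply/eqP.
rewrite [RHS](reindex_inj (mulgI c)); apply: eq_bigr => e _.
by rewrite BMr mulrC.
Qed.

(* For u = (x, a), this is the grouplike element x * chi_a with chi_a = B a. *)
Definition sd_char (u : S) : twalg D :=
  [ffun q => if q.1 == u.1 then B u.2 (to q.2 u.1) else 0].

(** [B] identifies [G] with its character group compatibly with [F], so the [sd_char u] are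
    grouplike and multiply as in the semidirect product. They form a basis by Fourier inversion,
    which divides by the order of [G]. *)
Lemma twalg_sdprod : hopf_iso (twalg D) (group_alg k S).
Proof.
apply: (@galg_lift_iso _ _ _ sd_char).
- apply/ffunP=> -[x a]; rewrite !ffunE /=. by rewrite B1; case: eqP.
- move=> u v; apply/ffunP=> -[x a]; rewrite !ffunE.
  rewrite (bigD1 u.1) //= big1 ?addr0 => [|y ny].
    rewrite !ffunE /= eqxx -[X in _ * (if X then _ else _)](inj_eq (mulgI u.1)) mulKVg.
    case: eqP => [_|_]; last by rewrite mulr0.
    by rewrite BM gact_comp B_act.
  by rewrite !ffunE (negPf ny) mul0r.
- move=> u X g gb.
  have wE : sd_char u = \sum_b B u.2 (to b u.1) *: twe D u.1 b.
    rewrite [LHS]twe_expand (bigD1 u.1) //= [X in _ + X]big1 ?addr0 => [|x nx].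
      by apply: eq_bigr => b _; rewrite ffunE eqxx.
    by apply: big1 => b _; rewrite ffunE /= (negPf nx) scale0r.
  rewrite [LHS](sum_tw_bilin _ gb) (bigD1 u.1) //= [X in _ + X]big1 ?addr0; last first.
    move=> x nx; apply: big1 => b _; apply: big1 => c _.
    by rewrite ffunE /= (negPf nx) mul0r scale0r.
  rewrite {2}wE (linear_sum_of (gb.1 _)); apply: eq_bigr => b _.
  rewrite wE (linearZ_of (gb.1 _)) (linear_sum_of (gb.2 _)) scaler_sumr.
  apply: eq_bigr => c _; rewrite -wE ffunE /= eqxx D1 mulr1.
  by rewrite (linearZ_of (gb.2 _)) scalerA gact_morph BMr.
pose psi (h : twalg D) : group_alg k S :=
  [ffun u : S => #|G|%:R^-1 * \sum_b h (u.1, b) / B u.2 (to b u.1)].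
have liftE (f : group_alg k S) x b :
    galg_lift sd_char f (x, b) = \sum_a f (sd_pair x a) * B a (to b x).
  rewrite /galg_lift sum_sdprod sum_ffunE (bigD1 x) //= [X in _ + X]big1 ?addr0; last first.
    move=> y ny; rewrite sum_ffunE big1 // => a _.
    by rewrite !ffunE /= eq_sym (negPf ny) [LHS]mulr0.
  by rewrite sum_ffunE; apply: eq_bigr => a _; rewrite !ffunE /= eqxx.
exists psi => [f|h].
  apply/ffunP=> u; rewrite !ffunE.
  under eq_bigr => b _ do rewrite liftE mulr_suml.
  rewrite exchange_big /= (bigD1 u.2) //= [X in _ + X]big1 ?addr0; last first.
    move=> a na; under eq_bigr => b _ do rewrite -mulrA.
    rewrite -mulr_sumr.
    have := B_orthogonal a u.2; rewrite (reindex_inj (@gact_inj _ _ to u.1)) /= => ->.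
    by rewrite (negPf na) mulr0.
  under eq_bigr => b _ do rewrite mulfK //.
  rewrite sumr_const -[X in _ * X]mulr_natl mulKf ?card_neq0 //; congr (f _).
  by apply: val_inj; rewrite /= -surjective_pairing.
apply/ffunP=> -[x b]; rewrite liftE.
under eq_bigr => a _ do rewrite ffunE /= mulr_sumr mulr_suml.
rewrite exchange_big /= (bigD1 b) //= [X in _ + X]big1 ?addr0; last first.
  move=> c nc; transitivity (#|G|%:R^-1 * h (x, c) * \sum_a B (to b x) a / B (to c x) a).
    by rewrite mulr_sumr; apply: eq_bigr => a _; rewrite !(BC a); ring.
  by rewrite B_orthogonal (inj_eq (@gact_inj _ _ to x)) eq_sym (negPf nc) mulr0.
under eq_bigr => a _ do rewrite -mulrA mulfVK //.
by rewrite sumr_const -mulrnAl -mulr_natr mulVf ?card_neq0 // mul1r.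
Qed.

End Semidirect.

(** * Perfect pairings on finite abelian groups *)

Section CyclicLog.
Variables (gT : finGroupType) (u : gT).

(* [clog a] is junk outside the cyclic group generated by [u]. *)
Definition clog (a : gT) : nat :=
  if [pick j : 'I_#[u]%g | a == (u ^+ j)%g] is Some j then j else 0.

Lemma clogK a : a \in <[u]>%g -> (u ^+ clog a)%g = a.
Proof.
case/cyclePmin=> j lt_j ->; rewrite /clog; case: pickP => [l /eqP->//|].
by move/(_ (Ordinal lt_j)); rewrite eqxx.
Qed.

Lemma expr_clog (k : nzRingType) (z : k) a m :
  z ^+ #[u]%g = 1 -> a \in <[u]>%g -> a = (u ^+ m)%g -> z ^+ clog a = z ^+ m.
Proof.
move=> zu /clogK; move: (clog a) => l <- /eqP; rewrite eq_expg_mod_order => /eqP lm.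
by rewrite -(expr_mod l zu) lm expr_mod.
Qed.

End CyclicLog.

Section Pairings.
Variables (k : closedFieldType) (char_k : [pchar k] =i pred0).

(** In characteristic 0, X^m - 1 is separable, so it has [m] distinct roots, and that many m-th
    roots of unity include a primitive one. *)
Lemma exists_prim_root m : (0 < m)%N -> exists z : k, m.-primitive_root z.
Proof.
move=> m0; have [r rE] := closed_field_poly_normal ('X^m - 1 : {poly k}).
have mon : lead_coef ('X^m - 1 : {poly k}) = 1 by apply/eqP; rewrite -monicE monicXnsubC.
rewrite mon scale1r in rE.
have /hasP[z _ z_prim] : has m.-primitive_root r.
  apply: has_prim_root => //.
  - apply/allP=> z zr; rewrite /root_of_unity rE root_prod_XsubC //.
  - rewrite -separable_prod_XsubC -rE separable_Xn_sub_1 //.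
    by move/pcharf0P: char_k => ->; rewrite -lt0n.
  by rewrite -ltnS -(size_prod_XsubC r id) -rE size_XnsubC.
by exists z.
Qed.

Variable gT : finGroupType.
Implicit Types A K H : {group gT}.

(** Multiplicativity and nondegeneracy are confined to [A] because the pairings below are built from
    logarithms and projections that are meaningful only there. The second variable is covered by
    symmetry. *)
Definition perfect_pairing (A : {set gT}) (B : gT -> gT -> k) : Prop :=
  [/\ {in A & &, forall a b c, B (a * b)%g c = B a c * B b c},
      forall a b, B a b = B b a, forall a b, B a b != 0
    & {in A, forall a, {in A, forall b, B a b = 1} -> a = 1%g}].

Lemma cyclic_pairing (u : gT) : exists B, perfect_pairing <[u]>%g B.
Proof.
have [z z_prim] := exists_prim_root (order_gt0 u).
have zu := prim_expr_order z_prim.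
exists (fun a b => z ^+ (clog u a * clog u b)); split.
- move=> a b c ua ub uc; rewrite !(mulnC _ (clog u c)) !exprM -exprD.
  apply: expr_clog; rewrite ?groupM // ?expgD ?clogK //.
  by rewrite -exprM mulnC exprM zu expr1n.
- by move=> a b; rewrite mulnC.
- move=> a b; rewrite expf_neq0 //; apply/eqP=> z0; move: zu.
  by rewrite z0 expr0n (gtn_eqF (order_gt0 u)) => /eqP; rewrite eq_sym oner_eq0.
move=> a ua /(_ u (cycle_id u)); rewrite exprM.
rewrite (expr_clog (m := 1)) ?expr1 ?cycle_id ?expg1 //; last first.
  by rewrite -exprM mulnC exprM zu expr1n.
move/eqP; rewrite -(prim_order_dvd z_prim) => /dvdnP[q qE].
by rewrite -(clogK ua) qE mulnC expgM expg_order expg1n.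
Qed.

(** Orthogonal sum of the two pairings; [divgr] and [remgr] are the projections to the factors. *)
Lemma dprod_pairing K H A B1 B2 : (K \x H)%g = A ->
  perfect_pairing K B1 -> perfect_pairing H B2 -> exists B, perfect_pairing A B.
Proof.
move=> KHA [B1M B1C B10 B1n] [B2M B2C B20 B2n].
have [_ KH_A cKH tiKH] := dprodP KHA.
have compl : H \in [complements to K in A]%g.
  by apply/complP; split; [rewrite setIC -tiKH setIC | ].
have dK a : a \in A -> divgr K H a \in K by move=> aA; apply: mem_divgr; rewrite KH_A.
have rH a : a \in A -> remgr K H a \in H by move=> aA; apply: mem_remgr; rewrite KH_A.
have nKA : (K <| A)%g by have /dprod_normal2[] := KHA.
exists (fun a b => B1 (divgr K H a) (divgr K H b) * B2 (remgr K H a) (remgr K H b)); split.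
- move=> a b c aA bA cA; rewrite (divgrM compl cKH) ?(remgrM compl nKA) //.
  by rewrite B1M ?B2M ?dK ?rH //; ring.
- by move=> a b; rewrite B1C B2C.
- by move=> a b; rewrite mulf_neq0.
have one1 b : b \in K -> B1 1%g b = 1.
  by move=> bK; apply: (mulfI (B10 1%g b)); rewrite -B1M // mulg1 mulr1.
have one2 b : b \in H -> B2 1%g b = 1.
  by move=> bH; apply: (mulfI (B20 1%g b)); rewrite -B2M // mulg1 mulr1.
move=> a aA Ba; rewrite (divgr_eq K H a).
have -> : divgr K H a = 1%g.
  apply: B1n (dK _ aA) _ => b bK.
  have bA : b \in A by rewrite -KH_A -[b]mulg1 mem_mulg.
  have := Ba b bA; rewrite (divgr_id _ bK) (remgr1 _ bK).
  by rewrite B2C one2 ?rH // mulr1.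
have -> : remgr K H a = 1%g.
  apply: B2n (rH _ aA) _ => b bH.
  have bA : b \in A by rewrite -KH_A -[b]mul1g mem_mulg.
  have db : divgr K H b = 1%g by have := divgrMid tiKH (group1 K) bH; rewrite mul1g.
  have := Ba b bA; rewrite (remgr_id tiKH bH) db.
  by rewrite B1C one1 ?dK // mul1r.
by rewrite mulg1.
Qed.

Lemma abelian_pairing A : abelian A -> exists B, perfect_pairing A B.
Proof.
case/abelian_structure=> s sA _; elim: s A sA => [|u s IHs] A.
  rewrite big_nil => <-; exists (fun _ _ => 1); split=> //.
  - by move=> *; rewrite mulr1.
  - by move=> *; rewrite oner_eq0.
  by move=> a /set1P.
rewrite big_cons => dA; have [[K H _ HE] _ _ _] := dprodP dA.
rewrite HE in dA; have [B2 B2p] := IHs H HE; have [B1 B1p] := cyclic_pairing u.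
exact: dprod_pairing dA B1p B2p.
Qed.

End Pairings.

(** * Fixed and inverted parts of an involution in odd order *)

Section InvolutionSplitting.
Variables (G : finGroupType) (to : groupAction [set: C2] [set: G]).
Hypotheses (abG : forall a b : G, commute a b) (oG : odd #|G|).
Implicit Types a b : G.
Local Notation t a := (to a t2).

(** The exponent (|G|+1)/2 inverts 2 modulo the odd number |G|: in additive notation, [fixpart] and
    [negpart] are the projections (1 + t)/2 and (1 - t)/2. *)
Definition fixpart a := ((a * t a) ^+ (#|G|./2).+1)%g.
Definition negpart a := ((a * (t a)^-1) ^+ (#|G|./2).+1)%g.

Lemma actt2K : involutive (fun a => t a).
Proof. by move=> a; rewrite -gact_comp t2_mul act1. Qed.

Lemma expg_half2 a : ((a ^+ 2) ^+ (#|G|./2).+1 = a)%g.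
Proof.
have N2 : (#|G|./2.*2).+1 = #|G| by rewrite -[RHS]odd_double_half oG.
by rewrite -expgM mul2n doubleS expgS N2 -cardsT expg_cardG ?inE // mulg1.
Qed.

Lemma gact_expg a m : t (a ^+ m)%g = ((t a) ^+ m)%g.
Proof. by elim: m => [|m IHm]; rewrite ?gact_one // !expgS gact_morph IHm. Qed.

Lemma fixpartM : {morph fixpart : a b / (a * b)%g}.
Proof.
move=> a b; rewrite /fixpart -expgMn; last exact: abG.
rewrite gact_morph; congr (_ ^+ _)%g; rewrite -!mulgA; congr (_ * _)%g.
by rewrite !mulgA (abG b).
Qed.

Lemma negpartM : {morph negpart : a b / (a * b)%g}.
Proof.
move=> a b; rewrite /negpart -expgMn; last exact: abG.
rewrite gact_morph invMg (abG (t b)^-1%g); congr (_ ^+ _)%g.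
by rewrite -!mulgA; congr (_ * _)%g; rewrite !mulgA (abG b).
Qed.

Lemma fixpart_act a : t (fixpart a) = fixpart a.
Proof. by rewrite /fixpart gact_expg gact_morph actt2K (abG a). Qed.

Lemma act_fixpart a : fixpart (t a) = fixpart a.
Proof. by rewrite /fixpart actt2K (abG a). Qed.

Lemma negpart_act a : t (negpart a) = (negpart a)^-1%g.
Proof. by rewrite /negpart gact_expg gact_morph gact_inv actt2K -expgVn invMg invgK. Qed.

Lemma act_negpart a : negpart (t a) = (negpart a)^-1%g.
Proof. by rewrite /negpart actt2K -expgVn invMg invgK. Qed.

Lemma fix_negpart a : a = (fixpart a * negpart a)%g.
Proof.
rewrite /fixpart /negpart -expgMn; last exact: abG.
by rewrite -mulgA (mulgA (t a)) (abG (t a)) -mulgA mulgV mulg1 expg_half2.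
Qed.

Lemma fixpart_id a : t a = a -> fixpart a = a.
Proof. by rewrite /fixpart => ->; rewrite expg_half2. Qed.

Lemma negpart_fix a : t a = a -> negpart a = 1%g.
Proof. by rewrite /negpart => ->; rewrite mulgV expg1n. Qed.

Lemma negpart_id a : t a = a^-1%g -> negpart a = a.
Proof. by rewrite /negpart => ->; rewrite invgK expg_half2. Qed.

Lemma fixpart_neg a : t a = a^-1%g -> fixpart a = 1%g.
Proof. by rewrite /fixpart => ->; rewrite mulgV expg1n. Qed.

Fact fixed_group_set : group_set [set a : G | t a == a].
Proof.
apply/group_setP; split=> [|a b]; rewrite !inE ?gact_one // gact_morph.
by move=> /eqP-> /eqP->.
Qed.
Canonical fixed_group := Group fixed_group_set.

Fact inverted_group_set : group_set [set a : G | t a == a^-1%g].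
Proof.
apply/group_setP; split=> [|a b]; rewrite !inE ?gact_one ?invg1 // gact_morph.
by move=> /eqP-> /eqP->; rewrite invMg (abG a^-1%g).
Qed.
Canonical inverted_group := Group inverted_group_set.

Lemma fixpart_mem a : fixpart a \in fixed_group.
Proof. by rewrite inE fixpart_act. Qed.

Lemma negpart_mem a : negpart a \in inverted_group.
Proof. by rewrite inE negpart_act. Qed.

(** Orthogonal sum of perfect pairings on the fixed and the inverted part: [t] is trivial on the
    first and inverts both arguments on the second, which changes neither pairing. *)
Lemma invariant_pairing (k : closedFieldType) : [pchar k] =i pred0 ->
  exists B : G -> G -> k,
  [/\ [/\ forall a b c, B (a * b)%g c = B a c * B b c,
          forall a b, B a b = B b a & forall a b, B a b != 0],
      forall x a b, B (to a x) (to b x) = B a b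
    & forall a, (forall b, B a b = 1) -> a = 1%g].
Proof.
move=> char_k.
have abA (A : {group G}) : abelian A by apply/centsP => a _ b _; apply: abG.
have [B1 [B1M B1C B10 B1n]] := abelian_pairing char_k (abA fixed_group).
have [B2 [B2M B2C B20 B2n]] := abelian_pairing char_k (abA inverted_group).
have pm := fixpart_mem; have nm := negpart_mem.
have one1 b : b \in fixed_group -> B1 1%g b = 1.
  by move=> bK; apply: (mulfI (B10 1%g b)); rewrite -B1M // mulg1 mulr1.
have one2 b : b \in inverted_group -> B2 1%g b = 1.
  by move=> bH; apply: (mulfI (B20 1%g b)); rewrite -B2M // mulg1 mulr1.
have B2V a b : a \in inverted_group -> b \in inverted_group -> B2 a^-1%g b * B2 a b = 1.
  by move=> aI bI; rewrite -B2M ?groupV // mulVg one2.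
exists (fun a b => B1 (fixpart a) (fixpart b) * B2 (negpart a) (negpart b)).
split; first split.
- by move=> a b c; rewrite fixpartM negpartM B1M // B2M //; ring.
- by move=> a b; rewrite B1C B2C.
- by move=> a b; rewrite mulf_neq0.
- move=> x a b; case: (C2P x) => ->; rewrite ?act1 // !act_fixpart !act_negpart.
  congr (_ * _); have aI := nm a; have bI := nm b.
  have E1 := B2V _ _ aI (groupVr bI); have E2 := B2V _ _ bI aI.
  rewrite (B2C _ (negpart a)) (B2C (negpart b)) in E2.
  apply: (mulIf (B20 (negpart a) (negpart b)^-1%g)).
  by rewrite E1 mulrC E2.
move=> a Ba; rewrite [a]fix_negpart.
have -> : fixpart a = 1%g.
  apply: B1n => // b; rewrite inE => /eqP tb.
  by have := Ba b; rewrite (fixpart_id tb) (negpart_fix tb) B2C one2 // mulr1.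
rewrite mul1g; apply: B2n => // b; rewrite inE => /eqP tb.
by have := Ba b; rewrite (fixpart_neg tb) (negpart_id tb) B1C one1 // mul1r.
Qed.

End InvolutionSplitting.

(** * Twists on the square of a cyclic group *)

Lemma coprime_root1 (k : nzRingType) (z : k) a b :
  (0 < a)%N -> coprime a b -> z ^+ a = 1 -> z ^+ b = 1 -> z = 1.
Proof.
move=> a0 cab za zb; have [m mz _] := prim_order_exists a0 za.
have : (m %| 1)%N.
  rewrite -(eqP cab) dvdn_gcd !(prim_order_dvd mz).
  by rewrite za zb !eqxx.
by rewrite dvdn1 => /eqP m1; rewrite -[z]expr1 -m1 prim_expr_order.
Qed.

(** * Fixed and inverted subgroups at the mixed primes *)

Section MixedPart.
Variables (n : nat) (n_odd : odd n) (to : groupAction [set: C2] [set: ZnZn n]).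
Local Notation G := (ZnZn n).
Local Notation t a := (to a t2).
Implicit Types a b x y : G.

Lemma odd_gt0 : (0 < n)%N. Proof. by case: n n_odd. Qed.

Lemma card_Zn m : (0 < m)%N -> #|Zn m| = m.
Proof. by case: m => // m _; rewrite card_ord. Qed.

Lemma card_ZnZn : #|G| = (n * n)%N.
Proof. by rewrite card_prod !card_Zn ?odd_gt0. Qed.

Lemma odd_ZnZn : odd #|G|.
Proof. by rewrite card_ZnZn oddM n_odd. Qed.

Lemma ZnZn_comm a b : commute a b.
Proof. by case: a b => [a1 a2] [b1 b2]; congr (_, _); apply: (@Zp_mulgC n.-1). Qed.

Lemma expg_pair (a : G) m : (a ^+ m)%g = ((a.1 ^+ m)%g, (a.2 ^+ m)%g).
Proof. by elim: m => [|m IHm] //; rewrite !expgS IHm. Qed.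

Lemma expg_ZnZn a : (a ^+ n = 1)%g.
Proof.
have E (b : Zn n) : (b ^+ n = 1)%g.
  by rewrite -[X in (_ ^+ X)%g](card_Zn odd_gt0) -cardsT expg_cardG ?inE.
by rewrite expg_pair !E.
Qed.

Lemma Zn_cyclic m : cyclic [set: Zn m].
Proof. by apply/cyclicP; exists Zp1; apply: Zp_cycle. Qed.

(** The torsion subgroup is cyclic, and its generator is itself killed by [p]. *)
Lemma card_Zn_torsion p : (#|[set a : Zn n | (a ^+ p == 1)%g]| %| p)%N.
Proof.
have gT : group_set [set a : Zn n | (a ^+ p == 1)%g].
  apply/group_setP; split=> [|a b]; rewrite !inE ?expg1n // => /eqP a1 /eqP b1.
  by rewrite expgMn ?a1 ?b1 ?mulg1 //; apply: (@Zp_mulgC n.-1).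
have /cyclicP[x xE] : cyclic (Group gT) := cyclicS (subsetT _) (Zn_cyclic n).
have : x \in (Group gT) by rewrite xE cycle_id.
by rewrite inE -order_dvdn /order -xE.
Qed.

Lemma card_torsion p : prime p -> (#|[set a : G | (a ^+ p == 1)%g]| <= p * p)%N.
Proof.
move=> pr_p; set T := [set _ | _].
have sT : T \subset setX [set a : Zn n | (a ^+ p == 1)%g] [set a : Zn n | (a ^+ p == 1)%g].
  apply/subsetP=> a; rewrite inE expg_pair => /eqP[a1 a2].
  by rewrite !inE -!(inj_eq val_inj) /= a1 a2 eqxx.
apply: leq_trans (subset_leq_card sT) _; rewrite cardsX.
by apply: leq_mul; apply: dvdn_leq (prime_gt0 pr_p) (card_Zn_torsion p).
Qed.

Definition mixed : nat_pred := [pred p | (p \in primes n) && ~~ acts_pm_id to p].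

Lemma n_of_actionE : n_of_action to = (n`_mixed)%N.
Proof.
rewrite [RHS](prod_prime_decomp (part_gt0 mixed n)) prime_decompE big_map primes_part.
rewrite big_filter /n_of_action big_seq_cond [RHS]big_seq_cond.
apply: eq_big => [p|p /andP[pn np]] /=; first by rewrite inE andbA andbb.
by rewrite -!p_part partn_part // => q; rewrite !inE => /eqP->; rewrite pn.
Qed.

(** Powers of [x] and [y] of order [p] lie in the primary component. As [p] is odd neither is its
    own inverse, so the first keeps [t] from being inversion there and the second from being the
    identity. *)
Lemma mixed_common_prime p x y : t x = x -> t y = y^-1%g ->
  prime p -> (p %| #[x]%g)%N -> (p %| #[y]%g)%N -> p \in mixed.
Proof.
move=> tx ty pr_p px py; rewrite inE; apply/andP; split.
  by rewrite mem_primes pr_p odd_gt0 (dvdn_trans px) // order_dvdn expg_ZnZn.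
have power (w : G) : (p %| #[w]%g)%N -> exists2 m, #[(w ^+ m)%g]%g = p & (w ^+ m)%g
  \in primary_comp n p.
  move=> /dvdnP[m mE]; have m0 : (0 < m)%N by have := order_gt0 w; rewrite mE; case: (m).
  have om : #[(w ^+ m)%g]%g = p by rewrite orderXdiv mE ?dvdn_mulr // mulKn.
  by exists m => //; rewrite inE /p_elt om pnat_id.
have p_odd : odd p.
  have : (p %| n)%N by rewrite (dvdn_trans px) // order_dvdn expg_ZnZn.
  by move=> /dvdn_odd; apply.
have [m1 o1 x1] := power x px; have [m2 o2 y2] := power y py.
have self_inv (w : G) : #[w]%g = p -> w = w^-1%g -> False.
  move=> ow wV; have : (p %| 2)%N by rewrite -ow order_dvdn expgS expg1 {2}wV mulgV.
  by rewrite dvdn_prime2 // => /eqP p2; rewrite p2 in p_odd.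
apply/norP; split; apply/forall_inP => allP.
  apply: (self_inv _ o2); rewrite -expgVn -ty -gact_expg.
  by rewrite (eqP (allP _ y2)).
have tx1 : t (x ^+ m1)%g = (x ^+ m1)%g by rewrite gact_expg tx.
by apply: (self_inv _ o1); rewrite -{1}tx1; apply/eqP/allP.
Qed.

Lemma fix_neg_coprime x y : t x = x -> t y = y^-1%g -> (mixed.-nat (gcdn #[x]%g #[y]%g))%N.
Proof.
move=> tx ty; apply/pnatP; rewrite ?gcdn_gt0 ?order_gt0 // => p pr_p.
by rewrite dvdn_gcd => /andP[px py]; apply: mixed_common_prime tx ty pr_p px py.
Qed.

Definition fix_mixed a := ((fixpart to a).`_mixed)%g.
Definition neg_mixed a := ((negpart to a).`_mixed)%g.

Section Values.
Variables (k : fieldType) (D : twist k to).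

Lemma tw_act_inverse x y : D t2 x y * D t2 (t x) (t y) = 1.
Proof. by rewrite -tw_coc t2_mul tw_id. Qed.

(** For two fixed arguments, and likewise for two inverted ones in [tw_neg], [tw_act_inverse] says
    that the value has square 1. *)
Lemma tw_fix x y : t x = x -> t y = y -> D t2 x y = 1.
Proof.
move=> tx ty; apply: odd_order_root1 odd_ZnZn (tw_order _ _ _ _) _.
by rewrite expr2 -{2}tx -{2}ty tw_act_inverse.
Qed.

Lemma tw_invr (x : C2) a b : D x a b^-1%g = (D x a b)^-1.
Proof. by apply: (mulfI (tw_neq0 D x a b)); rewrite -twMr mulgV twg1 divff ?tw_neq0. Qed.

Lemma tw_invl (x : C2) a b : D x a^-1%g b = (D x a b)^-1.
Proof. by apply: (mulfI (tw_neq0 D x a b)); rewrite -twMl mulgV tw1g divff ?tw_neq0. Qed.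

Lemma tw_neg x y : t x = x^-1%g -> t y = y^-1%g -> D t2 x y = 1.
Proof.
move=> tx ty; apply: odd_order_root1 odd_ZnZn (tw_order _ _ _ _) _.
by rewrite expr2 -{2}[D t2 x y]invrK -tw_invr -tw_invl -tx -ty tw_act_inverse.
Qed.

Lemma tw_coprime (x : C2) a b : coprime #[a]%g #[b]%g -> D x a b = 1.
Proof.
move=> cab; apply: coprime_root1 (order_gt0 a) cab _ _.
  by rewrite -twX expg_order tw1g.
have := twX D x b a #[b]%g; rewrite expg_order tw1g => E.
apply: (mulIf (expf_neq0 #[b]%g (tw_neq0 D x b a))).
by rewrite -exprMn twC expr1n mul1r.
Qed.

(** The orders of a fixed and an inverted element share only mixed primes, so by [tw_coprime] the
    parts away from [mixed] contribute 1. *)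
Lemma tw_constt x y : t x = x -> t y = y^-1%g ->
  D t2 x y = D t2 (x.`_mixed)%g (y.`_mixed)%g.
Proof.
move=> tx ty; have gpi := fix_neg_coprime tx ty.
have E1 : D t2 (x.`_mixed^')%g y = 1.
  apply: tw_coprime; rewrite order_constt; apply/eqP; apply: (pnat_1 (pi := mixed)).
    by apply: pnat_dvd gpi; rewrite dvdn_gcd dvdn_gcdr (dvdn_trans (dvdn_gcdl _ _)) ?dvdn_part.
  by apply: pnat_dvd (dvdn_gcdl _ _) _; apply: part_pnat.
have E2 : D t2 (x.`_mixed)%g (y.`_mixed^')%g = 1.
  by apply: tw_coprime; rewrite !order_constt (pnat_coprime (part_pnat _ _) (part_pnat _ _)).
by rewrite -{1}(consttC mixed x) twMl E1 mulr1 -{1}(consttC mixed y) twMr E2 mulr1.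
Qed.

Lemma tw_mixed a b : D t2 a b = D t2 (fix_mixed a) (neg_mixed b) * D t2 (neg_mixed a) (fix_mixed b).
Proof.
have fx := fixpart_act to ZnZn_comm; have ng := negpart_act to.
rewrite {1}[a](fix_negpart to ZnZn_comm odd_ZnZn) {1}[b](fix_negpart to ZnZn_comm odd_ZnZn).
rewrite !twMl !twMr (tw_fix (fx a) (fx b)) (tw_neg (ng a) (ng b)) mul1r mulr1.
rewrite (tw_constt (fx a) (ng b)) -/(fix_mixed a) -/(neg_mixed b); congr (_ * _).
apply: (mulIf (tw_neq0 D t2 (fixpart to b) (negpart to a))).
by rewrite twC (tw_constt (fx b) (ng a)) twC.
Qed.

End Values.

Fact fixed_mixed_group_set :
  group_set [set a : G | (t a == a) && (mixed.-elt a)%g].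
Proof.
apply/group_setP; split=> [|a b]; rewrite !inE ?gact_one ?eqxx ?p_elt1 //.
move=> /andP[/eqP ta pa] /andP[/eqP tb pb]; rewrite gact_morph ta tb eqxx.
by rewrite p_eltM //; apply: ZnZn_comm.
Qed.
Canonical fixed_mixed_group := Group fixed_mixed_group_set.

Fact inverted_mixed_group_set :
  group_set [set a : G | (t a == a^-1%g) && (mixed.-elt a)%g].
Proof.
apply/group_setP; split=> [|a b]; rewrite !inE ?gact_one ?invg1 ?eqxx ?p_elt1 //.
move=> /andP[/eqP ta pa] /andP[/eqP tb pb]; rewrite gact_morph ta tb.
rewrite invMg (ZnZn_comm a^-1%g) eqxx p_eltM //; apply: ZnZn_comm.
Qed.
Canonical inverted_mixed_group := Group inverted_mixed_group_set.

Local Notation X := fixed_mixed_group.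
Local Notation Y := inverted_mixed_group.

Lemma order_act a : #[t a]%g = #[a]%g.
Proof.
have dvd b : (#[t b]%g %| #[b]%g)%N.
  by rewrite order_dvdn -gact_expg expg_order gact_one.
by apply/eqP; rewrite eqn_dvd dvd -{1}(actt2K to a) dvd.
Qed.

Lemma elt_fixpart (pi : nat_pred) a : (pi.-elt a)%g -> (pi.-elt (fixpart to a))%g.
Proof.
move=> pa; apply: p_eltX; rewrite p_eltM //; first exact: ZnZn_comm.
by rewrite /p_elt order_act.
Qed.

Lemma elt_negpart (pi : nat_pred) a : (pi.-elt a)%g -> (pi.-elt (negpart to a))%g.
Proof.
move=> pa; apply: p_eltX; rewrite p_eltM //; first exact: ZnZn_comm.
by rewrite p_eltV /p_elt order_act.
Qed.

Lemma fix_mixed_mem a : fix_mixed a \in X.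
Proof.
rewrite inE p_elt_constt andbT /fix_mixed -[in X in _ == X]/(fix_mixed a) /constt gact_expg.
by rewrite fixpart_act //; apply: ZnZn_comm.
Qed.

Lemma neg_mixed_mem a : neg_mixed a \in Y.
Proof. by rewrite inE p_elt_constt andbT /neg_mixed /constt gact_expg negpart_act expgVn. Qed.

Lemma fix_mixed_id a : a \in X -> fix_mixed a = a.
Proof.
by rewrite inE => /andP[/eqP ta pa]; rewrite /fix_mixed (fixpart_id odd_ZnZn ta) constt_p_elt.
Qed.

Lemma neg_mixed_id a : a \in Y -> neg_mixed a = a.
Proof.
by rewrite inE => /andP[/eqP ta pa]; rewrite /neg_mixed (negpart_id odd_ZnZn ta) constt_p_elt.
Qed.

Lemma fix_mixed_inverted a : a \in Y -> fix_mixed a = 1%g.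
Proof.
by rewrite inE => /andP[/eqP ta pa]; rewrite /fix_mixed (fixpart_neg ta) constt1.
Qed.

Lemma neg_mixed_fixed a : a \in X -> neg_mixed a = 1%g.
Proof.
by rewrite inE => /andP[/eqP ta pa]; rewrite /neg_mixed (negpart_fix ta) constt1.
Qed.

Lemma fix_mixedM : {morph fix_mixed : a b / (a * b)%g}.
Proof. by move=> a b; rewrite /fix_mixed (fixpartM to ZnZn_comm) consttM //; apply: ZnZn_comm. Qed.

Lemma neg_mixedM : {morph neg_mixed : a b / (a * b)%g}.
Proof. by move=> a b; rewrite /neg_mixed (negpartM to ZnZn_comm) consttM //; apply: ZnZn_comm. Qed.

Lemma fix_mixed_act a : fix_mixed (t a) = fix_mixed a.
Proof. by rewrite /fix_mixed act_fixpart //; apply: ZnZn_comm. Qed.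

Lemma neg_mixed_act a : neg_mixed (t a) = (neg_mixed a)^-1%g.
Proof. by rewrite /neg_mixed act_negpart consttV. Qed.

Lemma nontrivial_torsion (A : {group G}) p a : prime p -> a \in A -> a != 1%g ->
  (p.-elt a)%g -> exists2 b, b \in A & #[b]%g = p.
Proof.
move=> pr_p aA a1 pa; have pdiv_a : (p %| #[a]%g)%N.
  have [m mE] := p_natP pa; rewrite mE; case: m mE => [|m _]; last by rewrite expnS dvdn_mulr.
  by move=> /eqP; rewrite order_eq1 (negPf a1).
have [q qE] := dvdnP pdiv_a; exists (a ^+ q)%g; first exact: groupX.
have q0 : (0 < q)%N by have := order_gt0 a; rewrite qE; case: (q).
by rewrite orderXdiv qE ?dvdn_mulr // mulKn.
Qed.

Lemma mixed_prime p : p \in mixed -> prime p.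
Proof. by rewrite inE mem_primes => /andP[/and3P[]]. Qed.

(** Some [a] in the primary component is not inverted by [t], so [a * t a] is a nontrivial fixed
    element. Dually, [a * (t a)^-1] serves in [inverted_mixed_torsion]. *)
Lemma fixed_mixed_torsion p : p \in mixed -> exists2 b, b \in X & #[b]%g = p.
Proof.
move=> pm; have pr_p := mixed_prime pm.
have := pm; rewrite inE => /andP[_ /norP[_ /forall_inPn[a]]]; rewrite inE => pa nta.
apply: (nontrivial_torsion (a := (a * t a)%g) pr_p).
- rewrite inE gact_morph actt2K (ZnZn_comm (t a)) eqxx /=.
  apply: (@sub_p_elt _ p); first by move=> q; rewrite !inE => /eqP->.
  by rewrite p_eltM //; [apply: ZnZn_comm | rewrite /p_elt order_act].
- by apply: contra nta => /eqP E; apply/eqP/(mulgI a); rewrite E mulgV.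
- by rewrite p_eltM //; [apply: ZnZn_comm | rewrite /p_elt order_act].
Qed.

Lemma inverted_mixed_torsion p : p \in mixed -> exists2 b, b \in Y & #[b]%g = p.
Proof.
move=> pm; have pr_p := mixed_prime pm.
have := pm; rewrite inE => /andP[_ /norP[/forall_inPn[a]]]; rewrite inE => pa nta _.
apply: (nontrivial_torsion (a := (a * (t a)^-1)%g) pr_p).
- rewrite inE gact_morph gact_inv actt2K invMg invgK eqxx /=.
  apply: (@sub_p_elt _ p); first by move=> q; rewrite !inE => /eqP->.
  by rewrite p_eltM //; [apply: ZnZn_comm | rewrite p_eltV /p_elt order_act].
- by rewrite -eq_mulgV1 eq_sym.
- by rewrite p_eltM //; [apply: ZnZn_comm | rewrite p_eltV /p_elt order_act].
Qed.

(** Multiplication is injective on X x Y, since [fix_mixed] and [neg_mixed] recover the factors, and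
    it lands in the p-torsion of [G]. *)
Lemma torsion_prod p : prime p ->
  (#|[set a in X | (a ^+ p == 1)%g]| * #|[set a in Y | (a ^+ p == 1)%g]| <= p * p)%N.
Proof.
move=> pr_p; apply: leq_trans (card_torsion pr_p); rewrite -cardsX.
rewrite -(card_in_imset (f := fun q => (q.1 * q.2)%g)); last first.
  move=> [a b] [a' b']; rewrite !inE /=.
  move=> /andP[/andP[aX _] /andP[bY _]] /andP[/andP[aX' _] /andP[bY' _]] E.
  have Xm c : (t c == c) && (mixed.-elt c)%g -> c \in X by rewrite inE.
  have Ym c : (t c == c^-1%g) && (mixed.-elt c)%g -> c \in Y by rewrite inE.
  move: (Xm _ aX) (Ym _ bY) (Xm _ aX') (Ym _ bY') => {Xm Ym} aX1 bY1 aX1' bY1'.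
  have := congr1 fix_mixed E; have := congr1 neg_mixed E.
  rewrite !fix_mixedM !neg_mixedM (fix_mixed_id aX1) (fix_mixed_id aX1')
    (fix_mixed_inverted bY1) (fix_mixed_inverted bY1').
  by rewrite (neg_mixed_id bY1) (neg_mixed_id bY1') (neg_mixed_fixed aX1)
    (neg_mixed_fixed aX1') !mulg1 !mul1g => -> ->.
apply/subset_leq_card/subsetP=> _ /imsetP[[a b] + ->]; rewrite !inE /=.
move=> /andP[/andP[_ /eqP ap] /andP[_ /eqP bp]].
by rewrite expgMn ?ap ?bp ?mulg1 //; apply: ZnZn_comm.
Qed.

Lemma torsion_geq (A : {group G}) p b : b \in A -> #[b]%g = p ->
  (p <= #|[set a in A | (a ^+ p == 1)%g]|)%N.
Proof.
move=> bA <-; apply/subset_leq_card/subsetP=> _ /cycleP[m ->].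
by rewrite inE groupX //= -expgM mulnC expgM expg_order expg1n.
Qed.

(** Rank at least 2 would give an elementary abelian subgroup with p^2 elements of p-torsion. *)
Lemma cyclic_of_torsion (A : {group G}) : (forall a, a \in A -> (mixed.-elt a)%g) ->
  (forall p, p \in mixed -> (#|[set a in A | (a ^+ p == 1)%g]| <= p)%N) ->
  cyclic A.
Proof.
move=> Amixed Ator; have abA : abelian A by apply/centsP => a _ b _; apply: ZnZn_comm.
rewrite abelian_rank1_cyclic //; have [p pr_p ->] := rank_witness A.
rewrite leqNgt; apply/negP => /p_rank_geP[E].
rewrite inE => /andP[]; rewrite inE => /andP[EA abE] /eqP oE.
have cardE : #|E| = (p ^ 2)%N.
  by have := card_pgroup (abelem_pgroup abE); rewrite oE.
have [a aE a1] : exists2 a, a \in E & a != 1%g.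
  apply/trivgPn; rewrite -cardG_gt1 cardE; exact: (ltn_exp2l 0 2 (prime_gt1 pr_p)).
have pm : p \in mixed.
  have := Amixed a (subsetP EA a aE); rewrite /p_elt (abelem_order_p abE aE a1).
  by rewrite pnatE.
have : (p ^ 2 <= p)%N.
  rewrite -cardE; apply: leq_trans (Ator p pm).
  apply/subset_leq_card/subsetP=> b bE; rewrite inE (subsetP EA) //=.
  by have /abelemP := abE; move=> /(_ pr_p)[_ /(_ b bE) ->].
by rewrite leqNgt (ltn_exp2l 1 2 (prime_gt1 pr_p)).
Qed.

(** The inverted subgroup already has [p] elements of p-torsion, so the bound p^2 of [torsion_prod]
    leaves at most [p] here. *)
Lemma fixed_mixed_cyclic : cyclic X.
Proof.
apply: cyclic_of_torsion => [a|p pm]; first by rewrite inE => /andP[].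
have pr_p := mixed_prime pm; have [b bY ob] := inverted_mixed_torsion pm.
rewrite -(leq_pmul2r (prime_gt0 pr_p)); apply: leq_trans (torsion_prod pr_p).
by rewrite leq_mul2l (torsion_geq bY ob) orbT.
Qed.

Lemma inverted_mixed_cyclic : cyclic Y.
Proof.
apply: cyclic_of_torsion => [a|p pm]; first by rewrite inE => /andP[].
have pr_p := mixed_prime pm; have [b bX ob] := fixed_mixed_torsion pm.
rewrite -(leq_pmul2l (prime_gt0 pr_p)); apply: leq_trans (torsion_prod pr_p).
by rewrite leq_mul2r (torsion_geq bX ob) orbT.
Qed.

Local Notation M := (n_of_action to).

Lemma n_of_action_gt0 : (0 < M)%N.
Proof. by rewrite n_of_actionE part_gt0. Qed.

Lemma cyclic_mixed_dvd (A : {group G}) : cyclic A ->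
  (forall a, a \in A -> (mixed.-elt a)%g) -> (#|A| %| M)%N.
Proof.
case/cyclicP=> u uA Amixed; have umixed : (mixed.-elt u)%g by rewrite Amixed ?uA ?cycle_id.
rewrite n_of_actionE uA -[#|_|]/(#[u]%g) -(part_pnat_id umixed).
by apply: partn_dvd odd_gt0 _; rewrite order_dvdn expg_ZnZn.
Qed.

(** Both orders divide [M], and the products of elements of the two groups exhaust the Hall subgroup
    at the mixed primes, of order M^2, which forces equality. *)
Lemma card_mixed_groups : #|X| = M /\ #|Y| = M.
Proof.
have dX : (#|X| %| M)%N by apply: cyclic_mixed_dvd fixed_mixed_cyclic _ => a;
  rewrite inE => /andP[].
have dY : (#|Y| %| M)%N by apply: cyclic_mixed_dvd inverted_mixed_cyclic _ => a;
  rewrite inE => /andP[].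
have lX := dvdn_leq n_of_action_gt0 dX; have lY := dvdn_leq n_of_action_gt0 dY.
have abG : abelian [set: G] by apply/centsP => a _ b _; apply: ZnZn_comm.
have hall := nilpotent_pcore_Hall mixed (abelian_nil abG).
have cardO : #|'O_mixed([set: G])%g| = (M * M)%N.
  by rewrite (card_Hall hall) cardsT card_ZnZn partnM ?odd_gt0 // -!n_of_actionE.
have : (M * M <= #|X| * #|Y|)%N.
  rewrite -cardO -cardsX; apply: leq_trans (leq_imset_card (fun q => (q.1 * q.2)%g) _).
  apply/subset_leq_card/subsetP=> a aO; apply/imsetP.
  have pa : (mixed.-elt a)%g by apply: mem_p_elt (pcore_pgroup _ _) aO.
  exists (fixpart to a, negpart to a); last first.
    by rewrite -(fix_negpart to ZnZn_comm odd_ZnZn).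
  rewrite !inE /= elt_fixpart // elt_negpart // negpart_act eqxx !andbT.
  by rewrite fixpart_act //; apply: ZnZn_comm.
move=> le; split; apply/eqP; rewrite eqn_leq ?lX ?lY /=.
  rewrite -(leq_pmul2r n_of_action_gt0); apply: leq_trans le _.
  by rewrite leq_mul2l lY orbT.
rewrite -(leq_pmul2l n_of_action_gt0); apply: leq_trans le _.
by rewrite leq_mul2r lX orbT.
Qed.

Lemma mixed_generators : exists u v : G,
  [/\ X = <[u]>%g :> {set G}, Y = <[v]>%g :> {set G}, #[u]%g = M & #[v]%g = M].
Proof.
have [oX oY] := card_mixed_groups.
have [[u uX] [v vY]] := (cyclicP fixed_mixed_cyclic, cyclicP inverted_mixed_cyclic).
by exists u, v; rewrite /order -uX -vY.
Qed.

End MixedPart.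

Lemma expr_eq_order (k : nzRingType) (gT : finGroupType) (u : gT) (z : k) i j :
  (u ^+ i = u ^+ j)%g -> z ^+ #[u]%g = 1 -> z ^+ i = z ^+ j.
Proof.
move=> /eqP; rewrite eq_expg_mod_order => /eqP ij zu.
by rewrite -(expr_mod i zu) ij expr_mod.
Qed.

Section TwistPullback.
Variables (k : fieldType) (F G G' : finGroupType).
Variables (to : groupAction [set: F] [set: G]) (D : twist k to).
Variable to' : groupAction [set: F] [set: G'].
Variable s : G' -> G.
Hypotheses (sM : {morph s : a b / (a * b)%g})
  (s_act : forall a x, s (to' a x) = to (s a) x).

(** Transparent, because the isomorphism below relies on its values unfolding. *)
Definition pull_twist : twist k to'.
Proof.
exists (fun x a b => D x (s a) (s b)).
- by move=> *; rewrite sM twMl.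
- by move=> *; rewrite sM twMr.
- by move=> *; rewrite tw_alt.
- by move=> *; rewrite tw_coc !s_act.
- by move=> *; rewrite tw_id.
Defined.

Lemma pull_twist_iso : bijective s -> hopf_iso (twalg D) (twalg pull_twist).
Proof. by move=> sb; apply: twalg_iso sM sb s_act _. Qed.

End TwistPullback.

(** * Twists as roots of unity *)

Section MixedTwists.
Variables (k : closedFieldType) (char_k : [pchar k] =i pred0).
Variables (n : nat) (n_odd : odd n) (to : groupAction [set: C2] [set: ZnZn n]).
Local Notation G := (ZnZn n).
Local Notation t a := (to a t2).
Local Notation M := (n_of_action to).

Lemma C2_twalg_iso (D D' : twist k to) :
  (forall a b, D' t2 a b = D t2 a b) -> hopf_iso (twalg D) (twalg D').
Proof.
move=> DD'; apply: (twalg_iso (s := id)) => //; first by exists id.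
by move=> x a b; case: (C2P x) => ->; rewrite ?tw_id.
Qed.

(** The extension realises an equivalent action [to']; its twist is pulled back to [to] along the
    intertwining automorphism [s]. *)
Lemma Ext_twalg (H : hopfAlgType k) : in_Ext to H ->
  exists D : twist k to, hopf_iso H (twalg D).
Proof.
move=> [i [p [to' [ext act [s sAut s_act]]]]].
have [D DH] := extension_twalg (@ZnZn_comm n) (odd_ZnZn n_odd) ext act.
have sM : {morph s : a b / (a * b)%g}.
  by move=> a b; rewrite -!(autmE sAut) morphM ?inE.
exists (pull_twist D sM s_act); apply: hopf_iso_trans (hopf_iso_sym DH) _.
apply: pull_twist_iso; exists (s^-1)%g; [exact: permK | exact: permKV].
Qed.

Variables u v : G.
Hypotheses (Xu : fixed_mixed_group to = <[u]>%g :> {set G})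
  (Yv : inverted_mixed_group to = <[v]>%g :> {set G})
  (ou : #[u]%g = M) (ov : #[v]%g = M).

Variables I J : G -> nat.
Hypotheses (logXK : forall a, (u ^+ I a)%g = fix_mixed to a)
  (logYK : forall a, (v ^+ J a)%g = neg_mixed to a).

Lemma expr_logX (z : k) a m : z ^+ M = 1 -> fix_mixed to a = (u ^+ m)%g -> z ^+ I a = z ^+ m.
Proof. by move=> zM; rewrite -logXK => E; apply: expr_eq_order E _; rewrite ou. Qed.

Lemma expr_logY (z : k) a m : z ^+ M = 1 -> neg_mixed to a = (v ^+ m)%g -> z ^+ J a = z ^+ m.
Proof. by move=> zM; rewrite -logYK => E; apply: expr_eq_order E _; rewrite ov. Qed.

Lemma expr_logXM (z : k) a b : z ^+ M = 1 -> z ^+ I (a * b)%g = z ^+ I a * z ^+ I b.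
Proof.
by move=> zM; rewrite -exprD; apply: (expr_logX zM); rewrite fix_mixedM expgD -!logXK.
Qed.

Lemma expr_logYM (z : k) a b : z ^+ M = 1 -> z ^+ J (a * b)%g = z ^+ J a * z ^+ J b.
Proof.
by move=> zM; rewrite -exprD; apply: (expr_logY zM); rewrite neg_mixedM expgD -!logYK.
Qed.

Section Beta.
Variables (z : k) (zM : z ^+ M = 1).

(** The power of [z] by the determinant of the coordinates (I, J) of the two arguments, written as a
    quotient because the logarithms are natural numbers. *)
Definition beta a b := z ^+ (I a * J b) / z ^+ (J a * I b).

Let zXM m : (z ^+ m) ^+ M = 1. Proof. by rewrite -exprM mulnC exprM zM expr1n. Qed.
Let z0 m : z ^+ m != 0.
Proof. by apply/eqP=> z0; have := zXM m; rewrite z0 expr0n (gtn_eqF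
  (n_of_action_gt0 to)) => /eqP; rewrite eq_sym oner_eq0. Qed.

Lemma betaM a b c : beta (a * b)%g c = beta a c * beta b c.
Proof.
rewrite /beta !(mulnC _ (J c)) !(mulnC _ (I c)) !exprM.
by rewrite (expr_logXM _ _ (zXM _)) (expr_logYM _ _ (zXM _)) mulf_div.
Qed.

Lemma betaMr a b c : beta a (b * c)%g = beta a b * beta a c.
Proof.
rewrite /beta !exprM (expr_logXM _ _ (zXM _)) (expr_logYM _ _ (zXM _)).
by rewrite mulf_div.
Qed.

Lemma beta_alt a : beta a a = 1.
Proof. by rewrite /beta mulnC divff. Qed.

(** [t] keeps the coordinate [I] and negates [J], so it changes the sign of the determinant. *)
Lemma beta_act a b : beta a b * beta (t a) (t b) = 1.
Proof.
have JV (w : k) c : w ^+ M = 1 -> w ^+ J c * w ^+ J (t c) = 1.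
  move=> wM; rewrite -(expr_logYM _ _ wM) (expr_logY (m := 0) wM) ?expr0 //.
  by rewrite neg_mixedM neg_mixed_act mulgV.
have IE c m : z ^+ (I (t c) * m) = z ^+ (I c * m).
  rewrite !(mulnC _ m) !exprM; apply: (expr_logX (zXM m)).
  by rewrite fix_mixed_act logXK.
rewrite /beta mulf_div (mulnC (J a)) (mulnC (J (t a))) !IE !exprM.
by rewrite !(JV _ _ (zXM _)) divr1.
Qed.

Definition beta_twist : twist k to := c2_twist betaM betaMr beta_alt beta_act.

Lemma beta_twistE a b : beta_twist t2 a b = beta a b.
Proof. exact: c2_twistE. Qed.

Lemma beta_gen : beta u v = z.
Proof.
have uX : u \in fixed_mixed_group to by rewrite /= Xu cycle_id.
have vY : v \in inverted_mixed_group to by rewrite /= Yv cycle_id.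
have Iu (w : k) : w ^+ M = 1 -> w ^+ I u = w.
  by move=> wM; rewrite (expr_logX (m := 1) wM) ?expr1 // expg1 (fix_mixed_id n_odd uX).
have Jv (w : k) : w ^+ M = 1 -> w ^+ J v = w.
  by move=> wM; rewrite (expr_logY (m := 1) wM) ?expr1 // expg1 (neg_mixed_id n_odd vY).
have Ju (w : k) : w ^+ M = 1 -> w ^+ J u = 1.
  by move=> wM; rewrite (expr_logY (m := 0) wM) ?expr0 // (neg_mixed_fixed uX).
by rewrite /beta !exprM (Iu _ zM) (Jv _ zM) (Ju _ zM) expr1n divr1.
Qed.

End Beta.

Lemma twist_gen_order (D : twist k to) : D t2 u v ^+ M = 1.
Proof. by rewrite -twX -ou expg_order tw1g. Qed.

(** By [tw_mixed] only the values between powers of [u] and powers of [v] matter. *)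
Lemma twist_beta (D : twist k to) a b : D t2 a b = beta (D t2 u v) a b.
Proof.
rewrite (tw_mixed n_odd) -!logXK -!logYK /beta.
have twXr x c d m : D x c (d ^+ m)%g = D x c d ^+ m.
  by elim: m => [|m IHm]; rewrite ?twg1 // expgS twMr IHm exprS.
rewrite !twX !twXr -!exprM; congr (_ * _); first by rewrite mulnC.
rewrite (mulnC (I b)).
apply: (mulIf (_ : D t2 u v ^+ (J a * I b) != 0)); first by rewrite expf_neq0 ?tw_neq0.
by rewrite -exprMn twC expr1n mulVf // expf_neq0 ?tw_neq0.
Qed.

Lemma twist_trivial (D : twist k to) : M = 1%N -> forall x a b, D x a b = 1.
Proof.
move=> M1 x a b; case: (C2P x) => ->; first exact: tw_id.
have z1 : D t2 u v = 1 by have := twist_gen_order D; rewrite M1.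
by rewrite twist_beta /beta z1 !expr1n divr1.
Qed.

Section Stretch.
Variables (r : nat) (r_gt0 : (0 < r)%N).

(* Multiplies the fixed coordinate by r and leaves the inverted one alone, so
   that it has determinant r on the mixed part. *)
Definition stretch a := (a * fix_mixed to a ^+ r.-1)%g.

Lemma stretchM : {morph stretch : a b / (a * b)%g}.
Proof.
move=> a b; rewrite /stretch fix_mixedM expgMn; last exact: ZnZn_comm.
by rewrite -!mulgA; congr (_ * _)%g; rewrite !mulgA (ZnZn_comm b).
Qed.

Lemma fix_mixed_expg a m : fix_mixed to (a ^+ m)%g = (fix_mixed to a ^+ m)%g.
Proof.
elim: m => [|m IHm]; last by rewrite !expgS fix_mixedM IHm.
by apply: (mulgI (fix_mixed to 1%g)); rewrite -fix_mixedM !mulg1.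
Qed.

Lemma fix_mixed_stretch a : fix_mixed to (stretch a) = (fix_mixed to a ^+ r)%g.
Proof.
by rewrite /stretch fix_mixedM fix_mixed_expg (fix_mixed_id n_odd (fix_mixed_mem to
  a)) -expgS prednK.
Qed.

Lemma neg_mixed_stretch a : neg_mixed to (stretch a) = neg_mixed to a.
Proof.
have aX : (fix_mixed to a ^+ r.-1)%g \in fixed_mixed_group to by rewrite groupX ?fix_mixed_mem.
by rewrite /stretch neg_mixedM (neg_mixed_fixed aX) mulg1.
Qed.

Lemma stretch_act a x : stretch (to a x) = to (stretch a) x.
Proof.
case: (C2P x) => ->; rewrite ?act1 // /stretch gact_morph gact_expg fix_mixed_act.
by have := fix_mixed_mem to a; rewrite inE => /andP[/eqP-> _].
Qed.

End Stretch.

(** The inverse is the stretch by an inverse of [r] modulo [M], the order of [u]. *)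
Lemma stretch_bij r : coprime r M -> (0 < r)%N -> bijective (stretch r).
Proof.
move=> rM r0.
have [r' r'0 r'E] : exists2 r', (0 < r')%N & r * r' = 1 %[mod M].
  case: (egcdnP M r0) => [[|r'] q rE _]; last first.
    by exists r'.+1 => //; rewrite mulnC rE (eqP rM) modnMDl.
  by move: rE; rewrite (eqP rM) addn1 => /eqP; rewrite mul0n.
have K r1 r2 : (0 < r1)%N -> (0 < r2)%N -> r1 * r2 = 1 %[mod M] ->
    cancel (stretch r1) (stretch r2).
  move=> r10 r20 rE a; rewrite {1}/stretch fix_mixed_stretch // /stretch -mulgA.
  rewrite -(expgM (fix_mixed to a)) -(expgD (fix_mixed to a)) -[RHS]mulg1; congr (_ * _)%g.
  (* A stretch multiplies by the power r - 1 of the fixed coordinate, so two of them combine to r1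
     r2 - 1, a multiple of [M]. *)
  have -> : (r1.-1 + r1 * r2.-1 = (r1 * r2).-1)%N.
    by rewrite -[r2 in RHS](prednK r20) mulnS; case: (r1) r10.
  apply: (mulgI (fix_mixed to a)); rewrite -expgS mulg1 prednK ?muln_gt0 ?r10 //.
  rewrite -logXK -(expgM u); apply/eqP.
  by rewrite eq_expg_mod_order ou -modnMmr rE modnMmr muln1.
exists (stretch r'); [exact: K | by apply: K => //; rewrite mulnC].
Qed.

(** Pulling [beta] back along [stretch r] multiplies the determinant by [r]. *)
Lemma beta_stretch (z w : k) (zM : z ^+ M = 1) (wM : w ^+ M = 1) r :
  coprime r M -> (0 < r)%N -> w = z ^+ r ->
  hopf_iso (twalg (beta_twist zM)) (twalg (beta_twist wM)).
Proof.
move=> rM r0 wE; apply: (twalg_iso (s := stretch r)).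
- exact: stretchM.
- exact: stretch_bij.
- exact: stretch_act.
move=> x a b; case: (C2P x) => ->; rewrite ?tw_id // !beta_twistE wE /beta.
have zXM m : (z ^+ m) ^+ M = 1 by rewrite -exprM mulnC exprM zM expr1n.
have IE c m : z ^+ (I (stretch r c) * m) = z ^+ (r * I c * m).
  rewrite !(mulnC _ m) !(exprM z m); apply: (expr_logX (zXM m)).
  by rewrite fix_mixed_stretch // mulnC expgM logXK.
have JE c m : z ^+ (m * J (stretch r c)) = z ^+ (m * J c).
  by rewrite !exprM; apply: (expr_logY (zXM m)); rewrite neg_mixed_stretch logYK.
have E c d : z ^+ (I (stretch r c) * J (stretch r d)) = (z ^+ r) ^+ (I c * J d).
  rewrite -(exprM z) mulnA; exact: etrans (IE c _) (JE d _).
by congr (_ / _); [rewrite E | rewrite (mulnC (J a)) -E mulnC].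
Qed.

End MixedTwists.

(** * Classification *)

(** Chinese remainders: prescribe [j] modulo the part of [M] at the primes of [d], and 1 modulo the
    rest. Two roots of unity of order [d] are related by an exponent prime to [d], whereas
    [stretch_bij] asks for one prime to [M]. *)
Lemma coprime_lift M d j : (0 < M)%N -> (d %| M)%N -> coprime j d ->
  exists r, [/\ (0 < r)%N, coprime r M & r = j %[mod d]].
Proof.
move=> M0 dM cjd; have d0 := dvdn_gt0 M0 dM.
pose m1 := (M`_\pi(d))%N; pose m2 := (M`_\pi(d)^')%N.
have M12 : (m1 * m2)%N = M by rewrite partnC.
have d_m1 : (d %| m1)%N by rewrite -[d](partn_pi d0) partn_dvd.
have c12 : coprime m1 m2 by rewrite coprime_partC.
have j0 : (0 < j + d)%N by rewrite addn_gt0 d0 orbT.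
have cj1 : coprime (j + d) m1.
  rewrite coprime_sym; apply: pnat_coprime (part_pnat _ _) _.
  by rewrite -coprime_pi' // /coprime gcdnDr -/(coprime d j) coprime_sym.
pose r := chinese m1 m2 (j + d) 1.
have r1 : r = j + d %[mod m1] by apply: chinese_modl.
have r2 : r = 1 %[mod m2] by apply: chinese_modr.
(* Adding [M] makes the exponent positive without changing its class. *)
exists (r + M)%N; split.
- by rewrite addn_gt0 M0 orbT.
- rewrite coprime_sym /coprime gcdnDr -/(coprime M r) coprime_sym -M12 coprimeMr.
  by rewrite -coprime_modl r1 coprime_modl cj1 -coprime_modl r2 coprime_modl coprime1n.
have rd : r = j + d %[mod d] by rewrite -(modn_dvdm r d_m1) r1 modn_dvdm.
by rewrite -modnDm (eqP dM) addn0 modn_mod rd modnDr.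
Qed.

(** * Actions by plus or minus the identity on every primary component *)

Section ActionClass.
Variables (n : nat) (n_odd : odd n) (to : groupAction [set: C2] [set: ZnZn n]).

Lemma one_G0m1 (P : pred nat) s : 1%g \in (\prod_(p <- s | P p) primary_comp n p)%g.
Proof.
elim: s => [|p s IHs]; first by rewrite big_nil inE.
rewrite big_cons; case: ifP => // _; rewrite -(mulg1 1%g).
by apply: mem_mulg; rewrite // inE p_elt1.
Qed.

Lemma G0m1_sub p a : p \in primes n -> ~~ acts_pm_id to p ->
  a \in primary_comp n p -> a \in G0m1 to.
Proof.
move=> pn np ap; rewrite /G0m1; elim: (primes n) pn => // q s IHs.
rewrite inE big_cons => /predU1P[<-|/IHs aS].
  by rewrite np -[a]mulg1 mem_mulg // one_G0m1.
by case: ifP => // _; rewrite -[a]mul1g mem_mulg // inE p_elt1.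
Qed.

Lemma G0m1_eq1 : G0m1 to = 1%g <-> {in primes n, forall p, acts_pm_id to p}.
Proof.
split=> [G1 p pn|allP]; last first.
  by rewrite /G0m1 big_seq_cond big1 // => p /andP[/allP->].
apply/negPn/negP => np; have := np; rewrite negb_or => /andP[/forall_inPn[a ap ta] _].
have := G0m1_sub pn np ap; rewrite G1 => /set1P a1.
by move: ta; rewrite a1 gact_one eqxx.
Qed.

Lemma n_of_action1 : G0m1 to = 1%g -> n_of_action to = 1%N.
Proof.
by move=> /G0m1_eq1 allP; rewrite /n_of_action big_seq_cond big1 // => p /andP[/allP->].
Qed.

Lemma nontrivial_action : G0m1 to <> 1%g -> exists a, to a t2 != a.
Proof.
move=> G1; apply/existsP; rewrite -[[exists _, _]]negbK negb_exists.
apply/negP => /forallP fixa; apply/G1/G0m1_eq1 => p _; apply/orP; left.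
by apply/forall_inP => a _; rewrite -[_ == _]negbK.
Qed.

End ActionClass.

Section TrivialTwist.
Variables (k : closedFieldType) (char_k : [pchar k] =i pred0).
Variables (n : nat) (n_odd : odd n) (to : groupAction [set: C2] [set: ZnZn n]).

Lemma trivial_twalg (D : twist k to) : (forall x a b, D x a b = 1) ->
  hopf_iso (twalg D) (group_alg k (sdprod_by to)).
Proof.
move=> D1.
have [B [[BM BC B0] B_act Bn]] := invariant_pairing to (@ZnZn_comm n) (odd_ZnZn n_odd) char_k.
exact: (twalg_sdprod char_k D1 BM BC B_act B0 Bn).
Qed.

Lemma exists_trivial_twist : exists D : twist k to, forall x a b, D x a b = 1.
Proof.
by unshelve eexists; first exists (fun _ _ _ => 1); move=> *; rewrite ?mulr1.
Qed.

End TrivialTwist.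

Theorem theorem6p3 (k : closedFieldType) (char_k : [pchar k] =i pred0)
    (n : nat) (n_odd : odd n) (to : groupAction [set: C2] [set: ZnZn n]) :
  (G0m1 to = 1%g ->
     in_Ext to (group_alg k (sdprod_by to)) /\
     forall H : hopfAlgType k, in_Ext to H ->
       hopf_iso H (group_alg k (sdprod_by to))) /\
  (G0m1 to <> 1%g ->
     exists Phi : {group Zn (n_of_action to)} -> hopfAlgType k,
       [/\ forall S, in_Ext to (Phi S),
           forall S T, hopf_iso (Phi S) (Phi T) -> S = T,
           forall H : hopfAlgType k, in_Ext to H ->
             exists S, hopf_iso H (Phi S),
           hopf_iso (Phi 1%G) (group_alg k (sdprod_by to))
         & forall S, trivial_hopf (Phi S) <-> S = 1%G]).
Proof.
have [u [v [Xu Yv ou ov]]] := mixed_generators n_odd to.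
have [I IK] : exists I, forall a, (u ^+ I a)%g = fix_mixed to a.
  by exists (fun a => clog u (fix_mixed to a)) => a; rewrite clogK // -Xu fix_mixed_mem.
have [J JK] : exists J, forall a, (v ^+ J a)%g = neg_mixed to a.
  by exists (fun a => clog v (neg_mixed to a)) => a; rewrite clogK // -Yv neg_mixed_mem.
split=> [G1|G1].
  split=> [|H HE].
    have [D D1] := exists_trivial_twist k to.
    exact: hopf_iso_Ext (trivial_twalg char_k n_odd D1) (tw_in_Ext D).
  have [D HD] := Ext_twalg n_odd HE.
  apply: hopf_iso_trans HD (trivial_twalg char_k n_odd _).
  exact: (twist_trivial n_odd ou IK JK D (n_of_action1 G1)).
set M := n_of_action to.
have M0 : (0 < M)%N := n_of_action_gt0 to.
have [z z_prim] := exists_prim_root char_k M0.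
have SM (S : {group Zn M}) : (#|S| %| M)%N.
  by have := cardSg (subsetT S); rewrite cardsT card_Zn.
(* A root of unity of order exactly |S|; subgroups of a cyclic group are determined by their orders,
   so [S] can be recovered from it. *)
pose zS (S : {group Zn M}) := z ^+ (M %/ #|S|).
have zS_prim (S : {group Zn M}) : #|S|.-primitive_root (zS S) by apply: dvdn_prim_root.
have zSM (S : {group Zn M}) : zS S ^+ M = 1 by apply/eqP; rewrite -(prim_order_dvd (zS_prim S)).
pose Phi (S : {group Zn M}) : hopfAlgType k := twalg (beta_twist (to := to) ou ov IK JK (zSM S)).
have PhiE S a b : beta_twist (to := to) ou ov IK JK (zSM S) t2 a b = beta I J (zS S) a b.
  exact: beta_twistE.
have Phi_gen S : beta I J (zS S) u v = zS S.
  exact: (beta_gen n_odd Xu Yv ou ov IK JK (zSM S)).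
have cardS1 (S : {group Zn M}) : zS S = 1 -> S = 1%G.
  move=> z1; apply/val_inj/eqP; rewrite /= trivg_card1 -dvdn1.
  by rewrite (prim_order_dvd (zS_prim S)) z1 expr1n.
(* By [twalg_iso_twist] the root for [T] is a value of the bicharacter for [S], hence killed by
   |S|. *)
have iso_dvd S T : hopf_iso (Phi S) (Phi T) -> (#|T| %| #|S|)%N.
  move=> /(twalg_iso_twist char_k (odd_ZnZn n_odd) (@ZnZn_comm n))[s sE].
  rewrite (prim_order_dvd (zS_prim T)) -(Phi_gen T) -PhiE sE PhiE /beta.
  rewrite expr_div_n -!exprM !(mulnC _ #|S|) !exprM (prim_expr_order (zS_prim S)).
  by rewrite !expr1n divr1.
have Phi1 : hopf_iso (Phi 1%G) (group_alg k (sdprod_by to)).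
  apply: (trivial_twalg char_k n_odd) => x a b; case: (C2P x) => ->; first exact: tw_id.
  rewrite PhiE /beta.
  have z1 : zS 1%G = 1 by have := prim_expr_order (zS_prim 1%G); rewrite cards1.
  by rewrite z1 !expr1n divr1.
exists Phi; split=> //.
- by move=> S; apply: tw_in_Ext.
- move=> S T ST; apply/val_inj/eqP => /=.
  rewrite (eq_subG_cyclic (Zn_cyclic M)) ?subsetT // eqn_dvd.
  by rewrite (iso_dvd _ _ ST) (iso_dvd _ _ (hopf_iso_sym ST)).
- move=> H HE; have [D HD] := Ext_twalg n_odd HE.
  pose w := D t2 u v.
  have wM : w ^+ M = 1 := twist_gen_order v ou D.
  have [d w_prim dM] := prim_order_exists M0 wM.
  have [S cardS] : exists S : {group Zn M}, #|S| = d.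
    have /cyclicP[g gE] := Zn_cyclic M.
    have og : #[g]%g = M by rewrite /order -gE cardsT card_Zn.
    exists <[g ^+ (M %/ d)]>%G; rewrite -[#|_|]/(#[(g ^+ (M %/ d))%g]%g).
    by rewrite orderXdiv og ?dvdn_div // divnA // mulKn.
  have zS_d := zS_prim S; rewrite cardS in zS_d.
  (* [w] and the root chosen for [S] are both primitive of order [d], so they differ by an exponent
     prime to [d], which is then lifted to one prime to [M]. *)
  have [j wE] := prim_rootP zS_d (prim_expr_order w_prim).
  have cjd : coprime j d by rewrite -(prim_root_exp_coprime j zS_d) -wE.
  have [r [r0 rM rj]] := coprime_lift M0 dM cjd.
  have wr : w = zS S ^+ r.
    by rewrite wE -(prim_expr_mod zS_d j) -rj (prim_expr_mod zS_d).
  exists S; apply: hopf_iso_trans HD (hopf_iso_sym _).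
  apply: hopf_iso_trans (beta_stretch n_odd ou ov IK JK (zSM S) wM rM r0 wr) _.
  apply: C2_twalg_iso => a b; rewrite beta_twistE.
  exact: (twist_beta n_odd IK JK D a b).
move=> S; split=> [trivS|->]; last by left; exists (sdprod_by to).
apply: cardS1; case: trivS => [grpS|[K dualK grpK]].
  by rewrite -(Phi_gen S) -PhiE (group_algebra_twist (odd_ZnZn n_odd) grpS).
(* The dual of a group algebra would force the trivial action, which [G1] excludes. *)
have [a] := nontrivial_action G1.
by rewrite (dual_group_algebra_action dualK grpK) eqxx.
Qed.
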